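(* Let $G_t$ be the convolution kernel on $\mathbb{R}^3$ of the Fourier multiplier with symbol $E_{\beta,1}(-\nu t^\beta|\xi|^\alpha)$, with $\alpha\in(1,2)$ and $\beta\in(0,1)$. Then $G_t\ge0$, $\int_{\mathbb{R}^3}G_t(x)\,\mathrm{d}x=1$, and there is a constant $C>0$ such that, for $|x|\ge t^{\beta/\alpha}$, \[ G_t(x)\le\frac{C}{\Gamma(\beta+1)}\,\frac{t^{\beta}}{|x|^{3+\alpha}} . \] In particular the far field decays only algebraically.
   Context: $E_{\beta,1}(z)=\sum_{k\ge0}z^k/\Gamma(\beta k+1)$ is the Mittag-Leffler function; $\nu>0$ is a fixed constant (viscosity) and $t>0$. The far field is the behavior of $G_t(x)$ for large $|x|$. *)

(* Defs.v *)
From HB Require Import structures.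
From mathcomp Require Import all_boot all_order all_algebra.
From mathcomp Require Import complex.
From mathcomp Require Import all_classical all_reals all_analysis.

Set Implicit Arguments.
Unset Strict Implicit.
Unset Printing Implicit Defensive.

Import Order.TTheory GRing.Theory Num.Theory.
Import numFieldNormedType.Exports.

Local Open Scope classical_set_scope.
Local Open Scope complex_scope.
Local Open Scope ring_scope.

Definition Gamma (R : realType) (s : R) : R :=
  \int[@lebesgue_measure R]_(x in `]0, +oo[) (x `^ (s - 1) * expR (- x)).

(* E_{b,1}, at real arguments only. *)
Definition mittag_leffler (R : realType) (b z : R) : R :=
  limn (series (fun k : nat => z ^+ k / Gamma (b * k%:R + 1))).

Lemma sigma_finite_prod (d1 d2 : measure_display) (T1 : measurableType d1)
    (T2 : measurableType d2) (R : realType)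
    (m1 : {sigma_finite_measure set T1 -> \bar R})
    (m2 : {sigma_finite_measure set T2 -> \bar R}) :
  sigma_finite setT (m1 \x m2)%E.
Proof.
have /sigma_finiteP[F [TF ndF Foo]] := sigma_finiteT m1.
have /sigma_finiteP[G [TG ndG Goo]] := sigma_finiteT m2.
exists (fun n => F n `*` G n).
  rewrite -setXTT TF TG predeqE => -[x y]; split.
    move=> [/= [n _ Fnx] [k _ Gky]]; exists (maxn n k) => //; split.
    - by move: x Fnx; exact/subsetPset/ndF/leq_maxl.
    - by move: y Gky; exact/subsetPset/ndG/leq_maxr.
  by move=> [n _ []/= ? ?]; split; exists n.
move=> k; have [? ?] := Foo k; have [? ?] := Goo k.
split; first exact: measurableX.
by rewrite product_measure1E// lte_mul_pinfty// ge0_fin_numE.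
Qed.

(* R^3 is the product R * R * R, which carries a product Lebesgue measure.
   The library norm `|x| on it is the sup norm, so the Euclidean norm is
   defined separately. *)
Definition lebesgue2 (R : realType) :
    set (measurableTypeR R * measurableTypeR R) -> \bar R :=
  (lebesgue_measure \x lebesgue_measure)%E.

Arguments lebesgue2 : clear implicits.

HB.instance Definition _ (R : realType) := Measure.on (lebesgue2 R).

HB.instance Definition _ (R : realType) :=
  @Measure_isSigmaFinite.Build _ _ _ (lebesgue2 R)
    (sigma_finite_prod lebesgue_measure lebesgue_measure).

Definition lebesgue3 (R : realType) :
    set (measurableTypeR R * measurableTypeR R * measurableTypeR R) ->
    \bar R :=
  (lebesgue2 R \x lebesgue_measure)%E.

Arguments lebesgue3 : clear implicits.

HB.instance Definition _ (R : realType) := Measure.on (lebesgue3 R).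

HB.instance Definition _ (R : realType) :=
  @Measure_isSigmaFinite.Build _ _ _ (lebesgue3 R)
    (sigma_finite_prod (lebesgue2 R) lebesgue_measure).

Definition dot3 (R : realType) (x y : R * R * R) : R :=
  x.1.1 * y.1.1 + x.1.2 * y.1.2 + x.2 * y.2.

Definition enorm3 (R : realType) (x : R * R * R) : R := Num.sqrt (dot3 x x).

Definition basis3 (R : realType) (i : 'I_3) : R * R * R :=
  ((i == 0)%:R, (i == 1)%:R, (i == 2)%:R).

(* Iterated partial derivative along the coordinates listed in s (the last one
   being taken first). *)
Definition partials (R : realType) (s : seq 'I_3) (f : R * R * R -> R) :
    R * R * R -> R :=
  foldr (fun i g => 'D_(basis3 R i) g) f s.

(* The Schwartz class: for every s, the derivative along s exists, and decays
   faster than every power. 'D_v is a total operator, hence the explicit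
   differentiability requirement. *)
Definition schwartz (R : realType) (f : R * R * R -> R) : Prop :=
  forall s : seq 'I_3,
    (forall x, differentiable (partials s f) x) /\
    (forall n : nat, exists M : R,
       forall x, enorm3 x ^+ n * `|partials s f x| <= M).

(* exp (i theta) *)
Definition cis (R : realType) (theta : R) : R[i] := cos theta +i* sin theta.

Definition cintegral3 (R : realType) (f : R * R * R -> R[i]) : R[i] :=
  (\int[lebesgue3 R]_x complex.Re (f x)) +i*
  (\int[lebesgue3 R]_x complex.Im (f x)).

Definition fourier (R : realType) (f : R * R * R -> R[i]) (xi : R * R * R) :
    R[i] :=
  cintegral3 (fun x => f x * cis (- dot3 x xi)).

Definition inv_fourier (R : realType) (g : R * R * R -> R[i])
    (x : R * R * R) : R[i] :=
  (((2 * pi) ^+ 3)^-1)%:C * cintegral3 (fun xi => g xi * cis (dot3 x xi)).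

Definition fourier_multiplier (R : realType) (m f : R * R * R -> R[i]) :
    R * R * R -> R[i] :=
  inv_fourier (fun xi => m xi * fourier f xi).

Definition convolution3 (R : realType) (G f : R * R * R -> R) (x : R * R * R) :
    R :=
  \int[lebesgue3 R]_y (G y * f (x - y)).

(* The operator with symbol m is convolution with G on the Schwartz class.
   Neither sign nor integrability of G itself is imposed. Real-valued test
   functions are enough by linearity. Such a G is unique up to a.e. equality. *)
Definition is_convolution_kernel (R : realType) (m : R * R * R -> R[i])
    (G : R * R * R -> R) : Prop :=
  measurable_fun
    [set: measurableTypeR R * measurableTypeR R * measurableTypeR R] G /\
  (forall f : R * R * R -> R, schwartz f -> forall x,
     (lebesgue3 R).-integrable setT (fun y => (G y * f (x - y))%:E) /\
     (convolution3 G f x)%:C = fourier_multiplier m (fun y => (f y)%:C) x).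

Definition mittag_leffler_symbol (R : realType) (nu alpha beta t : R)
    (xi : R * R * R) : R[i] :=
  (mittag_leffler beta (- nu * t `^ beta * enorm3 xi `^ alpha))%:C.

(* G(x) = O(|x|^-p) as |x| -> +oo, for G known up to a.e. equality. *)
Definition decays_at_rate (R : realType) (G : R * R * R -> R) (p : R) : Prop :=
  exists M : R, exists r : R,
    {ae lebesgue3 R, forall x,
       r <= enorm3 x -> `|G x| <= M * enorm3 x `^ (- p)}.

(* The far field decays like a negative power of |x|, but not faster than all
   of them. *)
Definition decays_only_algebraically (R : realType) (G : R * R * R -> R) :
    Prop :=
  (exists2 p : R, 0 < p & decays_at_rate G p) /\
  (exists p : R, ~ decays_at_rate G p).

(* Main.v *)
(* The symbol is a mixture of Gaussians: with [g = alpha / 2], Bernstein-type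
   subordination writes [exp (- l^g)] and [E_beta (- z)] as Laplace transforms of
   probability laws (the one-sided stable law, a limit of laws of partial sums of
   heavy-tailed variables, and the law of [S^(- beta)] for [S] one-sided
   [beta]-stable), hence [E_beta (- nu t^beta l^g) = E (exp (- l X))] for some
   positive random variable [X]. Therefore [G_t] is the heat kernel averaged over
   the random time [X], which gives positivity and unit mass. The heat kernel
   satisfies [h_u(x) <= 31 |x|^-3 (1 - exp (- u / |x|^2))], so that
   [G_t(x) <= 31 |x|^-3 (1 - E_beta (- nu t^beta |x|^(- alpha)))], and the far field
   bound follows from [1 - E_beta (- z) <= z / Gamma (beta + 1)].
   The kernel is determined almost everywhere by its action on the functions
   [exp (- |x|^2 - sum_i exp (k_i x_i + c_i))], which approximate indicators of
   orthants. *)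

Require Import Defs.
From HB Require Import structures.
From mathcomp Require Import all_boot all_order all_algebra.
From mathcomp Require Import complex.
From mathcomp Require Import all_classical all_reals all_analysis.
From mathcomp Require Import measurable_realfun.
From mathcomp Require Import ring lra.

Set Implicit Arguments.
Unset Strict Implicit.
Unset Printing Implicit Defensive.

Import Order.TTheory GRing.Theory Num.Theory.
Import numFieldNormedType.Exports.

Local Open Scope classical_set_scope.
Local Open Scope ring_scope.

Implicit Types R : realType.

Local Notation mu := lebesgue_measure.
Local Notation space3 R := (measurableTypeR R * measurableTypeR R * measurableTypeR R)%type.

(** The obstacle to the far field bound is that [X] has infinite mean, since [1 - E (exp (- l X))]
    is of order [l^g] with [g < 1]; an estimate of [h_u(x)] linear in [u] therefore gives nothing
    after averaging. A bound by a multiple of [1 - exp (- u / |x|^2)] instead turns the average into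
    a single evaluation of the symbol, at [l = |x|^-2]. A convolution kernel is given only through
    its action on Schwartz functions, with no sign or integrability of its own. All properties are
    therefore proved for the explicit average of heat kernels and then carried over by uniqueness.
    No infinite independent sequence is built: finite products of probability spaces suffice, and
    the stable law arises as a limit of distribution functions. Nor is a Fourier inversion theorem
    used: Fubini reduces every multiplier to Gaussian ones, whose transforms are explicit. *)

(** * Affine change of variables and products of probabilities *)

(** The image of [mu] under the affine map, scaled by [|a|], has the right value on the intervals
    []c, d]], and this characterizes Lebesgue measure. For [a < 0] the preimage is closed at the
    other end, with the same length. *)
Lemma ge0_integral_affine R (a b : R) (f : R -> \bar R) :
  a != 0 -> measurable_fun [set: R] f -> (forall x, 0 <= f x)%E ->
  (\int[mu]_x f x =
     `|a|%:E * \int[mu]_x f (a * x + b)%R)%E.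
Proof.
move=> a0 mf f0.
have mphi : measurable_fun [set: R]
    ((fun x => a * x + b) : measurableTypeR R -> measurableTypeR R).
  by apply: measurable_funD => //; exact: measurable_funM.
pose nu : {measure set (measurableTypeR R) -> \bar R} :=
  mscale (NngNum (normr_ge0 a))
    (pushforward mu
       ((fun x => a * x + b) : measurableTypeR R -> measurableTypeR R)).
have lnu A : measurable A -> mu A = nu mphi A.
  apply: lebesgue_measure_unique => X [[c d] _ <-] /=.
  rewrite /nu /mscale /= /pushforward lebesgue_measure_itv/=.
  have [a_gt0|a_lt0|] := ltgtP 0 a; last by move=> e; rewrite -e eqxx in a0.
  - have -> : (fun x => a * x + b) @^-1` `]c, d] =
        `](c - b) / a, (d - b) / a]%classic.
      apply/seteqP; split=> x /=; rewrite !in_itv/= ltr_pdivrMr// ler_pdivlMr//;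
      lra.
    rewrite lebesgue_measure_itv/= !lte_fin ltr_pM2r ?invr_gt0// ltrD2r.
    case: ifPn => cd; last by rewrite mule0.
    by rewrite -!EFinD -EFinM gtr0_norm//; congr EFin; field.
  - have -> : (fun x => a * x + b) @^-1` `]c, d] =
        `[(d - b) / a, (c - b) / a[%classic.
      apply/seteqP; split=> x /=; rewrite !in_itv/= ler_ndivrMr// ltr_ndivlMr//;
      lra.
    rewrite lebesgue_measure_itv/= !lte_fin ltr_nM2r ?invr_lt0// ltrD2r.
    case: ifPn => cd; last by rewrite mule0.
    by rewrite -!EFinD -EFinM ltr0_norm//; congr EFin; field.
rewrite (@eq_measure_integral _ _ _ _ (nu mphi)); last by move=> A mA _; exact: lnu.
rewrite /nu ge0_integral_mscale//= ge0_integral_pushforward//=.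
Qed.

Lemma probability_prod R d1 d2 (T1 : measurableType d1)
    (T2 : measurableType d2) (P1 : probability T1 R) (P2 : probability T2 R) :
  exists P : probability (T1 * T2)%type R, P = (P1 \x P2)%E :> (set _ -> \bar R).
Proof.
have PT : (P1 \x P2)%E setT = 1%E.
  by rewrite -setXTT product_measure1E// [X in (X * _)%E]probability_setT [X in (_ * X)%E]probability_setT mule1.
pose Q : probability (T1 * T2)%type R :=
  HB.pack (P1 \x P2)%E (Measure_isProbability.Build _ _ _ (P1 \x P2)%E PT).
by exists Q.
Qed.

Lemma measurable_expRNM R d (T : measurableType d) (X : T -> R) (l : R) :
  measurable_fun setT X -> measurable_fun setT (fun t => expR (- (l * X t))).
Proof.
move=> mX; apply: measurableT_comp => //; apply: measurable_funN.
exact: measurable_funM.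
Qed.

(** * Laplace transforms of probability laws *)

(** By Bernstein's theorem these are the completely monotone functions on [l > 0] tending to 1 at 0.
    The probability space is existential because products and limits change it. *)
Definition laplace_mix R (phi : R -> R) : Prop :=
  exists d (T : measurableType d) (P : probability T R) (X : T -> R),
    [/\ measurable_fun setT X, (forall t, 0 <= X t) &
        forall l, 0 < l -> (\int[P]_t (expR (- (l * X t)))%:E)%E = (phi l)%:E].

(** The product is realized by a sum of independent variables on the product space. *)
Lemma laplace_mixM R (phi psi : R -> R) :
  laplace_mix phi -> laplace_mix psi -> laplace_mix (fun l => phi l * psi l).
Proof.
move=> [d1 [T1 [P1 [X1 [mX1 X10 L1]]]]] [d2 [T2 [P2 [X2 [mX2 X20 L2]]]]].
have [P PE] := probability_prod P1 P2.
exists _, _, P, (fun t => X1 t.1 + X2 t.2); split.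
- by apply: measurable_funD; exact: measurableT_comp.
- by move=> t; rewrite addr_ge0.
move=> l l0.
have mE (d : measure_display) (T : measurableType d) (X : T -> R) : measurable_fun setT X ->
    measurable_fun setT (fun t => (expR (- (l * X t)))%:E).
  by move=> mX; apply/measurable_EFinP; exact: measurable_expRNM.
rewrite PE fubini_tonelli1/=; last 2 first.
- apply: (mE _ _ (fun t => X1 t.1 + X2 t.2)).
  by apply: measurable_funD; exact: measurableT_comp.
- by move=> x; rewrite lee_fin expR_ge0.
rewrite /fubini_F/=.
under eq_integral => x _.
  under eq_integral => y _ do rewrite mulrDr opprD expRD EFinM.
  rewrite ge0_integralZl//; last exact: mE.
  rewrite L2//.
  over.
rewrite ge0_integralZr//.
- by rewrite L1.
- exact: mE.
- by rewrite -L2//; apply: integral_ge0 => y _; rewrite lee_fin expR_ge0.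
Qed.

Lemma laplace_mixX R (phi : R -> R) n :
  laplace_mix phi -> laplace_mix (fun l => phi l ^+ n.+1).
Proof.
move=> Lphi; elim: n => [|n IHn].
  by under eq_fun do rewrite expr1.
under eq_fun do rewrite exprS.
exact: laplace_mixM.
Qed.

Lemma le_limn_einf R (u v : (\bar R)^nat) (l : \bar R) :
  (forall n, v n <= u n)%E -> v n @[n --> \oo] --> l -> (l <= limn_einf u)%E.
Proof.
move=> vu vl; rewrite -(cvg_limn_einf_sup vl).1 !limn_einf_lim.
apply: lee_lim; [exact: is_cvg_einfs|exact: is_cvg_einfs|].
apply: nearW => n; apply: le_ereal_inf_tmp => _ [m /= nm <-].
by apply: le_trans (vu m); apply: ereal_inf_lbound; exists m.
Qed.

Lemma derivable_continuous R (f : R -> R) :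
  (forall x, derivable f x 1) -> continuous f.
Proof.
move=> df x; apply: (@differentiable_continuous _ R^o R^o).
by apply/derivable1_diffP; exact: df.
Qed.

Lemma measurable_fun_limn_einf d (T : measurableType d) R
    (D : set T) (f : (T -> \bar R)^nat) :
  (forall n, measurable_fun D (f n)) ->
  measurable_fun D (fun x => limn_einf (f ^~ x)).
Proof.
move=> mf; rewrite (_ : (fun x => _) =
    (fun x => - limn_esup (fun n => - f n x)))%E; last first.
  by apply/funext => x; rewrite -limn_einfN; congr limn_einf; apply/funext => n/=;
     rewrite oppeK.
apply: measurableT_comp => //; apply: measurable_fun_limn_esup => n.
exact: measurableT_comp.
Qed.

Lemma integral_exp_tail R (l x : R) : 0 < l ->
  (\int[mu]_(u in `[x, +oo[) (l * expR (- (l * u)))%:E =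
   (expR (- (l * x)))%:E)%E.
Proof.
move=> l0.
have dF u : is_derive u (1:R) (fun u : R => - expR (- (l * u))) (l * expR (- (l * u))).
  by apply: is_derive_eq; rewrite /GRing.scale/=; ring.
rewrite (@ge0_continuous_FTC2y R _ (fun u => - expR (- (l * u))) _ 0).
- by rewrite sub0e -EFinN opprK.
- by move=> u _; rewrite mulr_ge0 ?expR_ge0// ltW.
- apply: continuous_subspaceT => u.
  by apply: derivable_continuous => {}u; exact: ex_derive.
- rewrite -oppr0; apply: cvgN.
  apply: (cvg_comp (fun u => l * u) (fun y => expR (- y))); last exact: cvgr_expR.
  exact: gt0_cvgMry.
- by move=> u _; exact: ex_derive.
- apply: cvg_at_right_filter.
  apply: (@derivable_continuous _ (fun u : R => - expR (- (l * u)))) => u.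
  exact: ex_derive.
- by move=> u _; rewrite derive1E; exact: derive_val.
Qed.

(** Tonelli, applied to [exp (- l X)] written as the integral of [l exp (- l u)] over [u >= X]. The
    law then enters only through its distribution function, integrated against a fixed density,
    which is the form in which limits are taken. *)
Lemma integral_exp_cdf R d (T : measurableType d)
    (P : probability T R) (X : T -> R) (l : R) :
  measurable_fun setT X -> 0 < l ->
  (\int[P]_t (expR (- (l * X t)))%:E =
   \int[mu]_u
     ((l * expR (- (l * u)))%:E * P [set t | (X t <= u)%R]))%E.
Proof.
move=> mX l0.
pose f (z : T * measurableTypeR R) : \bar R :=
  ((l * expR (- (l * z.2))) * \1_[set z | X z.1 <= z.2] z)%:E.
have mA : measurable [set z : T * measurableTypeR R | X z.1 <= z.2].
  rewrite (_ : [set _ | _] = (fun z : T * measurableTypeR R => X z.1 <= z.2) @^-1` [set true])//.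
  rewrite -[X in measurable X]setTI; apply: measurable_fun_ler => //.
  exact: measurableT_comp.
have mw : measurable_fun setT (fun u : R => l * expR (- (l * u))).
  by apply: measurable_funM => //; exact: measurable_expRNM.
have mf : measurable_fun setT f.
  apply/measurable_EFinP; apply: measurable_funM.
    exact: (measurableT_comp mw).
  exact: measurable_indic.
have f0 z : (0 <= f z)%E.
  by rewrite /f lee_fin !mulr_ge0 ?expR_ge0// ltW.
have := @fubini_tonelli _ _ _ _ R P mu f mf f0.
rewrite /f/= => FT.
transitivity (\int[P]_x \int[mu]_y
    ((l * expR (- (l * y)))%R * \1_[set z | X z.1 <= z.2] (x, y))%:E)%E.
  apply: eq_integral => t _; rewrite -(integral_exp_tail _ l0) integral_mkcond.
  apply: eq_integral => u _; rewrite patchE/= indicE/=.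
  have [h|h] := leP (X t) u.
    by rewrite !mem_set ?mulr1//= in_itv/= h.
  by rewrite !memNset ?mulr0//=; rewrite ?in_itv/= ?andbT leNgt h.
rewrite FT; apply: eq_integral => u _.
under eq_integral do rewrite EFinM.
rewrite ge0_integralZl//=; last 2 first.
- apply/measurable_EFinP; apply/measurable_indic.
  by rewrite -[X in measurable X]setTI; apply: measurable_fun_ler.
- by rewrite lee_fin mulr_ge0 ?expR_ge0// ltW.
congr (_ * _)%E.
have -> : (fun x => (\1_[set z : T * R | X z.1 <= z.2] (x, u))%:E) =
          (fun x => (\1_[set t | X t <= u] x)%:E : \bar R).
  by apply/funext => t; rewrite !indicE; congr ((nat_of_bool _)%:R%:E); apply/idP/idP;
     rewrite !inE.
rewrite integral_indic// ?setIT//.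
by rewrite -[X in measurable X]setTI; apply: measurable_fun_ler.
Qed.

(** * Helly selection and limits of Laplace transforms *)

(** Tychonoff gives a cluster point [G] in the product of copies of [[0, 1]]; monotonicity passes to
    it because it involves two coordinates at a time. Countability of the rationals then yields a
    sequence: [F (s j)] is within [1 / (j + 1)] of [G] at the first [j] rationals in the order of
    [pickle]. The condition [j <= s j] is what makes [s] tend to infinity. *)
Lemma helly_selection R (F : nat -> R -> R) :
  (forall k, {homo F k : x y / x <= y}) -> (forall k x, 0 <= F k x <= 1) ->
  exists (s : nat -> nat) (G : R -> R),
    [/\ forall j, (j <= s j)%N, {homo G : x y / x <= y},
        forall x, 0 <= G x <= 1 &
        forall q : rat, F (s j) (ratr q) @[j --> \oo] --> G (ratr q)].
Proof.
move=> ndF F01.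
have cpt : forall x : R, compact (`[0, 1] : set R) by move=> x; exact: segment_compact.
have [|G [G01 clG]] := @tychonoff R (fun=> R) (fun=> `[0, 1]%classic) cpt (F @ \oo) _.
  by exists 0%N => // k _ x /=; rewrite in_itv/= F01.
pose ptws := ArrowAsProduct.prod__canonical__topology_structure_Topological (fun _ : R => R).
have nG x e : 0 < e -> nbhs (G : ptws) [set g | `|g x - G x| < e].
  move=> e0; have := @proj_continuous R (fun=> R) x G.
  move=> /(_ [set y | `|y - G x| < e]); apply.
  apply/nbhs_ballP; exists e => //= y; rewrite /ball/= distrC//.
have FG A n : nbhs (G : ptws) A -> exists2 k, (n <= k)%N & A (F k).
  move=> nA.
  have [|g [[k /= nk <-] Ag]] := clG [set F k | k in [set k | (n <= k)%N]] A _ nA.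
    by exists n => // k /= nk; exists k.
  by exists k.
have nGn n e : 0 < e -> nbhs (G : ptws) [set g |
    forall q : rat, (pickle q < n)%N -> `|g (ratr q) - G (ratr q)| < e].
  move=> e0; elim: n => [|n IHn]; first by apply: filterS filterT.
  have [[q qn]|nq] := pselect (exists q : rat, pickle q = n); last first.
    apply: filterS IHn => g /= gn q; rewrite ltnS leq_eqVlt => /orP[/eqP qn|]; last exact: gn.
    by exfalso; apply: nq; exists q.
  apply: filterS2 IHn (nG (ratr q) e e0) => g /= gn gq q'.
  rewrite ltnS leq_eqVlt => /orP[/eqP qn'|]; last exact: gn.
  have -> // : q' = q by apply: (pcan_inj pickleK); rewrite qn qn'.
have /choice[s sP] : forall j, exists k, (j <= k)%N /\
    forall q : rat, (pickle q < j)%N -> `|F k (ratr q) - G (ratr q)| < j.+1%:R^-1.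
  move=> j; have [|k jk Fk] := FG _ j (nGn j j.+1%:R^-1 _); first by rewrite invr_gt0.
  by exists k.
exists s, G; split.
- by move=> j; have [] := sP j.
- move=> x y xy; rewrite leNgt; apply/negP => Gyx.
  pose e := (G x - G y) / 2.
  have e0 : 0 < e by rewrite divr_gt0// subr_gt0.
  have [k _ /= [Fx Fy]] := FG _ 0%N (filterI (nG x e e0) (nG y e e0)).
  have := ndF k _ _ xy; move: Fx Fy; rewrite !ltr_norml /e; lra.
- by move=> x; have /= := G01 x; rewrite in_itv.
- move=> q; apply/cvgrPdist_lt => e e0.
  near=> j.
  have [_ /(_ q)] := sP j; rewrite distrC => /(_ _)/lt_trans -> //.
  + near: j; exact: nbhs_infty_gt.
  + near: j; exact: (near_infty_natSinv_lt (PosNum e0)).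
Unshelve. all: by end_near. Qed.

Lemma le_exp_itv R (a r p : R) : 0 < a -> 0 <= r <= 1 ->
  (forall h, 0 < h -> expR (- (a * h)) * r <= p) -> r <= p.
Proof.
move=> a0 /andP[r0 r1] H; apply/ler_addgt0Pr => e e0.
have /H : 0 < e / a by rewrite divr_gt0.
have -> : a * (e / a) = e by field; rewrite gt_eqF.
move=> rp; have := expR_ge1Dx (- e) => ee.
have : (1 + - e) * r <= p by apply: le_trans rp; rewrite ler_wpM2r.
nra.
Qed.

(** The density has mass 1 on the half-line, so a lower bound for the complement of [f] is an upper
    bound for [f]. *)
Lemma integral_exp_compl R (l : R) (f : R -> R) : 0 < l ->
  measurable_fun [set: R] f -> (forall u, 0 <= f u <= 1) ->
  (forall u, u < 0 -> f u = 0) ->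
  (\int[mu]_u (l * expR (- (l * u)) * f u)%:E +
   \int[mu]_u (l * expR (- (l * u)) * (\1_`[0%R, +oo[ u - f u))%:E
   = 1)%E.
Proof.
move=> l0 mf f01 fneg.
have mw : measurable_fun [set: R] (fun u : R => l * expR (- (l * u))).
  by apply: measurable_funM => //; exact: measurable_expRNM.
have w0 u : 0 <= l * expR (- (l * u)) by rewrite mulr_ge0 ?expR_ge0// ltW.
have mI : measurable_fun [set: R] (\1_`[0, +oo[%classic : R -> R).
  by apply: measurable_indic.
have f1 u : 0 <= \1_`[0, +oo[%classic u - f u.
  rewrite indicE; have [u0|u0] := leP 0 u.
    by rewrite mem_set/= ?in_itv/= ?u0// subr_ge0; case/andP: (f01 u).
  by rewrite memNset/= ?in_itv/= ?andbT ?fneg// ?subrr// leNgt u0.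
rewrite -ge0_integralD//=; last 4 first.
- by move=> u _; rewrite lee_fin mulr_ge0//; case/andP: (f01 u).
- by apply/measurable_EFinP; exact: measurable_funM.
- by move=> u _; rewrite lee_fin mulr_ge0.
- by apply/measurable_EFinP; apply: measurable_funM => //; exact: measurable_funB.
rewrite -[RHS](_ : (expR (- (l * 0)))%:E = _); last by rewrite mulr0 oppr0 expR0.
rewrite -(integral_exp_tail 0 l0) [RHS]integral_mkcond.
apply: eq_integral => u _; rewrite patchE -EFinD -mulrDr addrC subrK indicE.
by case: ifP => _; rewrite ?mulr1 ?mulr0.
Qed.

Lemma nondecreasing_measurableT R (f : R -> R) :
  {homo f : x y / x <= y} -> measurable_fun [set: R] f.
Proof. by move=> ndf; apply: nondecreasing_measurable. Qed.

Lemma adde_eq1 (R : realDomainType) (x y : \bar R) :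
  (0 <= x -> 0 <= y -> x + y = 1 ->
   exists r : R, [/\ (0 <= r <= 1)%R, x = r%:E & y = (1 - r)%:E])%E.
Proof.
case: x y => [x| |] [y| |] //; rewrite !lee_fin => x0 y0 [xy].
by exists x; split; rewrite ?x0 -?xy ?lerDl// addrAC subrr add0r.
Qed.

(** The [F j] need not converge at jumps of [H], so dominated convergence is replaced by two uses of
    Fatou: on [F j], which bounds the integral of [H (u - h)] by [p], and on the complements, which
    gives the reverse inequality for [H]. *)
Lemma exp_integral_squeeze R (l p : R) (F : nat -> R -> R)
    (H : R -> R) :
  0 < l ->
  (forall j, {homo F j : x y / x <= y}) -> (forall j u, 0 <= F j u <= 1) ->
  (forall j u, u < 0 -> F j u = 0) ->
  {homo H : x y / x <= y} -> (forall u, 0 <= H u <= 1) ->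
  (forall u, u < 0 -> H u = 0) ->
  (forall u h, 0 < h -> ((l * expR (- (l * u)) * H (u - h))%:E <=
     limn_einf (fun j => (l * expR (- (l * u)) * F j u)%:E))%E) ->
  (forall u, ((l * expR (- (l * u)) * (\1_`[0%R, +oo[ u - H u))%:E <=
     limn_einf (fun j => (l * expR (- (l * u)) * (\1_`[0%R, +oo[ u - F j u))%:E))%E) ->
  (\int[mu]_u (l * expR (- (l * u)) * F j u)%:E)%E @[j --> \oo]
     --> p%:E ->
  (\int[mu]_u (l * expR (- (l * u)) * H u)%:E)%E = p%:E.
Proof.
move=> l0 ndF F01 Fneg ndH H01 Hneg lo up Ip.
pose w (u : R) := l * expR (- (l * u)).
have w0 u : 0 <= w u by rewrite mulr_ge0 ?expR_ge0// ltW.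
have mw : measurable_fun [set: R] w.
  by apply: measurable_funM => //; exact: measurable_expRNM.
have mI : measurable_fun [set: R] (\1_`[0, +oo[%classic : R -> R).
  by apply: measurable_indic.
have wI (f : R -> R) : {homo f : x y / x <= y} ->
    measurable_fun [set: R] (fun u => (w u * f u)%:E).
  move=> ndf; apply/measurable_EFinP; apply: measurable_funM => //.
  exact: nondecreasing_measurableT.
have wIc (f : R -> R) : {homo f : x y / x <= y} ->
    measurable_fun [set: R] (fun u => (w u * (\1_`[0, +oo[%classic u - f u))%:E).
  move=> ndf; apply/measurable_EFinP; apply: measurable_funM => //.
  by apply: measurable_funB => //; exact: nondecreasing_measurableT.
have c0 (f : R -> R) : (forall u, 0 <= f u <= 1) -> (forall u, u < 0 -> f u = 0) ->
    forall u, (0 <= (w u * (\1_`[0, +oo[%classic u - f u))%:E)%E.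
  move=> f01 fneg u; rewrite lee_fin mulr_ge0// indicE.
  have [u0|u0] := leP 0 u.
    by rewrite mem_set/= ?in_itv/= ?u0// subr_ge0; case/andP: (f01 u).
  by rewrite memNset/= ?in_itv/= ?andbT ?fneg// ?subrr// leNgt u0.
have p0 (f : R -> R) : (forall u, 0 <= f u <= 1) -> forall u, (0 <= (w u * f u)%:E)%E.
  by move=> f01 u; rewrite lee_fin mulr_ge0//; case/andP: (f01 u).
have cmpl (f : R -> R) : {homo f : x y / x <= y} -> (forall u, 0 <= f u <= 1) ->
    (forall u, u < 0 -> f u = 0) ->
    exists r : R, [/\ 0 <= r <= 1,
      (\int[mu]_u (w u * f u)%:E = r%:E)%E &
      (\int[mu]_u (w u * (\1_`[0%R, +oo[ u - f u))%:E = (1 - r)%:E)%E].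
  move=> ndf f01 fneg.
  have := integral_exp_compl l0 (nondecreasing_measurableT ndf) f01 fneg.
  have : (0 <= \int[mu]_u (w u * f u)%:E)%E.
    by apply: integral_ge0 => u _; exact: p0.
  have : (0 <= \int[mu]_u (w u * (\1_`[0%R, +oo[ u - f u))%:E)%E.
    by apply: integral_ge0 => u _; exact: c0.
  move=> c p1 cp; exact: adde_eq1.
have [r [r01 IH cH]] := cmpl _ ndH H01 Hneg.
rewrite IH; congr EFin; apply/eqP; rewrite eq_le; apply/andP; split.
  apply: (@le_exp_itv _ l) => // h h0.
  rewrite -lee_fin EFinM -IH -ge0_integralZl//=; last 2 first.
  - exact: wI.
  - by move=> u _; exact: p0.
  (* Since [exp (- l h) w u = w (u + h)], a translation by [h] turns the damped integral of [H] into
     the integral of [H (u - h)]; the damping disappears as [h] tends to 0. *)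
  rewrite (_ : (fun u : R => _) =
      (fun u : R => (w (1 * u + h) * H (1 * u + h - h))%:E)); last first.
    apply/funext => u; rewrite mul1r addrK -EFinM /w mulrDr opprD expRD; congr EFin.
    by ring.
  have mHh : measurable_fun [set: R] (fun u => (w u * H (u - h))%:E).
    by apply: (wI (fun u => H (u - h))) => x y xy; apply: ndH; rewrite lerB.
  have Hh0 u : (0 <= (w u * H (u - h))%:E)%E.
    by rewrite lee_fin mulr_ge0//; case/andP: (H01 (u - h)).
  have := ge0_integral_affine h (oner_neq0 R) mHh Hh0.
  rewrite normr1 mul1e => <-.
  rewrite -(cvg_limn_einf_sup Ip).1.
  have FT := @fatou _ _ R mu setT measurableT
    (fun j u => (w u * F j u)%:E) (fun j => wI _ (ndF j))
    (fun j u _ => p0 _ (F01 j) u).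
  apply: le_trans FT.
  apply: ge0_le_integral => //; last by move=> u _; exact: lo.
  by apply: measurable_fun_limn_einf => j; exact: wI.
(* The reverse inequality, from Fatou on the complements, whose integrals tend to [1 - p]. *)
rewrite -[leRHS](subKr 1) -[leLHS](subKr 1) lerB// -lee_fin -cH.
have cp : (\int[mu]_u (w u * (\1_`[0%R, +oo[ u - F j u))%:E)%E
    @[j --> \oo] --> (1 - p)%:E.
  rewrite EFinB.
  rewrite (_ : (fun j => _) =
      (fun j => 1 - \int[mu]_u (w u * F j u)%:E)%E); last first.
    apply/funext => j; have [q [_ -> ->]] := cmpl _ (ndF j) (F01 j) (Fneg j).
    by rewrite -EFinB.
  apply: cvgeB => //; exact: cvg_cst.
rewrite -(cvg_limn_einf_sup cp).1.
have FT := @fatou _ _ R mu setT measurableT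
    (fun j u => (w u * (\1_`[0%R, +oo[%classic u - F j u))%:E)
    (fun j => wIc _ (ndF j)) (fun j u _ => c0 _ (F01 j) (Fneg j) u).
apply: le_trans FT; apply: ge0_le_integral => //.
- by move=> u _; exact: c0.
- exact: wIc.
- by apply: measurable_fun_limn_einf => j; exact: wIc.
- by move=> u _; exact: up.
Qed.

(* The distribution functions [F k] have pointwise cluster points by Helly; the
   right-continuous version [H] of a cluster point along the rationals has
   [H (u - h) <= liminf F k u <= limsup F k u <= H u], which is enough to
   identify its Laplace transform. *)
Lemma laplace_mix_lim R (phi_ : nat -> R -> R) (phi : R -> R) :
  (forall k, laplace_mix (phi_ k)) ->
  (forall l, 0 < l -> phi_ k l @[k --> \oo] --> phi l) ->
  (forall e, 0 < e -> exists2 l, 0 < l & 1 - e <= phi l) ->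
  laplace_mix phi.
Proof.
move=> Lphi phiP phi1.
pose w (l u : R) := l * expR (- (l * u)).
have w0 l u : 0 < l -> 0 <= w l u by move=> l0; rewrite mulr_ge0 ?expR_ge0// ltW.
have mw l : measurable_fun [set: R] (w l).
  by apply: measurable_funM => //; exact: measurable_expRNM.
have /choice[F FP] : forall k, exists F : R -> R,
    [/\ {homo F : x y / x <= y}, forall x, 0 <= F x <= 1,
       forall x, x < 0 -> F x = 0 &
       forall l, 0 < l -> (\int[mu]_u (w l u * F u)%:E = (phi_ k l)%:E)%E].
  move=> k; have [d [T [P [X [mX X0 LX]]]]] := Lphi k.
  have mXu u : measurable [set t | X t <= u].
    by rewrite -[X in measurable X]setTI; exact: measurable_fun_ler.
  exists (fun u => fine (P [set t | X t <= u])); split.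
  - move=> x y xy; rewrite fine_le ?fin_num_measure// le_measure ?inE//.
    by move=> t /= /le_trans; exact.
  - move=> x; rewrite fine_ge0//= -lee_fin fineK ?fin_num_measure//.
    exact: probability_le1.
  - move=> x x0; rewrite (_ : [set t | X t <= x] = set0) ?measure0//.
    by apply/seteqP; split => // t /= Xt; move: (le_lt_trans Xt x0); rewrite ltNge X0.
  - move=> l l0; rewrite -LX// (integral_exp_cdf P mX l0).
    by apply: eq_integral => u _; rewrite EFinM fineK ?fin_num_measure.
have ndF k : {homo F k : x y / x <= y} by have [] := FP k.
have F01 k x : 0 <= F k x <= 1 by have [] := FP k.
have Fneg k x : x < 0 -> F k x = 0 by move=> x0; have [_ _ ->] := FP k.
have LF k l : 0 < l -> (\int[mu]_u (w l u * F k u)%:E = (phi_ k l)%:E)%E.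
  by move=> l0; have [_ _ _ ->] := FP k.
have [s [G [sj ndG G01 FG]]] := helly_selection ndF F01.
have Gneg q : ratr q < 0 :> R -> G (ratr q) = 0.
  move=> q0; have F0 : F (s j) (ratr q) @[j --> \oo] --> (0 : R).
    by under eq_fun do rewrite Fneg//; exact: cvg_cst.
  exact: (cvg_unique _ (FG q) F0).
pose S (u : R) := [set G (ratr q) | q in [set q : rat | u < ratr q]].
pose H (u : R) := inf (S u).
have S0 u : S u !=set0.
  have [|q] := @rat_in_itvoo R u (u + 1); first by rewrite ltrDl.
  by rewrite in_itv/= => /andP[uq _]; exists (G (ratr q)), q.
have lbS u : lbound (S u) 0 by move=> _ [q _ <-]; case/andP: (G01 (ratr q)).
have HG u (q : rat) : u < ratr q -> H u <= G (ratr q).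
  by move=> uq; apply: ge_inf; [exists 0; exact: lbS|exists q].
have HGe u e : 0 < e -> exists2 q : rat, u < ratr q & G (ratr q) < H u + e.
  move=> e0; have [|_ [q uq <-] Gq] := @inf_adherent _ (S u) e e0.
    by split; [exact: S0|exists 0; exact: lbS].
  by exists q.
have H01 u : 0 <= H u <= 1.
  apply/andP; split; first by apply: lb_le_inf; [exact: S0|exact: lbS].
  have [_ [q uq _]] := S0 u.
  by apply: (le_trans (HG _ _ uq)); case/andP: (G01 (ratr q)).
have ndH : {homo H : x y / x <= y}.
  move=> x y xy; apply: lb_le_inf; first exact: S0.
  by move=> _ [q /= yq <-]; apply: HG; exact: le_lt_trans yq.
have Hneg u : u < 0 -> H u = 0.
  move=> u0; apply/eqP; rewrite eq_le; have /andP[-> _] := H01 u; rewrite andbT.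
  have [q] := rat_in_itvoo u0; rewrite in_itv/= => /andP[uq q0].
  by rewrite -(Gneg _ q0); exact: HG.
have IH l : 0 < l -> (\int[mu]_u (w l u * H u)%:E = (phi l)%:E)%E.
  move=> l0; apply: (@exp_integral_squeeze _ _ _ (fun j => F (s j))) => //.
  - by move=> j u; exact: Fneg.
  - move=> u h h0; have [|q] := @rat_in_itvoo R (u - h) u; first by rewrite ltrBlDr ltrDl.
    rewrite in_itv/= => /andP[uhq qu].
    apply: (@le_trans _ _ (w l u * G (ratr q))%:E).
      by rewrite lee_fin ler_wpM2l ?w0// HG.
    apply: (@le_limn_einf _ _ (fun j => (w l u * F (s j) (ratr q))%:E)).
      by move=> j; rewrite lee_fin ler_wpM2l ?w0// ndF// ltW.
    apply: cvg_EFin; first exact: nearW.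
    by apply: cvgM (FG q); exact: cvg_cst.
  - move=> u; apply/lee_addgt0Pr => e e0.
    have wl1 : 0 < w l u + 1 by rewrite ltr_pwDr// w0.
    have [|q uq Gq] := HGe u (e / (w l u + 1)); first by rewrite divr_gt0.
    rewrite -leeBlDr//.
    apply: (@le_trans _ _ (w l u * (\1_`[0, +oo[%classic u - G (ratr q)))%:E).
      have we : w l u * (e / (w l u + 1)) <= e.
        by rewrite mulrA ler_pdivrMr// mulrC ler_wpM2l ?ltW// ltrDl.
      have : w l u * (G (ratr q) - H u) <= w l u * (e / (w l u + 1)).
        by rewrite ler_wpM2l ?w0// lerBlDl ltW.
      rewrite -EFinB lee_fin -/(w l u); set i := \1_ _ _; lra.
    apply: (@le_limn_einf _ _
        (fun j => (w l u * (\1_`[0, +oo[%classic u - F (s j) (ratr q)))%:E)).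
      by move=> j; rewrite lee_fin ler_wpM2l ?w0// lerB// ndF// ltW.
    apply: cvg_EFin; first exact: nearW.
    by apply: cvgM; [exact: cvg_cst|apply: cvgB (FG q); exact: cvg_cst].
  - under eq_fun do rewrite LF//.
    apply: cvg_EFin; first exact: nearW.
    apply: (cvg_comp s (fun k => phi_ k l)); last exact: phiP.
    apply/cvgnyPge => A; near=> j; apply: leq_trans (sj j); near: j.
    exact: nbhs_infty_ge.
have rcH : forall x, H v @[v --> x^'+] --> H x.
  move=> x; apply/cvgrPdist_lt => e e0.
  have [q xq Gq] := HGe x e e0.
  near=> v.
  have xv : x < v by near: v; exact: nbhs_right_gt.
  have vq : v < ratr q by near: v; exact: nbhs_right_lt.
  rewrite distrC ger0_norm ?subr_ge0 ?ndH ?(ltW xv)// ltrBlDl.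
  by apply: le_lt_trans Gq; exact: HG.
have HNy : H v @[v --> -oo] --> (0 : R).
  apply/cvgrPdist_lt => e e0; near=> v.
  by rewrite Hneg ?subrr ?normr0//; near: v; exact: nbhs_ninfty_lt.
have Hy : H v @[v --> +oo] --> (1 : R).
  apply/cvgrPdist_le => e e0.
  have [|l l0 le] := phi1 (e / 2); first by rewrite divr_gt0.
  (* Tightness: if mass escaped to infinity, [H] would stay below [1 - e], hence so would [phi l]
     for every [l > 0], against the choice of [l]. *)
  suff [u Hu] : exists u, 1 - e <= H u.
    near=> v.
    rewrite ger0_norm ?subr_ge0; last by case/andP: (H01 v).
    rewrite lerBlDl -lerBlDr; apply: (le_trans Hu); apply: ndH.
    by near: v; apply: nbhs_pinfty_ge; rewrite num_real.
  apply: contrapT => /forallNP nH.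
  have He u : H u <= 1 - e by have /negP := nH u; rewrite -ltNge => /ltW.
  suff : phi l <= 1 - e by lra.
  rewrite -lee_fin -IH//.
  have e1 : 0 <= 1 - e by apply: le_trans (He 0); case/andP: (H01 0).
  apply: (@le_trans _ _ (\int[mu]_(u in `[0%R, +oo[) ((1 - e)%:E * (w l u)%:E))%E).
    rewrite [leRHS]integral_mkcond; apply: ge0_le_integral => //.
    - by move=> u _; rewrite lee_fin mulr_ge0 ?w0//; case/andP: (H01 u).
    - apply/measurable_EFinP; apply: measurable_funM; first exact: mw.
      exact: nondecreasing_measurableT.
    - apply/(measurable_restrictT _ _).1 => //.
      apply: measurable_funTS; apply: emeasurable_funM => //.
      apply/measurable_EFinP; exact: mw.
    - move=> u _; rewrite patchE; have [u0|u0] := leP 0 u.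
        by rewrite mem_set/= ?in_itv/= ?u0// -EFinM lee_fin mulrC ler_wpM2r ?w0.
      by rewrite memNset/= ?in_itv/= ?andbT ?Hneg ?mulr0// leNgt u0.
  rewrite ge0_integralZl//; last 2 first.
  - by apply: measurable_funTS; apply/measurable_EFinP; exact: mw.
  - by move=> u _; rewrite lee_fin w0.
  by rewrite integral_exp_tail// mulr0 oppr0 expR0 mule1.
pose Hc : cumulativeBounded (0 : R) 1 := HB.pack H
  (isCumulative.Build R _ R H ndH rcH) (isCumulativeBounded.Build R 0 1 H HNy Hy).
pose law : probability (measurableTypeR R) R := lebesgue_stieltjes_measure Hc.
have lawcdf u : law `]-oo, u]%classic = (H u)%:E := cdf_lebesgue_stieltjes_id Hc u.
(* The Stieltjes law lives on the whole line. Truncation at 0 makes the variable nonnegative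
   everywhere without changing its distribution function, as [H] vanishes on negative reals. *)
exists _, _, law, (fun x : measurableTypeR R => Order.max (x : R) 0); split.
- by apply: measurable_maxr.
- by move=> t; rewrite le_max lexx orbT.
move=> l l0; rewrite integral_exp_cdf//; last exact: measurable_maxr.
rewrite -IH//; apply: eq_integral => u _; rewrite [RHS]EFinM; congr (_ * _)%E.
have [u0|u0] := leP 0 u.
  rewrite -lawcdf; congr (law _); apply/seteqP; split=> x /=; rewrite in_itv/= ge_max u0 andbT//.
rewrite Hneg// (_ : [set t | _] = set0) ?measure0//.
by apply/seteqP; split=> x //=; rewrite ge_max => /andP[_]; rewrite leNgt u0.
Unshelve. all: by end_near. Qed.

Lemma laplace_mixZ R (phi : R -> R) (a : R) : 0 < a ->
  laplace_mix phi -> laplace_mix (fun l => phi (a * l)).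
Proof.
move=> a0 [d [T [P [X [mX X0 L]]]]].
exists d, T, P, (fun t => a * X t); split.
- exact: measurable_funM.
- by move=> t; rewrite mulr_ge0// ltW.
- move=> l l0; rewrite -(L _ (mulr_gt0 a0 l0)).
  by apply: eq_integral => t _; rewrite mulrCA mulrA.
Qed.

(** * The one-sided stable law *)

(** With [x = a k / (k + 1)], the inequalities [exp (- x / (1 - x)) <= 1 - x <= exp (- x)] are
    raised to the power [k + 1]. *)
Lemma cvg_expR_compound R (a : nat -> R) (l : R) :
  (forall k, 0 <= a k) -> a k @[k --> \oo] --> l ->
  (1 - a k / k.+1%:R) ^+ k.+1 @[k --> \oo] --> expR (- l).
Proof.
move=> a0 al.
have cV : (k.+1%:R)^-1 @[k --> \oo] --> (0 : R) by exact: cvg_harmonic.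
have ca : a k / k.+1%:R @[k --> \oo] --> (0 : R).
  by rewrite -(mulr0 l); exact: cvgM.
have cE (b : nat -> R) : b k @[k --> \oo] --> l ->
    expR (- b k) @[k --> \oo] --> expR (- l).
  move=> bl; apply: (cvg_comp _ _ (cvgN bl)); exact: continuous_expR.
apply: (@squeeze_cvgr _ _ _ _ (fun k => expR (- (a k / (1 - a k / k.+1%:R))))
  (fun k => expR (- a k))); last 2 first.
- apply: cE; rewrite -[X in _ --> X]divr1; apply: cvgM => //.
  apply: cvgV; first exact: oner_neq0.
  rewrite -[X in _ --> X]subr0; apply: cvgB => //; exact: cvg_cst.
- exact: cE al.
near=> k.
have x1 : a k / k.+1%:R < 1.
  by near: k; apply: (cvgr_lt _ ca).
have k0 : (k.+1%:R : R) != 0 by rewrite pnatr_eq0.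
move: x1 k0 (a0 k); set n : R := k.+1%:R; set x := a k / n => x1 k0 ak.
have x1' : 0 < 1 - x by rewrite subr_gt0.
have akE : a k = n * x by rewrite /x mulrCA mulfV// mulr1.
have eX z : expR (- (n * z)) = expR (- z) ^+ k.+1.
  by rewrite -expRM_natl mulrN.
apply/andP; split.
  rewrite [X in expR (- X)](_ : _ = n * (x / (1 - x))); last by rewrite {1}akE mulrA.
  rewrite eX; apply: lerXn2r; rewrite ?nnegrE ?expR_ge0 ?(ltW x1')//.
  rewrite expRN -[leRHS]invrK lef_pV2 ?posrE ?expR_gt0 ?invr_gt0//.
  apply: le_trans (expR_ge1Dx _); rewrite le_eqVlt; apply/orP; left; apply/eqP.
  by field; rewrite gt_eqF.
rewrite akE eX; apply: lerXn2r; rewrite ?nnegrE ?expR_ge0 ?(ltW x1')//.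
exact: (expR_ge1Dx (- x)).
Unshelve. all: by end_near. Qed.

Lemma powR_cvgy0 R (p : R) : 0 < p ->
  x `^ (- p) @[x --> +oo] --> (0 : R).
Proof.
move=> p0; apply/cvgrPdist_le => e e0; near=> x.
have x0 : 0 < x by near: x; apply: nbhs_pinfty_gt; rewrite num_real.
have xe : e `^ (- p^-1) <= x by near: x; apply: nbhs_pinfty_ge; rewrite num_real.
rewrite sub0r normrN ger0_norm ?powR_ge0// powRN.
rewrite -[leRHS]invrK lef_pV2 ?posrE ?powR_gt0 ?invr_gt0//.
apply: le_trans (_ : (e `^ (- p^-1)) `^ p <= _).
  by rewrite -powRrM mulNr mulVf ?gt_eqF// powR_inv1// ltW.
by apply: ge0_ler_powR; rewrite ?nnegrE ?powR_ge0 ?(ltW p0) ?(ltW x0).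
Unshelve. all: by end_near. Qed.

Lemma derivable_cvg R (f : R -> R) (x : R) :
  derivable f x 1 -> f z @[z --> x] --> f x.
Proof.
move=> df; apply: (@differentiable_continuous _ R^o R^o x f).
exact/derivable1_diffP.
Qed.

Lemma integral_powR_tail R (c : R) : 1 < c ->
  (\int[mu]_(v in `[1%R, +oo[) (v `^ (- c))%:E = ((c - 1)^-1)%:E)%E.
Proof.
move=> c1; have c10 : c - 1 != 0 by rewrite gt_eqF// subr_gt0.
have dF (x : R) : 0 < x -> is_derive x (1 : R) (fun v : R => - (c - 1)^-1 * v `^ (1 - c)) (x `^ (- c)).
  move=> x0; have dp := is_derive1_powR (1 - c) x0.
  apply: (is_derive_eq (is_deriveZ (- (c - 1)^-1) dp)); rewrite /GRing.scale/=.
  rewrite [in X in _ `^ X](_ : 1 - c - 1 = - c); last by ring.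
  by field.
rewrite (@ge0_continuous_FTC2y R _ (fun v => - (c - 1)^-1 * v `^ (1 - c)) _ 0).
- by rewrite powR1 mulr1 sub0e -EFinN opprK.
- by move=> x _; exact: powR_ge0.
- apply: derivable_within_continuous => x; rewrite in_itv/= andbT => x1.
  have x0 : 0 < x by exact: lt_le_trans x1.
  by have dp := is_derive1_powR (- c) x0; exact: ex_derive.
- rewrite -(mulr0 (- (c - 1)^-1)); apply: cvgM; first exact: cvg_cst.
  by rewrite -(opprB c 1); apply: powR_cvgy0; rewrite subr_gt0.
- move=> x x1; have x0 : 0 < x by exact: lt_trans x1.
  by case: (dF x x0).
- apply: cvg_at_right_filter.
  apply: (@derivable_cvg _ (fun v : R => - (c - 1)^-1 * v `^ (1 - c))).
  by case: (dF 1 ltr01).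
- move=> x; rewrite in_itv/= andbT => x1; have x0 : 0 < x by exact: lt_trans x1.
  by rewrite derive1E; case: (dF x x0).
Qed.

(** Under [s = v^(-c)] this becomes the integral of [1 - exp (- l s)] against the measure
    [g s^(-1-g) ds] with [g = 1 / c]: the Levy-Khintchine exponent of a [g]-stable subordinator. In
    the variable [v] the Levy measure is plain Lebesgue measure. *)
Definition levy_exponent R (c l : R) : \bar R :=
  (\int[mu]_(v in `]0%R, +oo[) (1 - expR (- (l * v `^ (- c))))%:E)%E.

Lemma measurable_levy_integrand R (c l : R) :
  measurable_fun [set: R] (fun v : R => (1 - expR (- (l * v `^ (- c))))%:E).
Proof.
apply/measurable_EFinP; apply: measurable_funB => //.
apply: measurableT_comp => //; apply: measurableT_comp => //.
apply: measurable_funM => //; exact: measurable_powR.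
Qed.

Lemma levy_integrand_ge0 R (c l v : R) : 0 <= l ->
  0 <= 1 - expR (- (l * v `^ (- c))).
Proof. by move=> l0; rewrite subr_ge0 -expR0 ler_expR oppr_le0 mulr_ge0// powR_ge0. Qed.

(** The integrand is at most 1 on []0, 1[] and at most [l v^(-c)] beyond, where [c > 1] gives
    convergence. *)
Lemma levy_exponent_lty R (c l : R) : 1 < c -> 0 <= l ->
  (levy_exponent c l < +oo)%E.
Proof.
move=> c1 l0; rewrite /levy_exponent.
rewrite (@itv_bndbnd_setU _ R (BRight 0%R) (BLeft 1%R) +oo%O)//; last first.
  by rewrite bnd_simp ltr01.
rewrite ge0_integral_setU//=; last 3 first.
- by apply: measurable_funTS; exact: measurable_levy_integrand.
- by move=> v _; rewrite lee_fin levy_integrand_ge0.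
- rewrite disj_set2E; apply/eqP/seteqP; split=> // v /=; rewrite !in_itv/= andbT.
  by move=> [/andP[_ v1]]; rewrite leNgt v1.
apply: lte_add_pinfty.
  apply: (@le_lt_trans _ _ (\int[mu]_(v in `]0%R, 1%R[) cst 1 v)%E).
    apply: ge0_le_integral => //.
    - by move=> v _; rewrite lee_fin levy_integrand_ge0.
    - by apply: measurable_funTS; exact: measurable_levy_integrand.
    - by move=> v _; rewrite lee_fin lerBlDr lerDl expR_ge0.
  by rewrite integral_cst//= lebesgue_measure_itv/= lte_fin ltr01 sube0 mule1 ltry.
apply: (@le_lt_trans _ _ (\int[mu]_(v in `[1%R, +oo[) (l%:E * (v `^ (- c))%:E))%E).
  apply: ge0_le_integral => //.
  - by move=> v _; rewrite lee_fin levy_integrand_ge0.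
  - by apply: measurable_funTS; exact: measurable_levy_integrand.
  - by apply: measurable_funTS; apply/measurable_EFinP; apply: measurable_funM.
  - move=> v _; rewrite -EFinM lee_fin.
    have := expR_ge1Dx (- (l * v `^ (- c))); lra.
rewrite ge0_integralZl//=; last 2 first.
- by apply: measurable_funTS; apply/measurable_EFinP; exact: measurable_powR.
- by move=> v _; rewrite lee_fin powR_ge0.
by rewrite integral_powR_tail// -EFinM ltry.
Qed.

Lemma levy_exponent_gt0 R (c l : R) : 0 < c -> 0 < l ->
  (0 < levy_exponent c l)%E.
Proof.
move=> c0 l0; rewrite /levy_exponent.
apply: (@lt_le_trans _ _ (\int[mu]_(v in `]0%R, 1%R]) cst (1 - expR (- l))%:E v)%E).
  rewrite integral_cst//= lebesgue_measure_itv/= lte_fin ltr01 sube0 mule1 lte_fin.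
  by rewrite subr_gt0 -expR0 ltr_expR oppr_lt0.
apply: (@le_trans _ _ (\int[mu]_(v in `]0%R, 1%R]) (1 - expR (- (l * v `^ (- c))))%:E)%E).
  apply: ge0_le_integral => //.
  - by move=> v _; rewrite lee_fin subr_ge0 -expR0 ler_expR oppr_le0 ltW.
  - by apply: measurable_funTS; exact: measurable_levy_integrand.
  - move=> v /=; rewrite in_itv/= => /andP[v0 v1].
    rewrite lee_fin lerB// ler_expR lerN2 ler_pMr// powRN -[leLHS]invr1 lef_pV2 ?posrE ?powR_gt0//.
    have e1 : (1 : R) `^ c = 1 by rewrite powR1.
    by rewrite -[leRHS]e1; apply: ge0_ler_powR; rewrite ?nnegrE ?ler01 ?(ltW v0) ?(ltW c0).
apply: ge0_subset_integral => //.
- by apply: measurable_funTS; exact: measurable_levy_integrand.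
- by move=> v _; rewrite lee_fin levy_integrand_ge0// ltW.
- by move=> v /=; rewrite !in_itv/= => /andP[-> _].
Qed.

(** Substitution [v = l^(1/c) w]. This homogeneity alone produces the stable exponent; the constant
    is only shown to be finite and positive, and is normalized away in [stable_law]. *)
Lemma levy_exponent_scale R (c l : R) : 0 < c -> 0 < l ->
  (levy_exponent c l = (l `^ c^-1)%:E * levy_exponent c 1)%E.
Proof.
move=> c0 l0; rewrite /levy_exponent.
set f := fun v : R => (1 - expR (- (l * v `^ (- c))))%:E.
have mf := measurable_levy_integrand c l.
set a := l `^ c^-1.
have a0 : 0 < a by rewrite powR_gt0.
have mI : measurable_fun [set: R] (f \_ `]0, +oo[%classic).
  by apply/(measurable_restrictT _ _).1 => //; exact: measurable_funTS.
have I0 x : (0 <= (f \_ `]0%R, +oo[%classic) x)%E.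
  by apply: erestrict_ge0 => v _; rewrite lee_fin levy_integrand_ge0// ltW.
have avE (v : R) : 0 < v -> l * (a * v) `^ (- c) = v `^ (- c).
  move=> v0; rewrite (powRM _ (ltW a0) (ltW v0)) mulrA /a -powRrM mulrN.
  by rewrite (mulVf (lt0r_neq0 c0)) (powR_inv1 (ltW l0)) (mulfV (lt0r_neq0 l0)) mul1r.
rewrite integral_mkcond (ge0_integral_affine 0 (lt0r_neq0 a0) mI I0).
rewrite gtr0_norm//; congr (_ * _)%E.
rewrite [RHS]integral_mkcond; apply: eq_integral => v _.
have nI (w : R) : w <= 0 -> (w \in `]0, +oo[%classic) = false.
  by move=> w0; apply/negP; rewrite inE/= in_itv/= andbT ltNge w0.
have yI (w : R) : 0 < w -> (w \in `]0, +oo[%classic) = true.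
  by move=> w0; rewrite mem_set//= in_itv/= w0.
rewrite !patchE addr0; have [v0|v0] := ltP 0 v; last first.
  by rewrite !nI// pmulr_rle0.
rewrite (yI _ v0) (yI _ (mulr_gt0 a0 v0)) /f.
by rewrite avE// mul1r.
Qed.

(** The variable is [v^(-c)] for [v] uniform on [[0, n + 1]]. Its transform is one minus a truncated
    Levy exponent divided by [n + 1], so that its power [n + 1] has the shape of
    [cvg_expR_compound]. *)
Lemma laplace_mix_uniform R (c : R) (n : nat) : 0 < c ->
  laplace_mix (fun l => 1 - fine (\int[mu]_(v in `]0%R, n.+1%:R])
    (1 - expR (- (l * v `^ (- c))))%:E)%E / n.+1%:R).
Proof.
move=> c0; have n0 : (0 : R) < n.+1%:R by rewrite ltr0n.
exists _, _, (uniform_prob n0), (fun v : measurableTypeR R => (v : R) `^ (- c)); split.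
- exact: measurable_powR.
- by move=> t; exact: powR_ge0.
move=> l l0; have mE : measurable_fun [set: R] (fun v : R => (expR (- (l * v `^ (- c))))%:E).
  apply/measurable_EFinP; apply: measurableT_comp => //; apply: measurableT_comp => //.
  by apply: measurable_funM => //; exact: measurable_powR.
rewrite integral_uniform//= -integral_itv_obnd_cbnd; last exact: measurable_funTS.
have : (\int[mu]_(v in `]0%R, n.+1%:R]) (expR (- (l * v `^ (- c))))%:E +
    \int[mu]_(v in `]0%R, n.+1%:R]) (1 - expR (- (l * v `^ (- c))))%:E = n.+1%:R%:E)%E.
  rewrite -ge0_integralD//=; last 3 first.
  - exact: measurable_funTS.
  - by move=> v _; rewrite lee_fin levy_integrand_ge0// ltW.
  - by apply: measurable_funTS; exact: measurable_levy_integrand.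
  under eq_integral do rewrite -EFinD addrC subrK.
  by rewrite integral_cst//= lebesgue_measure_itv/= lte_fin ltr0n/= sube0 mul1e.
have : (0 <= \int[mu]_(v in `]0%R, n.+1%:R]) (expR (- (l * v `^ (- c))))%:E)%E.
  by apply: integral_ge0 => v _; rewrite lee_fin expR_ge0.
have : (0 <= \int[mu]_(v in `]0%R, n.+1%:R]) (1 - expR (- (l * v `^ (- c))))%:E)%E.
  by apply: integral_ge0 => v _; rewrite lee_fin levy_integrand_ge0// ltW.
case: (\int[_]_(v in _) (1 - _)%:E)%E => [y| |]; case: (\int[_]_(v in _) _)%E => [x| |]//.
move=> _ _ [xy]; rewrite -EFinM subr0/= -[in RHS]xy; congr EFin.
by rewrite /= -xy in n0 *; field; rewrite gt_eqF.
Qed.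

Lemma laplace_mix_stable0 R (c : R) : 1 < c ->
  laplace_mix (fun l => expR (- (fine (levy_exponent c 1) * l `^ c^-1))).
Proof.
move=> c1; have c0 : 0 < c by exact: lt_trans c1.
have Dfin l : 0 <= l -> levy_exponent c l \is a fin_num.
  move=> l0; rewrite ge0_fin_numE ?levy_exponent_lty//.
  by apply: integral_ge0 => v _; rewrite lee_fin levy_integrand_ge0.
pose a l (n : nat) := fine (\int[mu]_(v in `]0%R, n.+1%:R])
    (1 - expR (- (l * v `^ (- c))))%:E)%E.
apply: (@laplace_mix_lim _ (fun n l => (1 - a l n / n.+1%:R) ^+ n.+1)).
- by move=> n; apply: laplace_mixX; exact: laplace_mix_uniform.
- move=> l l0; apply: cvg_expR_compound.
    move=> n; rewrite fine_ge0//; apply: integral_ge0 => v _.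
    by rewrite lee_fin levy_integrand_ge0// ltW.
  rewrite (_ : _ * _ = fine (levy_exponent c l)); last first.
    by rewrite [in RHS]levy_exponent_scale// fineM ?Dfin ?ler01//= mulrC.
  apply: fine_cvg; rewrite fineK ?Dfin ?ltW//.
  rewrite /levy_exponent (_ : `]0, +oo[%classic = \bigcup_n `]0%R, n.+1%:R]%classic); last first.
    apply/seteqP; split=> v /=.
      rewrite in_itv/= andbT => v0; exists (Num.truncn v) => //=.
      by rewrite in_itv/= v0 ltW// truncnS_gt.
    by move=> [n _ /=]; rewrite !in_itv/= andbT => /andP[].
  apply: ge0_nondecreasing_set_cvg_integral.
  - move=> n m nm; apply/subsetPset => v /=; rewrite !in_itv/= => /andP[-> /= vn].
    by rewrite (le_trans vn)// ler_nat.
  - by move=> n.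
  - by move=> n; apply: measurable_funTS; exact: measurable_levy_integrand.
  - by move=> n v _; rewrite lee_fin levy_integrand_ge0// ltW.
- move=> e e0; set C := fine _.
  have C0 : 0 < C.
    by rewrite /C fine_gt0// levy_exponent_gt0//= levy_exponent_lty.
  (* At this [l] the exponent [C l^(1/c)] equals [e], and [exp (- e) >= 1 - e]. *)
  exists ((e / C) `^ c); first by rewrite powR_gt0// divr_gt0.
  rewrite -powRrM mulfV ?gt_eqF// powRr1 ?divr_ge0 ?(ltW e0) ?(ltW C0)//.
  rewrite mulrCA mulfV ?gt_eqF// mulr1.
  exact: (expR_ge1Dx (- e)).
Qed.

(* Partial sums of [k] independent copies of [(k U)^(-1/g)], with [U] uniform on
   [0, 1], converge in law to a one-sided [g]-stable law. *)
Lemma stable_law R (g : R) : 0 < g < 1 ->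
  exists d (T : measurableType d) (P : probability T R) (X : T -> R),
    [/\ measurable_fun setT X, (forall t, 0 < X t) &
        forall l, 0 <= l -> (\int[P]_t (expR (- (l * X t)))%:E)%E = (expR (- l `^ g))%:E].
Proof.
move=> /andP[g0 g1]; pose c := g^-1.
have c1 : 1 < c by rewrite invf_gt1.
have c0 : 0 < c by rewrite invr_gt0.
pose C := fine (levy_exponent c 1).
have C0 : 0 < C by rewrite /C fine_gt0// levy_exponent_gt0//= levy_exponent_lty.
have [d [T [P [X [mX X0 LX]]]]] := laplace_mixZ (powR_gt0 (- c) C0) (laplace_mix_stable0 c1).
have {}LX l : 0 < l -> (\int[P]_t (expR (- (l * X t)))%:E)%E = (expR (- l `^ g))%:E.
  move=> l0; rewrite LX// invrK powRM ?powR_ge0 ?ltW// -powRrM mulNr mulVf ?gt_eqF//.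
  by rewrite powR_inv1 ?ltW// mulrA mulfV ?gt_eqF// mul1r.
(* Negative powers of the variable are needed later, so it must be positive everywhere. The event
   [X = 0] is null because its probability is at most [E (exp (- l X)) = exp (- l^g)] for every
   [l > 0]; there the value is reset to 1. *)
pose Y t := if 0 < X t then X t else 1.
have mE (Z : T -> R) l : measurable_fun setT Z -> measurable_fun setT (fun t => (expR (- (l * Z t)))%:E).
  move=> mZ; apply/measurable_EFinP; apply: measurableT_comp => //.
  by apply: measurableT_comp => //; exact: measurable_funM.
have mY : measurable_fun setT Y.
  by apply: measurable_fun_ifT => //; exact: measurable_fun_ltr.
have mN : measurable [set t | X t <= 0].
  by rewrite -[X in measurable X]setTI; exact: measurable_fun_ler.
have N0 : P [set t | X t <= 0] = 0%E.
  apply/eqP; rewrite -measure_le0; apply/lee_addgt0Pr => e e0; rewrite add0e.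
  have [l l0 le] : exists2 l, 0 < l & expR (- l `^ g) <= e.
    exists ((e^-1) `^ c); first by rewrite powR_gt0// invr_gt0.
    rewrite -powRrM mulVf ?gt_eqF// powRr1 ?invr_ge0 ?(ltW e0)//.
    rewrite expRN -[leRHS]invrK lef_pV2 ?posrE ?expR_gt0 ?invr_gt0//.
    by have := expR_ge1Dx (e^-1); lra.
  apply: le_trans (_ : (expR (- l `^ g))%:E <= _)%E; last by rewrite lee_fin.
  apply: (@le_trans _ _ (\int[P]_t (\1_[set t | (X t <= 0)%R] t)%:E)%E).
    by rewrite integral_indic// setIT.
  rewrite -LX//.
  apply: ge0_le_integral => //.
  - by apply/measurable_EFinP; exact: measurable_indic.
  - exact: mE.
  - move=> t _; rewrite lee_fin indicE; case: (boolP (_ \in _)) => [|_]; last exact: expR_ge0.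
    rewrite inE/= => Xt; have -> : X t = 0 by apply/eqP; rewrite eq_le Xt X0.
    by rewrite mulr0 oppr0 expR0.
exists d, T, P, Y; split => //.
  by move=> t; rewrite /Y; case: ifPn.
move=> l; rewrite le_eqVlt => /predU1P[<-|l0].
  under eq_integral do rewrite mul0r oppr0 expR0.
  rewrite integral_cst// mul1e powR0 ?gt_eqF// oppr0 expR0.
  exact: probability_setT.
rewrite -(LX _ l0); apply: ae_eq_integral => //; [exact: mE|exact: mE|].
exists [set t | X t <= 0]; split => // t /=.
apply: contra_notP => /negP; rewrite -ltNge => Xt _; rewrite /Y.
by rewrite Xt.
Qed.

(** * The Gamma function *)

Lemma exprn_expRN_le R (n : nat) (x : R) : 0 <= x ->
  x ^+ n * expR (- x) <= n`!%:R.
Proof.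
move=> x0; rewrite expRN ler_pdivrMr ?expR_gt0//.
case: n => [|n].
  by rewrite expr0 fact0 mul1r; apply: le_trans (expR_ge1Dx x); rewrite lerDl.
rewrite mulrC -ler_pdivrMr ?ltr0n ?fact_gt0//.
by apply: le_trans (expR_ge1Dxn n x0); rewrite lerDr.
Qed.

Lemma cvg_exprn_expRN R (n : nat) :
  (x ^+ n * expR (- x)) @[x --> +oo] --> (0 : R).
Proof.
apply/cvgrPdist_le => e e0; near=> x.
have x0 : 0 < x by near: x; apply: nbhs_pinfty_gt; rewrite num_real.
have xe : n.+1`!%:R / e <= x by near: x; apply: nbhs_pinfty_ge; rewrite num_real.
rewrite sub0r normrN ger0_norm ?mulr_ge0 ?exprn_ge0 ?expR_ge0 ?(ltW x0)//.
have := exprn_expRN_le n.+1 (ltW x0); rewrite exprS -mulrA mulrC -ler_pdivlMr// => /le_trans; apply.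
by rewrite ler_pdivrMr// mulrC -ler_pdivrMr.
Unshelve. all: by end_near. Qed.

Lemma is_derive_exprn R (n : nat) (x : R) :
  is_derive x (1 : R) (fun y : R => y ^+ n.+1) (n.+1%:R * x ^+ n).
Proof.
have := is_deriveX n.+1 (is_derive_id x (1 : R)).
rewrite (_ : id ^+ n.+1 = (fun y : R => y ^+ n.+1)); last first.
  by apply/funext => y; rewrite exprfctE.
by move=> h; apply: (is_derive_eq h); rewrite /GRing.scale/= mulr1.
Qed.

(** Induction builds an antiderivative vanishing at infinity, [F_(n+1) = (n + 1) F_n - x^(n+1) exp
    (- x)], whose value at 0 carries the factorial. *)
Lemma integral_Gamma_nat R (n : nat) :
  (\int[mu]_(x in `[0%R, +oo[) (x ^+ n * expR (- x))%:E = n`!%:R%:E :> \bar R)%E.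
Proof.
have [F [dF F0 Fy]] : exists F : R -> R,
    [/\ forall x, is_derive x (1 : R) F (x ^+ n * expR (- x)), F 0 = - n`!%:R &
       F x @[x --> +oo] --> (0 : R)].
  elim: n => [|n [F [dF F0 Fy]]].
    exists (fun x => - expR (- x)); split.
    - by move=> x; apply: is_derive_eq; rewrite /GRing.scale/= expr0; ring.
    - by rewrite oppr0 expR0 fact0.
    - by rewrite -oppr0; apply: cvgN; exact: cvgr_expR.
  exists (fun x => n.+1%:R * F x - x ^+ n.+1 * expR (- x)); split.
  - move=> x; have dFx := dF x.
    have dE : is_derive x (1 : R) (fun x : R => x ^+ n.+1 * expR (- x))
        (n.+1%:R * x ^+ n * expR (- x) - x ^+ n.+1 * expR (- x)).
      have dX := is_derive_exprn n x.
      have dN : is_derive x (1 : R) (fun x : R => expR (- x)) (- expR (- x)).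
        by apply: is_derive_eq; rewrite /GRing.scale/=; ring.
      by apply: (is_derive_eq (is_deriveM dX dN)); rewrite /GRing.scale/=; ring.
    apply: (is_derive_eq (is_deriveB (is_deriveZ n.+1%:R dFx) dE)).
    by rewrite /GRing.scale/=; ring.
  - by rewrite F0 expr0n/= mul0r subr0 factS natrM mulrN.
  - rewrite -(subr0 (0 : R)); apply: cvgB; last exact: cvg_exprn_expRN.
    by rewrite -(mulr0 n.+1%:R); apply: cvgM => //; exact: cvg_cst.
rewrite (@ge0_continuous_FTC2y R _ F _ 0) ?F0 ?sub0e -?EFinN ?opprK//.
- by move=> x x0; rewrite mulr_ge0 ?exprn_ge0 ?expR_ge0.
- apply: continuous_subspaceT => x; apply: cvgM; first exact: exprn_continuous.
  by apply: (@derivable_cvg _ (fun y : R => expR (- y))); exact: ex_derive.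
- by rewrite -F0; apply: cvg_at_right_filter; apply: derivable_cvg; case: (dF 0).
- by move=> x _; rewrite derive1E; case: (dF x).
Qed.

(** Extended-real version of [Gamma (p + 1)]. The latter takes [fine] of the integral and would be 0
    for an infinite one, so finiteness has to be settled before passing to it. *)
Definition Gamma_integral R (p : R) : \bar R :=
  (\int[mu]_(x in `]0%R, +oo[) (x `^ p * expR (- x))%:E)%E.

Lemma measurable_Gamma_integrand R (p : R) :
  measurable_fun [set: R] (fun x : R => (x `^ p * expR (- x))%:E).
Proof.
apply/measurable_EFinP; apply: measurable_funM; first exact: measurable_powR.
exact: measurableT_comp.
Qed.

Lemma Gamma_integral_nat R (n : nat) :
  Gamma_integral n%:R = n`!%:R%:E :> \bar R.
Proof.
rewrite /Gamma_integral integral_itv_obnd_cbnd.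
  rewrite -integral_Gamma_nat; apply: eq_integral => x.
  by rewrite inE/= in_itv/= andbT => x0; rewrite powR_mulrn.
by apply: measurable_funTS; exact: measurable_Gamma_integrand.
Qed.

(** With [n] an integer above [p], [x^p <= x^0 + x^n]: the first term serves for [x <= 1], the
    second for [x > 1]. *)
Lemma Gamma_integral_lty R (p : R) : 0 <= p -> (Gamma_integral p < +oo)%E.
Proof.
move=> p0; set n := (Num.truncn p).+1.
have pn : p <= n%:R by rewrite ltW// truncnS_gt.
apply: (@le_lt_trans _ _ (Gamma_integral (0%:R : R) + Gamma_integral n%:R)%E); last first.
  by rewrite !Gamma_integral_nat -EFinD ltry.
rewrite /Gamma_integral -ge0_integralD//=; last 4 first.
- by move=> x _; rewrite lee_fin mulr_ge0 ?powR_ge0 ?expR_ge0.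
- by apply: measurable_funTS; exact: measurable_Gamma_integrand.
- by move=> x _; rewrite lee_fin mulr_ge0 ?powR_ge0 ?expR_ge0.
- by apply: measurable_funTS; exact: measurable_Gamma_integrand.
apply: ge0_le_integral => //.
- by move=> x _; rewrite lee_fin mulr_ge0 ?powR_ge0 ?expR_ge0.
- by apply: measurable_funTS; exact: measurable_Gamma_integrand.
- by apply: emeasurable_funD; apply: measurable_funTS; exact: measurable_Gamma_integrand.
move=> x /=; rewrite in_itv/= andbT => x0.
rewrite -EFinD lee_fin -mulrDl ler_wpM2r ?expR_ge0// powRr0.
have [x1|x1] := leP x 1.
  apply: (@le_trans _ _ 1); last by rewrite lerDl powR_ge0.
  have e1 : (1 : R) `^ p = 1 by rewrite powR1.
  by rewrite -[leRHS]e1; apply: ge0_ler_powR; rewrite ?nnegrE ?ler01 ?(ltW x0).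
apply: (@le_trans _ _ (x `^ n%:R)); last by rewrite lerDr.
by apply: ler_powR => //; exact: ltW.
Qed.

Lemma Gamma_integralE R (p : R) : 0 <= p ->
  Gamma_integral p = (Gamma (p + 1))%:E.
Proof.
move=> p0; rewrite /Gamma addrK /Rintegral fineK// ge0_fin_numE ?Gamma_integral_lty//.
by apply: integral_ge0 => x _; rewrite lee_fin mulr_ge0 ?powR_ge0 ?expR_ge0.
Qed.

Lemma Gamma_nat R (n : nat) : Gamma (n%:R + 1) = n`!%:R :> R.
Proof. by apply: EFin_inj; rewrite -Gamma_integralE// Gamma_integral_nat. Qed.

(** The integral is restricted to [x >= A], where [x^p >= A^p]. The free parameter [A] makes this a
    substitute for Stirling's formula in the convergence of the Mittag-Leffler series. *)
Lemma Gamma_ge R (p A : R) : 0 <= p -> 0 < A ->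
  A `^ p * expR (- A) <= Gamma (p + 1).
Proof.
move=> p0 A0; rewrite -lee_fin -Gamma_integralE//.
apply: (@le_trans _ _ (\int[mu]_(x in `[A, +oo[) (x `^ p * expR (- x))%:E)%E); last first.
  apply: ge0_subset_integral => //.
  - by apply: measurable_funTS; exact: measurable_Gamma_integrand.
  - by move=> x _; rewrite lee_fin mulr_ge0 ?powR_ge0 ?expR_ge0.
  - by move=> x /=; rewrite !in_itv/= !andbT; exact: lt_le_trans.
apply: (@le_trans _ _ (\int[mu]_(x in `[A, +oo[) ((A `^ p)%:E * (1 * expR (- (1 * x)))%:E))%E).
  rewrite ge0_integralZl//=.
  - by rewrite integral_exp_tail// mul1r EFinM.
  - apply: measurable_funTS; apply/measurable_EFinP; apply: measurable_funM => //.
    by apply: measurableT_comp => //; apply: measurableT_comp => //; exact: measurable_funM.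
  - by rewrite lee_fin powR_ge0.
apply: ge0_le_integral => //.
- by move=> x _; rewrite -EFinM lee_fin mulr_ge0 ?powR_ge0// mul1r expR_ge0.
- apply: measurable_funTS; apply: emeasurable_funM => //; apply/measurable_EFinP.
  apply: measurable_funM => //.
  by apply: measurableT_comp => //; apply: measurableT_comp => //; exact: measurable_funM.
- by apply: measurable_funTS; exact: measurable_Gamma_integrand.
- move=> x /=; rewrite in_itv/= andbT => Ax; rewrite -EFinM lee_fin !mul1r.
  rewrite ler_wpM2r ?expR_ge0//; apply: ge0_ler_powR => //; rewrite ?nnegrE ?(ltW A0)//.
  exact: le_trans (ltW A0) Ax.
Qed.

Lemma Gamma_gt0 R (p : R) : 0 <= p -> 0 < Gamma (p + 1).
Proof.
move=> p0; apply: lt_le_trans (Gamma_ge p0 ltr01).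
by rewrite mulr_gt0 ?powR_gt0 ?expR_gt0.
Qed.

Lemma measurable_bool_natr d (T : measurableType d) R (b : T -> bool) :
  measurable_fun setT b -> measurable_fun setT (fun x => (b x)%:R : R).
Proof.
move=> mb; rewrite (_ : (fun x => _) = (fun x => if b x then 1 else 0)); last first.
  by apply/funext => x; case: (b x).
exact: measurable_fun_ifT.
Qed.

Lemma mem_itv0y R (x : R) : (x \in `]0, +oo[%classic) = (0 < x).
Proof. by apply/idP/idP; rewrite inE/= in_itv/= andbT. Qed.

Lemma integral_itv0y R (f : R -> R) :
  (\int[mu]_(x in `]0%R, +oo[) (f x)%:E =
   \int[mu]_x (f x * ((0 < x)%R)%:R)%:E)%E.
Proof.
rewrite integral_mkcond; apply: eq_integral => x _.
by rewrite patchE mem_itv0y; case: (0 < x); rewrite ?mulr1 ?mulr0.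
Qed.

Lemma integral_exp_tailT R (x : R) :
  (\int[mu]_y (expR (- y) * ((x <= y)%R)%:R)%:E = (expR (- x))%:E :> \bar R)%E.
Proof.
have := integral_exp_tail x (@ltr01 R); rewrite mul1r => <-.
rewrite [RHS]integral_mkcond; apply: eq_integral => y _.
rewrite patchE (_ : (y \in _) = (x <= y)).
  by case: (x <= y); rewrite ?mulr1 ?mulr0// !mul1r.
by apply/idP/idP; rewrite inE/= in_itv/= andbT.
Qed.

Lemma integral_oc_natr R (a : R) : 0 < a ->
  (\int[mu]_r (((0 < r) && (r <= a))%:R)%:E = a%:E :> \bar R)%E.
Proof.
move=> a0; transitivity (mu (`]0, a]%classic : set R)); last first.
  by rewrite lebesgue_measure_itv/= lte_fin a0 sube0.
rewrite -[X in _ = mu X]setIT -integral_indic//; apply: eq_integral => r _.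
rewrite indicE; congr ((nat_of_bool _)%:R%:E).
by apply/idP/idP; rewrite inE/= in_itv/=.
Qed.

Lemma powR_ler_swap R (p s r x : R) : 0 < p -> 0 < s -> 0 < r -> 0 < x ->
  (s * r `^ p^-1 <= x) = (r <= (x / s) `^ p).
Proof.
move=> p0 s0 r0 x0; rewrite mulrC -ler_pdivlMr//.
have xs : 0 <= x / s by rewrite divr_ge0 ?(ltW x0) ?(ltW s0).
apply/idP/idP => h.
  have -> : r = (r `^ p^-1) `^ p by rewrite -powRrM mulVf ?gt_eqF// powRr1// ltW.
  by apply: ge0_ler_powR; rewrite ?nnegrE ?powR_ge0 ?(ltW p0).
have -> : x / s = ((x / s) `^ p) `^ p^-1 by rewrite -powRrM mulfV ?gt_eqF// powRr1.
by apply: ge0_ler_powR; rewrite ?nnegrE ?powR_ge0 ?(ltW r0) ?invr_ge0 ?(ltW p0).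
Qed.

(* Layer-cake form of the Gamma integral. *)
Lemma integral_expR_powR R (p s : R) : 0 < p -> 0 < s ->
  (\int[mu]_(r in `]0%R, +oo[) (expR (- (s * r `^ p^-1)))%:E =
   (Gamma (p + 1) * s `^ (- p))%:E)%E.
Proof.
move=> p0 s0.
pose f (z : measurableTypeR R * measurableTypeR R) : \bar R :=
  (expR (- z.2) * ((0 < z.1) && (s * z.1 `^ p^-1 <= z.2))%:R)%:E.
have mf : measurable_fun setT f.
  apply/measurable_EFinP; apply: measurable_funM.
    apply: measurableT_comp => //.
    by apply: measurable_funN; exact: measurable_snd.
  apply: measurable_bool_natr; apply: measurable_and.
    by apply: measurable_fun_ltr => //; exact: measurable_fst.
  apply: measurable_fun_ler; last exact: measurable_snd.
  apply: measurable_funM => //.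
  exact: (measurableT_comp (measurable_powR _) measurable_fst).
have f0 z : (0 <= f z)%E by rewrite lee_fin mulr_ge0 ?expR_ge0.
have FT := @fubini_tonelli _ _ _ _ R mu mu f mf f0.
transitivity (\int[mu]_x \int[mu]_y f (x, y))%E.
  clear FT; rewrite integral_itv0y; apply: eq_integral => r _; rewrite /f/=.
  case: (0 < r); rewrite ?mulr1 ?mulr0/= ?integral_exp_tailT//.
  by rewrite integral0_eq// => y _; rewrite mulr0.
rewrite FT; clear FT; rewrite [in RHS]mulrC EFinM -Gamma_integralE ?(ltW p0)// -ge0_integralZl//=; last 3 first.
- by apply: measurable_funTS; exact: measurable_Gamma_integrand.
- by move=> x _; rewrite lee_fin mulr_ge0 ?powR_ge0 ?expR_ge0.
- by rewrite lee_fin powR_ge0.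
under [RHS]eq_integral do rewrite -EFinM.
rewrite integral_itv0y; apply: eq_integral => x _; rewrite /f/=.
have [x0|x0] := ltP 0 x; last first.
  rewrite mulr0 integral0_eq// => r _.
  case: ltP => r0/=; last by rewrite mulr0.
  rewrite (leNgt _ x) (le_lt_trans x0) ?mulr0//.
  by rewrite mulr_gt0 ?powR_gt0.
have a0 : 0 < (x / s) `^ p by rewrite powR_gt0// divr_gt0.
transitivity ((expR (- x))%:E * \int[mu]_r ((((0 < r) && (r <= (x / s) `^ p))%R)%:R)%:E)%E.
  rewrite -ge0_integralZl//=; last first.
    apply/measurable_EFinP; apply: measurable_bool_natr; apply: measurable_and.
      exact: measurable_fun_ltr.
    exact: measurable_fun_ler.
  apply: eq_integral => r _; rewrite -EFinM.
  by case: ltP => //= r0; rewrite powR_ler_swap.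
rewrite integral_oc_natr// -EFinM mulr1; congr EFin.
rewrite powRM ?invr_ge0 ?(ltW x0) ?(ltW s0)//.
rewrite -(powR_inv1 (ltW s0)) -powRrM mulN1r; ring.
Qed.

(** * The Mittag-Leffler function as a Laplace transform *)

Lemma expR_series R (x : R) :
  series (exp_coeff x) n @[n --> \oo] --> expR x.
Proof. by rewrite /expR; exact: is_cvg_series_exp_coeff. Qed.

(** [A] is chosen so that [A^(b k) = (2 z)^k]. Then [Gamma_ge] bounds the [k]-th term by
    [exp A / 2^k], and the geometric sum is at most 2. *)
Lemma mittag_leffler_partial_le R (b z : R) (n : nat) : 0 < b -> 0 < z ->
  series (fun k : nat => z ^+ k / Gamma (b * k%:R + 1)) n <=
    2 * expR ((2 * z) `^ b^-1).
Proof.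
move=> b0 z0; set A := (2 * z) `^ b^-1.
have A0 : 0 < A by rewrite powR_gt0// mulr_gt0.
have term k : z ^+ k / Gamma (b * k%:R + 1) <= expR A * 2^-1 ^+ k.
  have bk0 : 0 <= b * k%:R by rewrite mulr_ge0// ltW.
  rewrite ler_pdivrMr ?Gamma_gt0//.
  apply: (@le_trans _ _ (expR A * 2^-1 ^+ k * (A `^ (b * k%:R) * expR (- A)))); last first.
    by rewrite ler_wpM2l ?Gamma_ge// mulr_ge0 ?expR_ge0// exprn_ge0// invr_ge0.
  have -> : A `^ (b * k%:R) = 2 ^+ k * z ^+ k.
    rewrite /A -powRrM mulrA mulVf ?gt_eqF// mul1r powR_mulrn ?exprMn//.
    by rewrite mulr_ge0// ltW.
  have e1 : expR A * expR (- A) = 1 by rewrite -expRD subrr expR0.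
  have e2 : (2^-1 : R) ^+ k * 2 ^+ k = 1 by rewrite -exprMn mulVf ?expr1n.
  have -> : expR A * 2^-1 ^+ k * (2 ^+ k * z ^+ k * expR (- A)) =
     (expR A * expR (- A)) * (2^-1 ^+ k * 2 ^+ k) * z ^+ k by ring.
  by rewrite e1 e2 !mul1r.
apply: (@le_trans _ _ (\sum_(0 <= k < n) expR A * 2^-1 ^+ k)).
  by apply: ler_sum => k _; exact: term.
rewrite -mulr_sumr mulrC ler_wpM2r ?expR_ge0//.
have -> : \sum_(0 <= k < n) 2^-1 ^+ k = 2 - 2 * 2^-1 ^+ n :> R.
  elim: n => [|n IH]; first by rewrite big_nil expr0 mulr1 subrr.
  by rewrite big_nat_recr//= IH exprS; field.
by rewrite lerBlDr lerDl mulr_ge0// exprn_ge0// invr_ge0.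
Qed.

(** With [p = b k], the double integral of [exp (- S r^(1/p))] over [r > 0] and the probability
    space is computed in both orders. Integrating in [r] first gives [Gamma (p + 1) E (S^(-p))];
    taking the expectation first gives the integral of [exp (- r^(1/k))], which is [k!]. For [k = 0]
    the exponent [1/p] makes no sense, hence the separate case. *)
Lemma stable_moments R (b : R) d (T : measurableType d)
    (P : probability T R) (S : T -> R) (k : nat) :
  0 < b -> measurable_fun setT S -> (forall t, 0 < S t) ->
  (forall l, 0 <= l -> (\int[P]_t (expR (- (l * S t)))%:E)%E = (expR (- l `^ b))%:E) ->
  (\int[P]_t ((S t `^ (- b)) ^+ k)%:E = (k`!%:R / Gamma (b * k%:R + 1))%:E)%E.
Proof.
move=> b0 mS S0 LS; case: k => [|k].
  under eq_integral do rewrite expr0.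
  rewrite mulr0 (Gamma_nat R 0) fact0 divr1 integral_cst// mul1e.
  exact: probability_setT.
set p := b * k.+1%:R.
have p0 : 0 < p by rewrite mulr_gt0// ltr0n.
pose f (z : T * measurableTypeR R) : \bar R :=
  (expR (- (S z.1 * (z.2 : R) `^ p^-1)) * \1_(`]0, +oo[%classic : set R) z.2)%:E.
have mf : measurable_fun setT f.
  apply/measurable_EFinP; apply: measurable_funM.
    apply: measurableT_comp => //; apply: measurable_funN; apply: measurable_funM.
      exact: measurableT_comp.
    exact: (measurableT_comp (measurable_powR _) measurable_snd).
  apply: (measurableT_comp _ measurable_snd); exact: measurable_indic.
have f0 z : (0 <= f z)%E by rewrite lee_fin mulr_ge0 ?expR_ge0.
have FT := @fubini_tonelli _ _ _ _ R P mu f mf f0.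
have mSp q : measurable_fun setT (fun t => S t `^ q).
  exact: (measurableT_comp (measurable_powR _) mS).
have E1 : (\int[P]_x \int[mu]_y f (x, y) =
    (Gamma (p + 1))%:E * \int[P]_t (S t `^ (- p))%:E)%E.
  rewrite -ge0_integralZl//=; last 3 first.
  - exact/measurable_EFinP.
  - by move=> t _; rewrite lee_fin powR_ge0.
  - by rewrite lee_fin ltW// Gamma_gt0// ltW.
  apply: eq_integral => t _; rewrite -EFinM -integral_expR_powR// [RHS]integral_mkcond.
  apply: eq_integral => r _; rewrite patchE /f/= indicE.
  by case: ifPn => _; rewrite ?mulr1 ?mulr0.
have E2 : (\int[mu]_y \int[P]_x f (x, y) = k.+1`!%:R%:E)%E.
  rewrite -(Gamma_nat R k.+1) -[Gamma _]mulr1.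
  have e1 : (1 : R) `^ (- k.+1%:R) = 1 by rewrite powR1.
  rewrite -[X in (_ * X)%R]e1 -integral_expR_powR// ?ltr0n// [RHS]integral_mkcond.
  apply: eq_integral => r _; rewrite patchE.
  have [r0|r0] := ltP 0 r; last first.
    rewrite memNset/=; last by rewrite in_itv/= andbT; apply/negP; rewrite -leNgt.
    rewrite integral0_eq// => t _; rewrite /f indicE memNset ?mulr0//=.
    by rewrite in_itv/= andbT; apply/negP; rewrite -leNgt.
  rewrite mem_set/=; last by rewrite in_itv/= r0.
  transitivity (\int[P]_t (expR (- (r `^ p^-1 * S t)))%:E)%E.
    apply: eq_integral => t _; rewrite /f/= indicE mem_set ?mulr1 1?mulrC//=.
    by rewrite in_itv/= r0.
  rewrite LS ?powR_ge0// mul1r -powRrM; congr (expR (- (_ `^ _)))%:E.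
  by rewrite /p invfM mulrAC mulVf ?gt_eqF// mul1r.
have /eqP := esym E1; rewrite FT E2 => /eqP E.
have GP : 0 < Gamma (p + 1) by rewrite Gamma_gt0// ltW.
have -> : (\int[P]_t ((S t `^ (- b)) ^+ k.+1)%:E = \int[P]_t (S t `^ (- p))%:E)%E.
  apply: eq_integral => t _; congr EFin.
  by rewrite -powR_mulrn ?powR_ge0// -powRrM mulNr.
have : (0 <= \int[P]_t (S t `^ (- p))%:E)%E.
  by apply: integral_ge0 => t _; rewrite lee_fin powR_ge0.
move: E; case: (\int[P]_t _)%E => [x| |]//=.
- by rewrite -EFinM => -[<-] _; congr EFin; field; rewrite gt_eqF.
- by rewrite gt0_muley ?lte_fin.
Qed.

(* [W = S `^ (- b)] with [S] one-sided [b]-stable, whose [k]-th moment is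
   [k! / Gamma (b * k + 1)]. *)
Lemma mittag_leffler_law R (b : R) : 0 < b < 1 ->
  exists d (T : measurableType d) (P : probability T R) (W : T -> R),
    [/\ measurable_fun setT W, (forall t, 0 < W t),
        (forall z, 0 <= z ->
           (\int[P]_t (expR (- (z * W t)))%:E = (mittag_leffler b (- z))%:E)%E) &
        (\int[P]_t (W t)%:E = ((Gamma (b + 1))^-1)%:E)%E].
Proof.
move=> /andP[b0 b1].
have [d [T [P [S [mS S0 LS]]]]] : exists d (T : measurableType d) (P : probability T R) (X : T -> R),
    [/\ measurable_fun setT X, (forall t, 0 < X t) &
        forall l, 0 <= l -> (\int[P]_t (expR (- (l * X t)))%:E)%E = (expR (- l `^ b))%:E].
  by apply: stable_law; rewrite b0 b1.
pose W t := S t `^ (- b).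
have mom k : (\int[P]_t (W t ^+ k)%:E = (k`!%:R / Gamma (b * k%:R + 1))%:E)%E.
  exact: stable_moments.
have mW : measurable_fun setT W by exact: (measurableT_comp (measurable_powR _) mS).
have W0 t : 0 < W t by rewrite powR_gt0.
have mexp (x : R) n : measurable_fun setT (fun t => (series (exp_coeff (x * W t)) n)%:E).
  apply/measurable_EFinP; apply: measurable_sum => k.
  apply: measurable_funM => //; apply: measurable_funX; exact: measurable_funM.
have intWk k : P.-integrable setT (fun t => (W t ^+ k)%:E).
  apply/integrableP; split.
    by apply/measurable_EFinP; exact: measurable_funX.
  under eq_integral => t _ do rewrite gee0_abs ?lee_fin ?exprn_ge0 ?(ltW (W0 t))//.
  by rewrite mom ltry.
have intW x k : P.-integrable setT (fun t => ((x * W t) ^+ k / k`!%:R)%:E).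
  have -> : (fun t => ((x * W t) ^+ k / k`!%:R)%:E) =
            (fun t => (x ^+ k / k`!%:R)%:E * (W t ^+ k)%:E)%E.
    by apply/funext => t; rewrite -EFinM exprMn; congr EFin; ring.
  exact: integrableZl.
have Iexp (x : R) n : P.-integrable setT (fun t => (series (exp_coeff (x * W t)) n)%:E) /\
    (\int[P]_t (series (exp_coeff (x * W t)) n)%:E =
     (series (fun k => x ^+ k / Gamma (b * k%:R + 1)) n)%:E)%E.
  elim: n => [|n [IH1 IH2]].
    rewrite /series/=; split.
      under eq_fun do rewrite big_geq//; exact: integrable0.
    by rewrite big_geq//; under eq_integral do rewrite big_geq//; rewrite integral0.
  have E : (fun t => (series (exp_coeff (x * W t)) n.+1)%:E) =
      (fun t => (series (exp_coeff (x * W t)) n)%:E + ((x * W t) ^+ n / n`!%:R)%:E)%E.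
    by apply/funext => t; rewrite seriesSr EFinD.
  split; first by rewrite E; exact: integrableD.
  rewrite E integralD// IH2 seriesSr EFinD; congr (_ + _)%E.
  have -> : (fun t => ((x * W t) ^+ n / n`!%:R)%:E) =
            (fun t => (x ^+ n / n`!%:R)%:E * (W t ^+ n)%:E)%E.
    by apply/funext => t; rewrite -EFinM exprMn; congr EFin; ring.
  rewrite integralZl//.
  rewrite mom -EFinM; congr EFin; field.
  by rewrite gt_eqF ?Gamma_gt0 ?mulr_ge0 ?(ltW b0)//= pnatr_eq0 -lt0n fact_gt0.
have mE (x : R) : measurable_fun setT (fun t => (expR (x * W t))%:E).
  by apply/measurable_EFinP; apply: measurableT_comp => //; exact: measurable_funM.
exists d, T, P, W; split => //; last first.
  under eq_integral do rewrite -[W _]expr1.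
  have f1 : (1`! = 1)%N by [].
  by rewrite mom f1 mulr1 mul1r.
move=> z; rewrite le_eqVlt => /predU1P[<-|z0].
  under eq_integral do rewrite mul0r oppr0 expR0.
  rewrite integral_cst// mul1e /mittag_leffler.
  transitivity (1%:E : \bar R); first exact: probability_setT.
  congr EFin; apply/esym/cvg_lim => //.
  apply: (@cvg_near_cst _ _ _ _ _); exists 1%N => //= n /= n0.
  case: n n0 => // n _; rewrite /series/= big_nat_recl// expr0 mulr0 (Gamma_nat R 0) fact0 divr1.
  by rewrite big1_seq ?addr0// => k _; rewrite oppr0 exprS !mul0r.
(* The exponential moment of [W] dominates the partial sums at [- z]. It is finite by monotone
   convergence, since the expected partial sums at [z] are those of the Mittag-Leffler series and
   are uniformly bounded. *)
have intE : P.-integrable setT (fun t => (expR (z * W t))%:E).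
  apply/integrableP; split => //.
  under eq_integral do rewrite gee0_abs ?lee_fin ?expR_ge0//.
  have := @cvg_monotone_convergence _ _ _ P setT measurableT
    (fun n t => (series (exp_coeff (z * W t)) n)%:E) (mexp z) _ _.
  have e0 t k : 0 <= exp_coeff (z * W t) k.
    by rewrite /exp_coeff/= divr_ge0// exprn_ge0// mulr_ge0 ?(ltW z0) ?(ltW (W0 t)).
  have h1 n t : [set: T] t -> (0%:E <= (series (exp_coeff (z * W t)) n)%:E)%E.
    by move=> _; rewrite lee_fin /series/= sumr_ge0.
  have h2 t : [set: T] t -> {homo (fun n => (series (exp_coeff (z * W t)) n)%:E) : n m / (n <= m)%N >-> (n <= m)%E}.
    move=> _ n m nm; rewrite lee_fin; exact: nondecreasing_series.
  move=> /(_ h1 h2) H.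
  have -> : (\int[P]_t (expR (z * W t))%:E = \int[P]_t limn (fun n => (series (exp_coeff (z * W t)) n)%:E))%E.
    apply: eq_integral => t _; apply/esym/cvg_lim => //.
    apply: cvg_EFin; first exact: nearW.
    exact: expR_series.
  apply: (@le_lt_trans _ _ (2 * expR ((2 * z) `^ b^-1))%:E); last exact: ltry.
  rewrite -(cvg_lim _ H)//; apply: lime_le; first by apply/cvg_ex; eexists; exact: H.
  by apply: nearW => n; rewrite (Iexp z n).2 lee_fin mittag_leffler_partial_le.
have cvgE t : (series (exp_coeff (- z * W t)) n)%:E @[n --> \oo] --> (expR (- (z * W t)))%:E.
  apply: cvg_EFin; first exact: nearW.
  by rewrite -mulNr; exact: expR_series.
have dom n t : (`|(series (exp_coeff (- z * W t)) n)%:E| <= (expR (z * W t))%:E)%E.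
  rewrite /= lee_fin /series/=; apply: le_trans (ler_norm_sum _ _ _) _.
  have zW : 0 <= z * W t by rewrite mulr_ge0 ?(ltW z0) ?(ltW (W0 t)).
  have e0 k : 0 <= exp_coeff (z * W t) k by rewrite /exp_coeff/= divr_ge0// exprn_ge0.
  apply: (@le_trans _ _ (series (exp_coeff (z * W t)) n)).
    apply: ler_sum => k _; rewrite /exp_coeff/= normrM normfV normrX mulNr normrN.
    by rewrite !ger0_norm.
  rewrite -(cvg_lim _ (@expR_series _ (z * W t)))//.
  by apply: nondecreasing_cvgn_le; [exact: nondecreasing_series|exact: is_cvg_series_exp_coeff].
have := @dominated_cvg _ _ _ P setT measurableT
  (fun n t => (series (exp_coeff (- z * W t)) n)%:E) (fun t => (expR (- (z * W t)))%:E)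
  (fun t => (expR (z * W t))%:E) (mexp (- z)) (fun t _ => cvgE t) (fun t _ => isT) intE
  (fun n t _ => dom n t).
under eq_fun do rewrite (Iexp (- z) _).2.
move=> H.
have Hfin : (\int[P]_t (expR (- (z * W t)))%:E)%E \is a fin_num.
  rewrite ge0_fin_numE; last by apply: integral_ge0 => t _; rewrite lee_fin expR_ge0.
  apply: (@le_lt_trans _ _ (\int[P]_t cst 1%:E t)%E).
    apply: ge0_le_integral => //.
    - by under eq_fun do rewrite -mulNr; exact: mE.
    - by move=> t _; rewrite lee_fin -expR0 ler_expR oppr_le0 mulr_ge0 ?(ltW z0) ?(ltW (W0 t)).
  by rewrite integral_cst// mul1e (le_lt_trans (probability_le1 P measurableT))// ltry.
rewrite -(fineK Hfin) in H *; congr EFin; apply/esym.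
by move/fine_cvg : H => /cvg_lim; apply.
Qed.

(** Take [X = (a W)^(1/g) S] with [S] one-sided [g]-stable and independent of [W]. Given [W], the
    transform is [exp (- (l (a W)^(1/g))^g) = exp (- a l^g W)], and the average over [W] is the
    Mittag-Leffler function at [- a l^g]. *)
Lemma mittag_leffler_mixture R (b g a : R) : 0 < b < 1 -> 0 < g < 1 -> 0 < a ->
  exists d (T : measurableType d) (P : probability T R) (X : T -> R),
    [/\ measurable_fun setT X, (forall t, 0 < X t) &
        forall l, 0 <= l ->
          (\int[P]_t (expR (- (l * X t)))%:E = (mittag_leffler b (- (a * l `^ g)))%:E)%E].
Proof.
move=> b01 g01 a0; have [g0 _] := andP g01.
have [d1 [T1 [P1 [W [mW W0 LW _]]]]] := mittag_leffler_law b01.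
have [d2 [T2 [P2 [S [mS S0 LS]]]]] := stable_law g01.
have [P PE] := probability_prod P1 P2.
pose X (t : T1 * T2) := (a * W t.1) `^ g^-1 * S t.2.
have mX : measurable_fun setT X.
  apply: measurable_funM; last exact: measurableT_comp.
  apply: (measurableT_comp (measurable_powR _)); apply: measurable_funM => //.
  exact: measurableT_comp.
exists _, _, P, X; split => //.
  by move=> t; rewrite mulr_gt0// powR_gt0// mulr_gt0.
move=> l l0; rewrite PE fubini_tonelli1/=; last 2 first.
- apply/measurable_EFinP; apply: measurableT_comp => //; apply: measurable_funN.
  exact: measurable_funM.
- by move=> t; rewrite lee_fin expR_ge0.
rewrite /fubini_F -LW; last by rewrite mulr_ge0 ?powR_ge0 ?(ltW a0).
apply: eq_integral => t _.
transitivity (\int[P2]_y (expR (- ((l * (a * W t) `^ g^-1) * S y)))%:E)%E.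
  by apply: eq_integral => y _; rewrite /X/= mulrA.
rewrite LS ?mulr_ge0 ?powR_ge0//; congr (expR (- _))%:E.
have aW : 0 <= a * W t by rewrite mulr_ge0 ?(ltW a0) ?(ltW (W0 t)).
by rewrite (powRM g l0 (powR_ge0 _ _)) -powRrM mulVf ?gt_eqF// powRr1//; ring.
Qed.

(** Expectation of [1 <= exp (- z W) + z W], with mean [E W = 1 / Gamma (b + 1)]. *)
Lemma mittag_leffler_upper R (b z : R) : 0 < b < 1 -> 0 <= z ->
  1 - mittag_leffler b (- z) <= z / Gamma (b + 1).
Proof.
move=> b01 z0; have [d [T [P [W [mW W0 LW EW]]]]] := mittag_leffler_law b01.
have P1 : (\int[P]_t (cst 1%:E t) = 1%:E)%E.
  by rewrite integral_cst// mul1e; exact: probability_setT.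
have : (\int[P]_t (cst 1%:E t) <= \int[P]_t ((expR (- (z * W t)))%:E + (z * W t)%:E))%E.
  apply: ge0_le_integral => //.
  - apply: emeasurable_funD; apply/measurable_EFinP.
      exact: measurable_expRNM.
    exact: measurable_funM.
  - by move=> t _; rewrite -EFinD lee_fin; have := expR_ge1Dx (- (z * W t)); lra.
rewrite P1 ge0_integralD//=; last 3 first.
- apply/measurable_EFinP.
  exact: measurable_expRNM.
- by move=> t _; rewrite lee_fin mulr_ge0// ltW.
- by apply/measurable_EFinP; exact: measurable_funM.
under [X in (_ <= _ + X)%E]eq_integral do rewrite EFinM.
rewrite LW// ge0_integralZl//=; last 2 first.
- exact/measurable_EFinP.
- by move=> t _; rewrite lee_fin ltW.
by rewrite EW -EFinM -EFinD lee_fin; lra.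
Qed.

(** Concavity of [1 - exp (- x)] between 0 and [w]. The tangent inequality for the exponential at
    [z w] is taken at 0 with weight [1 - z] and at [w] with weight [z]; the linear terms cancel. *)
Lemma oneB_expRN_ge R (z w : R) : 0 <= z <= 1 -> 0 <= w ->
  z * (1 - expR (- w)) <= 1 - expR (- (z * w)).
Proof.
move=> /andP[z0 z1] w0.
have h1 := expR_ge1Dx (z * w); have h2 := expR_ge1Dx (- ((1 - z) * w)).
have e0 := expR_ge0 (- (z * w)).
have E1 : expR (- (z * w)) * expR (z * w) = 1 by rewrite -expRD addNr expR0.
have E2 : expR (- (z * w)) * expR (- ((1 - z) * w)) = expR (- w).
  by rewrite -expRD; congr expR; ring.
have k1 : expR (- (z * w)) * (1 + z * w) <= 1 by rewrite -[leRHS]E1 ler_wpM2l.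
have k2 : expR (- (z * w)) * (1 - (1 - z) * w) <= expR (- w) by rewrite -E2 ler_wpM2l.
have k3 : z * (expR (- (z * w)) * (1 - (1 - z) * w)) <= z * expR (- w) by rewrite ler_wpM2l.
have k4 : (1 - z) * (expR (- (z * w)) * (1 + z * w)) <= (1 - z) * 1.
  by rewrite ler_wpM2l// subr_ge0.
have : z * (expR (- (z * w)) * (1 - (1 - z) * w)) +
  (1 - z) * (expR (- (z * w)) * (1 + z * w)) = expR (- (z * w)) by ring.
lra.
Qed.

Lemma integral_oneB_expRN R d (T : measurableType d) (P : probability T R)
    (X : T -> R) (l c : R) : 0 <= l -> measurable_fun setT X -> (forall t, 0 <= X t) ->
  (\int[P]_t (expR (- (l * X t)))%:E = c%:E)%E ->
  (\int[P]_t (1 - expR (- (l * X t)))%:E = (1 - c)%:E)%E.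
Proof.
move=> l0 mX X0 Lc.
have mE : measurable_fun setT (fun t => expR (- (l * X t))).
  exact: measurable_expRNM.
have : (\int[P]_t ((expR (- (l * X t)))%:E + (1 - expR (- (l * X t)))%:E) = 1)%E.
  rewrite (eq_integral (cst 1%:E)).
    by rewrite integral_cst// mul1e; exact: probability_setT.
  by move=> t _; rewrite -EFinD addrC subrK.
rewrite ge0_integralD//=; last 3 first.
- exact/measurable_EFinP.
- by move=> t _; rewrite lee_fin subr_ge0 -expR0 ler_expR oppr_le0 mulr_ge0.
- by apply/measurable_EFinP; exact: measurable_funB.
rewrite Lc; case: (\int[P]_t _)%E => //= z [<-].
by congr EFin; rewrite addrAC subrr add0r.
Qed.

(** The constant is the slope of the chord from 0 to 1 of a concave function of [z], namely its
    value [1 - E_b(-1)] at 1. *)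
Lemma mittag_leffler_lower R (b : R) : 0 < b < 1 ->
  exists2 c : R, 0 < c &
    forall z, 0 <= z <= 1 -> c * z <= 1 - mittag_leffler b (- z).
Proof.
move=> b01; have [d [T [P [W [mW W0 LW EW]]]]] := mittag_leffler_law b01.
have P1 : (\int[P]_t (cst 1%:E t) = 1%:E)%E.
  by rewrite integral_cst// mul1e; exact: probability_setT.
have mE z : measurable_fun setT (fun t => (expR (- (z * W t)))%:E).
  apply/measurable_EFinP; apply: measurableT_comp => //.
  by apply: measurable_funN; exact: measurable_funM.
have mE' z : measurable_fun setT (fun t => (1 - expR (- (z * W t)))%:E).
  apply/measurable_EFinP; apply: measurable_funB => //.
  exact/measurable_EFinP/mE.
have E0 z t : 0 <= z -> 0 <= 1 - expR (- (z * W t)).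
  by move=> z0; rewrite subr_ge0 -expR0 ler_expR oppr_le0 mulr_ge0// ltW.
have IE z : 0 <= z -> (\int[P]_t (1 - expR (- (z * W t)))%:E =
    (1 - mittag_leffler b (- z))%:E)%E.
  by move=> z0; exact: (integral_oneB_expRN z0 mW (fun t => ltW (W0 t)) (LW z z0)).
exists (1 - mittag_leffler b (- 1)).
  rewrite -lte_fin -IE// lt_neqAle; apply/andP; split; last first.
    by apply: integral_ge0 => t _; rewrite lee_fin E0.
  (* A zero integral would force [1 - exp (- W)] to vanish almost everywhere, although [W > 0] makes
     it positive everywhere. *)
  apply/eqP => /esym I0.
  have /(ae_eq_integral_abs P measurableT (mE' 1)) : (\int[P]_t `|(1 - expR (- (1 * W t)))%:E| = 0)%E.
    by apply: etrans I0; apply: eq_integral => t _; rewrite gee0_abs// lee_fin E0.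
  move=> [N [mN N0 sN]].
  have : P setT = 0%E.
    apply/eqP; rewrite -measure_le0 -N0; apply: le_measure; rewrite ?inE//.
    move=> t _; apply: sN => /= /(_ I) [] h0.
    have : expR (- (1 * W t)) < 1 by rewrite mul1r -expR0 ltr_expR oppr_lt0.
    by move: h0; lra.
  rewrite [X in X = _ -> _]probability_setT => /eqP.
  by rewrite onee_eq0.
move=> z z01; have [z0 z1] := andP z01.
rewrite -lee_fin mulrC EFinM -!IE// -ge0_integralZl//=; last first.
  by move=> t _; rewrite lee_fin E0.
apply: ge0_le_integral => //.
- by move=> t _; rewrite -EFinM lee_fin mulr_ge0// E0.
- exact: emeasurable_funM.
- move=> t _; rewrite -EFinM lee_fin mul1r.
  by apply: oneB_expRN_ge => //; rewrite ltW.
Qed.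

(** * Integrals of derivatives and reflection on the line *)

(** One-dimensional integration by parts in the form used throughout: boundary terms at [- (n + 1)]
    and [n + 1] vanish by the decay of [F], and the truncated integrals converge by domination. *)
Lemma integral_deriv0 R (F f : R -> R) (M : R) :
  (forall x, is_derive x (1 : R) F (f x)) -> continuous f ->
  (mu.-integrable [set: R] (EFin \o f)) ->
  (forall x, `|F x| <= M / (1 + x ^+ 2)) ->
  (\int[mu]_x (f x)%:E = 0)%E.
Proof.
move=> dF cf intf FM.
have mf : measurable_fun [set: R] f by exact: continuous_measurable_fun.
pose f_ (n : nat) x : \bar R := (f x * ((- n.+1%:R <= x) && (x <= n.+1%:R))%:R)%:E.
have mf_ n : measurable_fun [set: R] (f_ n).
  apply/measurable_EFinP; apply: measurable_funM => //; apply: measurable_bool_natr.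
  by apply: measurable_and; exact: measurable_fun_ler.
have If_ n : (\int[mu]_x f_ n x = (F n.+1%:R - F (- n.+1%:R))%:E)%E.
  have n0 : - n.+1%:R < n.+1%:R :> R by rewrite gtrN// ltr0n.
  rewrite EFinB -(@continuous_FTC2 _ f F _ _ n0); last 3 first.
  - exact: continuous_subspaceT.
  - split.
    + by move=> x _; case: (dF x).
    + by apply: cvg_at_right_filter; apply: derivable_cvg; case: (dF (- n.+1%:R)).
    + by apply: cvg_at_left_filter; apply: derivable_cvg; case: (dF n.+1%:R).
  - by move=> x _; rewrite derive1E; case: (dF x).
  rewrite [RHS]integral_mkcond; apply: eq_integral => x _.
  rewrite patchE (_ : (x \in _) = ((- n.+1%:R <= x) && (x <= n.+1%:R))).
    by rewrite /f_; case: (_ && _); rewrite ?mulr1 ?mulr0.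
  by apply/idP/idP; rewrite inE/= in_itv.
have c1 : (\int[mu]_x f_ n x)%E @[n --> \oo] -->
    (\int[mu]_x (f x)%:E)%E.
  apply: (@dominated_cvg _ _ _ mu setT measurableT f_ _ (abse \o (EFin \o f))) => //.
  - move=> x _; apply: cvg_near_cst; near=> n.
    rewrite /f_; have -> : (- n.+1%:R <= x) && (x <= n.+1%:R).
      rewrite -ler_norml; near: n; exists (Num.truncn `|x|) => // n /= xn.
      by rewrite ltW// (lt_le_trans (truncnS_gt _))// ler_nat.
    by rewrite mulr1.
  - exact: integrable_abse.
  - move=> n x _; rewrite /f_ /= lee_fin; case: (_ && _); rewrite ?mulr1// mulr0 normr0//.
have c2 : (\int[mu]_x f_ n x)%E @[n --> \oo] --> 0%E.
  under eq_fun do rewrite If_.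
  apply: cvg_EFin; first exact: nearW.
  rewrite /comp/=; apply/cvgrPdist_le => e e0; near=> n.
  rewrite sub0r normrN; apply: le_trans (ler_normB _ _) _.
  have n1 : (1 : R) <= n.+1%:R by rewrite ler1n.
  have Mn (x : R) : x ^+ 2 = n.+1%:R ^+ 2 -> `|F x| <= `|M| / n.+1%:R.
    move=> xn; apply: (le_trans (FM x)); rewrite xn.
    have n2 : 0 < 1 + n.+1%:R ^+ 2 :> R by rewrite ltr_pwDl// sqr_ge0.
    rewrite ler_pdivrMr// mulrAC ler_pdivlMr ?ltr0n//.
    apply: le_trans (_ : `|M| * n.+1%:R <= _).
      by rewrite ler_wpM2r ?ler_norm.
    by rewrite ler_wpM2l// expr2; nra.
  apply: le_trans (_ : `|M| / n.+1%:R + `|M| / n.+1%:R <= _).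
    by rewrite lerD// Mn// sqrrN.
  rewrite (_ : _ + _ = 2 * `|M| / n.+1%:R); last by rewrite -mulrDl; congr (_ / _); ring.
  rewrite ler_pdivrMr ?ltr0n// [leRHS]mulrC -ler_pdivrMr//.
  near: n; exists (Num.truncn (2 * `|M| / e)) => // n /= xn.
  by rewrite ltW// (lt_le_trans (truncnS_gt _))// ler_nat.
exact: (cvg_unique _ c1 c2).
Unshelve. all: by end_near. Qed.

Lemma ge0_integral_reflect R (b : R) (g : R -> \bar R) :
  measurable_fun [set: R] g -> (forall x, 0 <= g x)%E ->
    (\int[mu]_x g x = \int[mu]_x g (b - x)%R)%E.
Proof.
move=> mg g0; have N0 : (-1 : R) != 0 by rewrite oppr_eq0 oner_eq0.
rewrite (ge0_integral_affine b N0 mg g0) normrN1 mul1e.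
by apply: eq_integral => x _; rewrite mulN1r addrC.
Qed.

Lemma integral_reflect R (b : R) (f : R -> \bar R) :
  measurable_fun [set: R] f ->
  (\int[mu]_x f x = \int[mu]_x f (b - x)%R)%E.
Proof.
move=> mf; rewrite integralE [RHS]integralE; congr (_ - _)%E.
- rewrite (ge0_integral_reflect b (measurable_funepos mf)) => [|x]; last exact: funepos_ge0.
  by apply: eq_integral => x _; rewrite !funeposE.
- rewrite (ge0_integral_reflect b (measurable_funeneg mf)) => [|x]; last exact: funeneg_ge0.
  by apply: eq_integral => x _; rewrite !funenegE.
Qed.

(** * Gaussian kernels *)

(** The kernel of the heat equation with generator the plain second derivative: variance [2 u], so
    that the transform is [exp (- u y^2)] without a factor 1/2. *)
Definition gauss R (u x : R) : R :=
  (Num.sqrt (4 * pi * u))^-1 * expR (- (x ^+ 2 / (4 * u))).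

Lemma gauss_normal R (u x : R) : 0 < u ->
  gauss u x = normal_pdf 0 (Num.sqrt (2 * u)) x.
Proof.
move=> u0; have s0 : Num.sqrt (2 * u) != 0 by rewrite gt_eqF// sqrtr_gt0 mulr_gt0.
rewrite /normal_pdf (negbTE s0) /normal_peak /normal_fun /gauss sqr_sqrtr ?mulr_ge0 ?(ltW u0)//.
congr ((Num.sqrt _)^-1 * expR _).
  by ring.
by rewrite subr0 mulNr; congr (- (_ / _)); ring.
Qed.

Lemma gauss_ge0 R (u x : R) : 0 <= gauss u x.
Proof. by rewrite mulr_ge0 ?invr_ge0 ?sqrtr_ge0 ?expR_ge0. Qed.

Lemma measurable_gauss R (u : R) : measurable_fun [set: R] (gauss u).
Proof.
apply: measurable_funM => //; apply: measurableT_comp => //; apply: measurable_funN.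
apply: measurable_funM => //; exact: measurable_funX.
Qed.

Lemma integral_gauss R (u : R) : 0 < u ->
  (\int[mu]_x (gauss u x)%:E = 1)%E.
Proof.
move=> u0; rewrite -(integral_normal_pdf 0 (Num.sqrt (2 * u))).
by apply: eq_integral => x _; rewrite gauss_normal.
Qed.

Lemma integrable_gauss R (u : R) : 0 < u ->
  mu.-integrable [set: R] (EFin \o gauss u).
Proof.
move=> u0; apply/integrableP; split; first by apply/measurable_EFinP; exact: measurable_gauss.
under eq_integral do rewrite gee0_abs ?lee_fin ?gauss_ge0//.
by rewrite integral_gauss// ltry.
Qed.

Lemma is_derive_gauss R (u x : R) : 0 < u ->
  is_derive x (1 : R) (gauss u) (- (x / (2 * u)) * gauss u x).
Proof.
move=> u0; rewrite /gauss.
have dX : is_derive x (1 : R) (fun y : R => y ^+ 2) (2 * x ^+ 1) := is_derive_exprn 1 x.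
have dZ := is_deriveZ (- (4 * u)^-1) dX.
have dE := is_derive1_comp (is_derive_expR _) dZ.
have dG := is_deriveZ (Num.sqrt (4 * pi * u))^-1 dE.
have e : (fun y : R => (Num.sqrt (4 * pi * u))^-1 * expR (- (y ^+ 2 / (4 * u)))) =
   (Num.sqrt (4 * pi * u))^-1 \*: (expR \o (- (4 * u)^-1 \*: (fun y : R => y ^+ 2))).
  by apply/funext => y; rewrite /= /GRing.scale/= mulNr mulrC [in RHS]mulrC [_^-1 * _ ^+ 2]mulrC.
rewrite e; apply: (is_derive_eq dG); rewrite /= /GRing.scale/= expr1.
rewrite [in RHS](_ : x ^+ 2 / (4 * u) = (4 * u)^-1 * x ^+ 2); last by rewrite mulrC.
rewrite mulNr; set E := expR _; set q := (Num.sqrt _)^-1.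
by field; rewrite gt_eqF.
Qed.

Lemma expRN_le_inv R (t : R) : 0 <= t -> expR (- t) <= (1 + t)^-1.
Proof.
move=> t0; rewrite expRN lef_pV2 ?posrE ?expR_gt0 ?expR_ge1Dx//.
by rewrite ltr_pwDl.
Qed.

Lemma gauss_le R (u : R) : 0 < u ->
  exists M : R, forall x, gauss u x <= M / (1 + x ^+ 2).
Proof.
move=> u0; exists ((Num.sqrt (4 * pi * u))^-1 * (1 + 4 * u)) => x.
rewrite /gauss -[leRHS]mulrA ler_wpM2l ?invr_ge0 ?sqrtr_ge0//.
have u4 : 0 < 4 * u by rewrite mulr_gt0.
have x2 : 0 <= x ^+ 2 by exact: sqr_ge0.
apply: le_trans (expRN_le_inv _) _; first by rewrite divr_ge0// ltW.
rewrite ler_pdivlMr ?ltr_pwDl// mulrC ler_pdivrMr; last by rewrite ltr_pwDl// divr_ge0// ltW.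
set t := x ^+ 2 / (4 * u).
have t0 : 0 <= t by rewrite divr_ge0// ltW.
have -> : x ^+ 2 = 4 * u * t by rewrite /t; field; rewrite gt_eqF.
lra.
Qed.

(** Half of the exponent absorbs [|x|]; the other half is the Gaussian at time [2 u]. *)
Lemma gauss_moment R (u : R) : 0 < u ->
  exists2 M : R, 0 <= M & forall x, `|x| * gauss u x <= M * gauss (2 * u) x.
Proof.
move=> u0; have u8 : 0 < 8 * u by rewrite mulr_gt0.
have su : 0 < Num.sqrt (4 * pi * (2 * u)).
  by rewrite sqrtr_gt0 !mulr_gt0// pi_gt0.
exists ((1 + 8 * u) * Num.sqrt (4 * pi * (2 * u)) / Num.sqrt (4 * pi * u)).
  by rewrite divr_ge0 ?sqrtr_ge0// mulr_ge0 ?sqrtr_ge0// addr_ge0// ltW.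
move=> x; rewrite /gauss.
rewrite (_ : x ^+ 2 / (4 * u) = x ^+ 2 / (8 * u) + x ^+ 2 / (8 * u)); last first.
  by field; rewrite gt_eqF.
rewrite (_ : 4 * (2 * u) = 8 * u); last by ring.
rewrite opprD expRD; set t := x ^+ 2 / (8 * u); set q := (Num.sqrt (4 * pi * u))^-1.
have t0 : 0 <= t by rewrite divr_ge0 ?sqr_ge0// ltW.
have q0 : 0 <= q by rewrite invr_ge0 sqrtr_ge0.
have E1 : `|x| * expR (- t) <= 1 + 8 * u.
  have x2 : x ^+ 2 = 8 * u * t by rewrite /t; field; rewrite gt_eqF.
  have te := @exprn_expRN_le R 1 t t0; have f1 : (1`! = 1)%N by [].
  rewrite expr1 f1 in te.
  have e1 : expR (- t) <= 1 by rewrite -expR0 ler_expR oppr_le0.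
  have ax : `|x| <= 1 + x ^+ 2.
    rewrite -real_normK ?num_real//; have := normr_ge0 x; set y := `|x|; nra.
  have e0 := expR_ge0 (- t).
  have : `|x| * expR (- t) <= (1 + 8 * u * t) * expR (- t) by rewrite -x2 ler_wpM2r.
  nra.
rewrite [leLHS](_ : _ = (q * expR (- t)) * (`|x| * expR (- t))); last by ring.
rewrite [leRHS](_ : _ = (q * expR (- t)) * (1 + 8 * u)); last first.
  by field; rewrite gt_eqF.
by rewrite ler_wpM2l// mulr_ge0// expR_ge0.
Qed.

Lemma integrable_gaussM R (u : R) (h : R -> R) : 0 < u ->
  measurable_fun [set: R] h -> (exists2 M : R, 0 <= M & forall x, `|h x| <= M * (1 + `|x|)) ->
  mu.-integrable [set: R] (fun x => (gauss u x * h x)%:E).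
Proof.
move=> u0 mh [M M0 hM]; have [C C0 gC] := gauss_moment u0.
have u20 : 0 < 2 * u by rewrite mulr_gt0.
apply: (@le_integrable _ _ _ mu _ measurableT _
  (fun x => (M%:E * (gauss u x)%:E + (M * C)%R%:E * (gauss (2 * u)%R x)%:E)%E)).
- by apply/measurable_EFinP; apply: measurable_funM => //; exact: measurable_gauss.
- move=> x _ /=; rewrite lee_fin; apply: le_trans (ler_norm _).
  rewrite normrM (ger0_norm (gauss_ge0 u x)).
  have g0 := gauss_ge0 u x.
  apply: (@le_trans _ _ (gauss u x * (M * (1 + `|x|)))); first by rewrite ler_wpM2l.
  rewrite (_ : _ * (M * _) = M * gauss u x + M * (`|x| * gauss u x)); last by ring.
  by rewrite lerD2l -mulrA ler_wpM2l.
- by apply: integrableD => //; apply: integrableZl => //; exact: integrable_gauss.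
Qed.

(** * Fourier transform of the Gaussian *)

Lemma is_derive_mull R (c x : R) : is_derive x (1 : R) (fun y : R => c * y) c.
Proof.
by apply: (is_derive_eq (is_deriveZ c (is_derive_id x (1 : R)))); rewrite /GRing.scale/= mulr1.
Qed.

Lemma measurable_cos R : measurable_fun [set: R] (@cos R).
Proof. exact: (continuous_measurable_fun (@continuous_cos R)). Qed.

Lemma integrable_cosM R d (T : measurableType d) (m : {measure set T -> \bar R})
    (f h : T -> R) : measurable_fun setT h -> m.-integrable setT (EFin \o f) ->
  m.-integrable setT (fun x => (f x * cos (h x))%:E).
Proof.
move=> mh If; apply: (le_integrable measurableT _ _ If).
  apply/measurable_EFinP; apply: measurable_funM; last exact: (measurableT_comp (@measurable_cos R)).
  by apply/measurable_EFinP; exact: measurable_int If.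
by move=> p _; rewrite lee_fin [leLHS]normrM ler_piMr// cos_max.
Qed.

Lemma measurable_cosM R (t y : R) : measurable_fun [set: R] (fun x : R => cos (t + y * x)).
Proof.
apply: (measurableT_comp (@measurable_cos R)).
by apply: measurable_funD => //; exact: measurable_funM.
Qed.

Lemma integrable_gauss_cos R (u t y : R) : 0 < u ->
  mu.-integrable [set: R] (fun x => (gauss u x * cos (t + y * x))%:E).
Proof.
move=> u0; apply: integrable_gaussM => //; first exact: measurable_cosM.
by exists 1 => // x; rewrite mul1r (le_trans (cos_max _))// lerDl.
Qed.

Lemma integrable_gauss_xsin R (u y : R) : 0 < u ->
  mu.-integrable [set: R] (fun x => (gauss u x * (x * sin (y * x)))%:E).
Proof.
move=> u0; apply: integrable_gaussM => //.
  apply: measurable_funM => //.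
  apply: (measurableT_comp (continuous_measurable_fun (@continuous_sin R))).
  exact: measurable_funM.
exists 1 => // x; rewrite mul1r normrM; have := sin_max (y * x).
by have := normr_ge0 x; have := normr_ge0 (sin (y * x)); nra.
Qed.

(** The integrand is the derivative in [x] of [gauss u x * sin (y * x)]. *)
Lemma integral_gauss_cos_sin R (u y : R) : 0 < u ->
  (\int[mu]_x
    (y * (gauss u x * cos (y * x)) - (2 * u)^-1 * (gauss u x * (x * sin (y * x))))%:E = 0)%E.
Proof.
move=> u0; have [M gM] := gauss_le u0.
pose f (x : R) : R := y * (gauss u x * cos (y * x)) - (2 * u)^-1 * (gauss u x * (x * sin (y * x))).
apply: (@integral_deriv0 _ (fun x => gauss u x * sin (y * x)) f M).
- move=> x; have d2 := is_derive1_comp (is_derive_sin (y * x)) (is_derive_mull y x).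
  apply: (is_derive_eq (is_deriveM (is_derive_gauss x u0) d2)).
  by rewrite /GRing.scale/= /f; field; rewrite gt_eqF.
- apply: derivable_continuous => x.
  have dg : derivable (gauss u) x 1 by case: (is_derive_gauss x u0).
  have dc := is_derive1_comp (is_derive_cos (y * x)) (is_derive_mull y x).
  have ds := is_derive1_comp (is_derive_sin (y * x)) (is_derive_mull y x).
  have dc' : derivable (fun x => cos (y * x)) x 1 by case: dc.
  have ds' : derivable (fun x => sin (y * x)) x 1 by case: ds.
  have di : derivable (fun x : R => x) x 1 by case: (is_derive_id x (1 : R)).
  exact: (derivableB (derivableZ (derivableM dg dc'))
                     (derivableZ (derivableM dg (derivableM di ds')))).
- rewrite (_ : _ \o _ = (fun x => y%:E * (gauss u x * cos (0 + y * x))%:E - ((2 * u)^-1)%:E * (gauss u x * (x * sin (y * x)))%:E)%E); last first.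
    by apply/funext => x; rewrite /= add0r.
  apply: integrableB => //; apply: integrableZl => //.
    exact: integrable_gauss_cos.
  exact: integrable_gauss_xsin.
- move=> x; rewrite normrM (ger0_norm (gauss_ge0 _ _)).
  by apply: le_trans (gM x); rewrite ler_piMr ?gauss_ge0// sin_max.
Qed.

Lemma Rintegral_gauss_xsin R (u y : R) : 0 < u ->
  \int[mu]_x (gauss u x * (x * sin (y * x))) =
    2 * u * y * \int[mu]_x (gauss u x * cos (y * x)).
Proof.
move=> u0.
have intc : mu.-integrable [set: R] (fun x => (gauss u x * cos (y * x))%:E).
  rewrite (_ : (fun x => _) = (fun x => (gauss u x * cos (0 + y * x))%:E)).
    exact: integrable_gauss_cos.
  by apply/funext => x; rewrite add0r.
have intxs := integrable_gauss_xsin y u0.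
have zc : mu.-integrable [set: R] (fun x => (y * (gauss u x * cos (y * x)))%:E).
  rewrite (_ : (fun x => _) = (fun x => y%:E * (gauss u x * cos (y * x))%:E)%E)//.
  exact: integrableZl.
have zs : mu.-integrable [set: R] (fun x => ((2 * u)^-1 * (gauss u x * (x * sin (y * x))))%:E).
  rewrite (_ : (fun x => _) = (fun x => ((2 * u)^-1)%:E * (gauss u x * (x * sin (y * x)))%:E)%E)//.
  exact: integrableZl.
have : \int[mu]_x (y * (gauss u x * cos (y * x)) - (2 * u)^-1 * (gauss u x * (x * sin (y * x)))) = 0.
  by rewrite /Rintegral integral_gauss_cos_sin.
rewrite RintegralB//.
rewrite (RintegralZl _ measurableT intc) (RintegralZl _ measurableT intxs).
set A := \int[_]_x (_ * cos _); set B := \int[_]_x _ => Z'.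
have e : y * A = (2 * u)^-1 * B by apply/eqP; rewrite -subr_eq0 Z'.
by rewrite -mulrA e mulrA mulfV ?mul1r// gt_eqF// mulr_gt0.
Qed.

(** Differentiation under the integral, dominated by [|x| gauss u x], produces the integral of
    [x sin (y x)], which integration by parts returns to the cosine integral. The resulting equation
    is solved with the integrating factor [exp (u y^2)]. *)
Lemma gauss_cos_ode R (u y : R) : 0 < u ->
  is_derive y (1 : R) (fun y => \int[mu]_x (gauss u x * cos (y * x)))
    (- (2 * u * y) * \int[mu]_x (gauss u x * cos (y * x))).
Proof.
move=> u0; pose f y x : R := gauss u x * cos (y * x).
have intc y0 : mu.-integrable [set: R] (EFin \o f y0) by rewrite (_ : _ \o _ = (fun x => (gauss u x * cos (0 + y0 * x))%:E)); [exact: integrable_gauss_cos | apply/funext => x; rewrite add0r].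
have intxs y0 : mu.-integrable [set: R] (fun x => (gauss u x * (x * sin (y0 * x)))%:E).
  exact: integrable_gauss_xsin.
have df y0 x : is_derive y0 (1 : R) (fun y => f y x) (- (gauss u x * (x * sin (y0 * x)))).
  have d2 := is_derive1_comp (is_derive_cos (x * y0)) (is_derive_mull x y0).
  rewrite (_ : f^~ x = gauss u x \*: (cos \o *%R x)); last first.
    by apply/funext => z; rewrite /f /= mulrC [z * x]mulrC mulrC.
  apply: (is_derive_eq (is_deriveZ (gauss u x) d2)).
  by rewrite /GRing.scale/= mulrC mulNr mulrA [x * y0]mulrC; ring.
pose G x := `|x| * gauss u x.
have intG : mu.-integrable [set: R] (EFin \o G).
  rewrite (_ : _ \o _ = (fun x => (gauss u x * `|x|)%:E)); last first.
    by apply/funext => x; rewrite /G/= mulrC.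
  apply: integrable_gaussM => //.
  by exists 1 => // x; rewrite normr_id mul1r lerDr.
have Iy : `]y - 1, y + 1[%classic y by rewrite /= in_itv/= ltrDl ltrBlDr ltrDl ltr01.
have P1E x y0 : partial1of2 f x y0 = - (gauss u y0 * (y0 * sin (x * y0))).
  by rewrite /partial1of2 derive1E; case: (df x y0).
have G0 x : 0 <= G x by rewrite mulr_ge0// gauss_ge0.
have PG x y0 : `]y - 1, y + 1[%classic x -> [set: R] y0 -> `|partial1of2 f x y0| <= G y0.
  move=> _ _; rewrite P1E normrN normrM (ger0_norm (gauss_ge0 _ _)) normrM /G mulrC.
  rewrite ler_wpM2r ?gauss_ge0//; have := sin_max (x * y0).
  by have := normr_ge0 y0; have := normr_ge0 (sin (x * y0)); nra.
have dfd x y0 : `]y - 1, y + 1[%classic x -> [set: R] y0 -> derivable (f^~ y0) x 1.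
  by move=> _ _; case: (df x y0).
have D := @derivable_under_integral R _ _ mu f setT measurableT y (y - 1) (y + 1)
  Iy (fun x _ => intc x) dfd G G0 intG PG.
have V := @differentiation_under_integral R _ _ mu f setT measurableT y (y - 1) (y + 1)
  Iy (fun x _ => intc x) dfd G G0 intG PG.
apply: DeriveDef; first exact: D.
rewrite -derive1E V; clear V D.
under eq_Rintegral do rewrite P1E.
rewrite mulNr -Rintegral_gauss_xsin// -mulN1r -RintegralZl//.
  by apply: eq_Rintegral => x _; exact: esym (mulN1r _).
exact: intxs.
Qed.

Lemma integral_gauss_cos0 R (u y : R) : 0 < u ->
  \int[mu]_x (gauss u x * cos (y * x)) = expR (- (u * y ^+ 2)).
Proof.
move=> u0; pose phi (z : R) := \int[mu]_x (gauss u x * cos (z * x)).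
have dphi (z : R) : is_derive z (1 : R) (fun z => expR (u * z ^+ 2) * phi z) 0.
  have dE := is_derive1_comp (is_derive_expR _) (is_deriveZ u (is_derive_exprn 1 z)).
  apply: (is_derive_eq (is_deriveM dE (gauss_cos_ode z u0))).
  by rewrite /GRing.scale/= -/(phi z); ring.
have := @is_derive_0_is_cst _ _ y 0 dphi.
rewrite /phi expr0n/= mulr0 expR0 mul1r => E.
have I0 : \int[mu]_x (gauss u x * cos (0 * x)) = 1.
  transitivity (\int[mu]_x gauss u x).
    by apply: eq_Rintegral => x _; rewrite mul0r cos0 mulr1.
  by rewrite /Rintegral integral_gauss.
by rewrite I0 in E; rewrite expRN -[RHS]mulr1 -E mulKf// gt_eqF// expR_gt0.
Qed.

(** Reflection averages [cos (t + y x)] and [cos (t - y x)] to [cos t cos (y x)]. The phase [t]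
    replaces complex exponentials, and in several variables it holds the contribution of the other
    coordinates. *)
Lemma integral_gauss_cos R (u t y : R) : 0 < u ->
  (\int[mu]_x (gauss u x * cos (t + y * x))%:E =
    (cos t * expR (- (u * y ^+ 2)))%:E)%E.
Proof.
move=> u0; have fin := integrable_fin_num measurableT (integrable_gauss_cos t y u0).
rewrite -[LHS]fineK//; congr EFin; set A := LHS.
have iN : mu.-integrable [set: R] (fun x => (gauss u x * cos (t - y * x))%:E).
  rewrite (_ : (fun x => _) = (fun x => (gauss u x * cos (t + (- y) * x))%:E)).
    exact: integrable_gauss_cos.
  by apply/funext => x; rewrite mulNr.
have refl : A =
    \int[mu]_x (gauss u x * cos (t - y * x)).
  rewrite /A /Rintegral; congr fine; rewrite (@integral_reflect _ 0).
    by apply: eq_integral => x _; rewrite sub0r mulrN /gauss sqrrN.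
  by apply/measurable_EFinP; apply: measurable_funM; [exact: measurable_gauss|exact: measurable_cosM].
have ic := integrable_gauss_cos 0 y u0.
have : A + \int[mu]_x (gauss u x * cos (t - y * x)) =
    2 * cos t * expR (- (u * y ^+ 2)).
  rewrite /A -/(Rintegral _ _ _) -RintegralD//; last exact: integrable_gauss_cos.
  transitivity (\int[mu]_x (2 * cos t * (gauss u x * cos (0 + y * x)))).
    by apply: eq_Rintegral => x _; rewrite add0r cosD cosB; ring.
  rewrite (RintegralZl _ measurableT ic); congr (_ * _).
  by rewrite -integral_gauss_cos0//; apply: eq_Rintegral => x _; rewrite add0r.
by rewrite -refl; lra.
Qed.

(** * Products of Gaussians and the heat kernel in three dimensions *)

Lemma integrable_prodM R d1 d2 (T1 : measurableType d1) (T2 : measurableType d2)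
    (m1 : {sigma_finite_measure set T1 -> \bar R}) (m2 : {sigma_finite_measure set T2 -> \bar R})
    (f : T1 -> R) (g : T2 -> R) :
  m1.-integrable setT (EFin \o f) -> m2.-integrable setT (EFin \o g) ->
  (m1 \x m2)%E.-integrable setT (fun p => (f p.1 * g p.2)%:E).
Proof.
move=> intf intg.
have mf : measurable_fun setT f by apply/measurable_EFinP; exact: measurable_int intf.
have mg : measurable_fun setT g by apply/measurable_EFinP; exact: measurable_int intg.
have mF : measurable_fun setT (fun p : T1 * T2 => (f p.1 * g p.2)%:E).
  by apply/measurable_EFinP; apply: measurable_funM; exact: measurableT_comp.
apply/(@integrable12ltyP _ _ _ _ _ m1 m2 _ mF).
rewrite (_ : (fun x => _) = (fun x => `|f x|%:E * \int[m2]_y `|(g y)%:E|)%E); last first.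
  apply/funext => x; rewrite -ge0_integralZl//.
    by apply: eq_integral => y _; rewrite /= normrM EFinM.
  by apply/measurable_EFinP; exact: measurableT_comp.
have gfin : (\int[m2]_y `|(g y)%:E| \is a fin_num)%E.
  by rewrite ge0_fin_numE ?integral_ge0//; case/integrableP : intg.
rewrite ge0_integralZr//; last 2 first.
- by apply/measurable_EFinP; exact: measurableT_comp.
- exact: integral_ge0.
have ffin : (\int[m1]_x `|(f x)%:E| \is a fin_num)%E.
  by rewrite ge0_fin_numE ?integral_ge0//; case/integrableP : intf.
by rewrite ltey_eq fin_numM.
Qed.

Lemma integral_prod_gauss_cos R d (T : measurableType d)
    (m : {sigma_finite_measure set T -> \bar R}) (f h : T -> R) (u y : R) : 0 < u ->
  measurable_fun setT h -> m.-integrable setT (EFin \o f) ->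
  (\int[m \x mu]_p (f p.1 * gauss u p.2 * cos (h p.1 + y * p.2))%:E =
   \int[m]_p (f p * cos (h p) * expR (- (u * y ^+ 2)))%:E)%E.
Proof.
move=> u0 mh intf.
have mf : measurable_fun setT f by apply/measurable_EFinP; exact: measurable_int intf.
have I := integrable_prodM intf (integrable_gauss u0).
rewrite -integral12_prod_meas1/=.
  apply: eq_integral => p _; rewrite /fubini_F/=.
  transitivity (\int[mu]_x ((f p)%:E * (gauss u x * cos (h p + y * x))%:E))%E.
    by apply: eq_integral => x _; rewrite -EFinM -mulrA.
  rewrite integralZl//; last exact: integrable_gauss_cos.
  by rewrite integral_gauss_cos// -EFinM mulrA.
apply: integrable_cosM I.
by apply: measurable_funD; [exact: measurableT_comp|exact: measurable_funM].
Qed.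

Definition heat R (u : R) (x : R * R * R) : R :=
  gauss u x.1.1 * gauss u x.1.2 * gauss u x.2.

Lemma heat_ge0 R (u : R) (x : R * R * R) : 0 <= heat u x.
Proof. by rewrite /heat !mulr_ge0 ?gauss_ge0. Qed.

Lemma integrable_gauss2 R (u : R) : 0 < u ->
  (lebesgue2 R).-integrable setT (fun p => (gauss u p.1 * gauss u p.2)%:E).
Proof. by move=> u0; apply: integrable_prodM; exact: integrable_gauss. Qed.

Lemma integrable_heat R (u : R) : 0 < u ->
  (lebesgue3 R).-integrable setT (EFin \o heat u).
Proof.
by move=> u0; exact: (integrable_prodM (integrable_gauss2 u0) (integrable_gauss u0)).
Qed.

Lemma integral_heat_cos R (u t : R) (z : R * R * R) : 0 < u ->
  (\int[lebesgue3 R]_x (heat u x * cos (t + dot3 z x))%:E =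
   (cos t * expR (- (u * dot3 z z)))%:E)%E.
Proof.
move=> u0.
transitivity (\int[lebesgue3 R]_p (gauss u p.1.1 * gauss u p.1.2 * gauss u p.2 *
    cos ((t + z.1.1 * p.1.1 + z.1.2 * p.1.2) + z.2 * p.2))%:E)%E.
  by apply: eq_integral => p _; rewrite /heat /dot3 !addrA.
rewrite (integral_prod_gauss_cos z.2 (h := fun p : measurableTypeR R * measurableTypeR R => t + z.1.1 * p.1 + z.1.2 * p.2)
   u0 _ (integrable_gauss2 u0)); last first.
  apply: measurable_funD; last by apply: measurable_funM => //; exact: measurable_snd.
  by apply: measurable_funD => //; apply: measurable_funM => //; exact: measurable_fst.
under eq_integral do rewrite EFinM.
rewrite integralZr//; last first.
  apply: integrable_cosM (integrable_gauss2 u0).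
  apply: measurable_funD; last by apply: measurable_funM => //; exact: measurable_snd.
  by apply: measurable_funD => //; apply: measurable_funM => //; exact: measurable_fst.
rewrite (integral_prod_gauss_cos z.1.2 (h := fun p : measurableTypeR R => t + z.1.1 * p)
   u0 _ (integrable_gauss u0)); last first.
  by apply: measurable_funD => //; exact: measurable_funM.
under eq_integral do rewrite EFinM.
rewrite integralZr//; last exact: integrable_gauss_cos.
rewrite integral_gauss_cos// -!EFinM -!mulrA -!expRD; congr (_ * expR _)%:E.
by rewrite /dot3; ring.
Qed.

(** A Gaussian in frequency is a multiple of the heat kernel at the dual time [1 / (4 u)], so its
    inverse transform follows from the direct one. *)
Lemma expRN_heat R (u : R) (x : R * R * R) : 0 < u ->
  expR (- (u * dot3 x x)) = Num.sqrt (pi / u) ^+ 3 * heat (4 * u)^-1 x.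
Proof.
move=> u0; have g (s : R) : gauss (4 * u)^-1 s = (Num.sqrt (pi / u))^-1 * expR (- (u * s ^+ 2)).
  rewrite /gauss; congr ((Num.sqrt _)^-1 * expR (- _)); field; rewrite ?gt_eqF//.
have q0 : Num.sqrt (pi / u) != 0 by rewrite gt_eqF// sqrtr_gt0 divr_gt0 ?pi_gt0.
rewrite /heat !g.
rewrite (_ : - (u * dot3 x x) = - (u * x.1.1 ^+ 2) + - (u * x.1.2 ^+ 2) + - (u * x.2 ^+ 2)).
  by rewrite !expRD; field.
by rewrite /dot3; ring.
Qed.

Lemma heatE R (u : R) (x : R * R * R) : 0 < u ->
  heat u x = (Num.sqrt (4 * pi * u))^-1 ^+ 3 * expR (- (dot3 x x / (4 * u))).
Proof.
move=> u0; rewrite /heat /gauss.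
rewrite (_ : - (dot3 x x / (4 * u)) = - (x.1.1 ^+ 2 / (4 * u)) + - (x.1.2 ^+ 2 / (4 * u)) + - (x.2 ^+ 2 / (4 * u))).
  by rewrite !expRD; ring.
by rewrite /dot3; ring.
Qed.

Lemma integral_expRN_cos R (u t : R) (x : R * R * R) : 0 < u ->
  (\int[lebesgue3 R]_z (expR (- (u * dot3 z z)) * cos (t + dot3 x z))%:E =
   (cos t * ((2 * pi) ^+ 3 * heat u x))%:E)%E.
Proof.
move=> u0; have v0 : 0 < (4 * u)^-1 by rewrite invr_gt0 mulr_gt0.
have I : (lebesgue3 R).-integrable setT (fun z => (heat (4 * u)^-1 z * cos (t + dot3 x z))%:E).
  apply: integrable_cosM (integrable_heat v0); apply: measurable_funD => //; rewrite /dot3.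
  apply: measurable_funD; last by apply: measurable_funM => //; exact: measurable_snd.
  by apply: measurable_funD => //; apply: measurable_funM => //; apply: measurableT_comp.
under eq_integral do rewrite expRN_heat// -mulrA EFinM.
rewrite integralZl// integral_heat_cos// -EFinM; congr EFin.
rewrite heatE// mulrCA; congr (_ * _); rewrite mulrA.
rewrite (_ : (4 * u)^-1 * dot3 x x = dot3 x x / (4 * u)); last by rewrite mulrC.
congr (_ * _).
(* Each coordinate contributes one factor [2 pi] of the inversion formula, the rest being the
   normalization of the Gaussian at time [u]. *)
rewrite (_ : Num.sqrt (pi / u) = 2 * pi / Num.sqrt (4 * pi * u)); last first.
  have s0 : Num.sqrt (4 * pi * u) != 0 by rewrite gt_eqF// sqrtr_gt0 !mulr_gt0 ?pi_gt0.
  apply/(mulIf s0); rewrite divfK// -sqrtrM ?divr_ge0 ?pi_ge0 ?(ltW u0)//.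
  rewrite (_ : pi / u * _ = (2 * pi) ^+ 2); last by field; rewrite gt_eqF.
  by rewrite sqrtr_sqr ger0_norm// mulr_ge0 ?pi_ge0.
by rewrite expr_div_n exprVn.
Qed.

(** * Measurability and reflection in three dimensions *)

Lemma ge0_integral_prod_map R d1 d2 (T1 : measurableType d1) (T2 : measurableType d2)
    (m1 : {sigma_finite_measure set T1 -> \bar R}) (m2 : {sigma_finite_measure set T2 -> \bar R})
    (f1 : T1 -> T1) (f2 : T2 -> T2) :
  measurable_fun setT f1 -> measurable_fun setT f2 ->
  (forall g : T1 -> \bar R, measurable_fun setT g -> (forall x, 0 <= g x)%E ->
    \int[m1]_x g x = \int[m1]_x g (f1 x))%E ->
  (forall g : T2 -> \bar R, measurable_fun setT g -> (forall x, 0 <= g x)%E ->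
    \int[m2]_x g x = \int[m2]_x g (f2 x))%E ->
  forall g : T1 * T2 -> \bar R, measurable_fun setT g -> (forall x, 0 <= g x)%E ->
    (\int[m1 \x m2]_x g x = \int[m1 \x m2]_x g (f1 x.1, f2 x.2))%E.
Proof.
move=> mf1 mf2 H1 H2 g mg g0.
have mF : measurable_fun setT (fun x : T1 * T2 => (f1 x.1, f2 x.2)).
  by apply: measurable_fun_pair; exact: measurableT_comp.
have mgF : measurable_fun setT (fun x : T1 * T2 => g (f1 x.1, f2 x.2)) by exact: measurableT_comp.
rewrite (@fubini_tonelli1 _ _ _ _ R m1 m2 _ mg g0) (@fubini_tonelli1 _ _ _ _ R m1 m2 _ mgF)//.
rewrite H1; last 2 first.
- exact: measurable_fun_fubini_tonelli_F.
- by move=> x; exact: integral_ge0.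
apply: eq_integral => x _; rewrite /fubini_F H2//.
exact: measurableT_comp.
Qed.

Lemma measurable_fun3 R :
  [/\ measurable_fun [set: space3 R] (fun x => x.1.1),
      measurable_fun [set: space3 R] (fun x => x.1.2) &
      measurable_fun [set: space3 R] (fun x => x.2)].
Proof. by split => //; apply: measurableT_comp. Qed.

Lemma dot3C R (x y : R * R * R) : dot3 x y = dot3 y x.
Proof. by rewrite /dot3; ring. Qed.

Lemma measurable_dot3_self R : measurable_fun [set: space3 R] (fun x => dot3 x x).
Proof.
have [h1 h2 h3] := measurable_fun3 R.
by apply: measurable_funD; [apply: measurable_funD|]; apply: measurable_funM.
Qed.

Lemma integral_reflect3 R (c : R * R * R) (f : R * R * R -> \bar R) :
  measurable_fun [set: space3 R] f ->
  (\int[lebesgue3 R]_x f x = \int[lebesgue3 R]_x f (c - x)%R)%E.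
Proof.
have key (g : R * R * R -> \bar R) :
    measurable_fun [set: space3 R] g ->
    (forall x, 0 <= g x)%E -> (\int[lebesgue3 R]_x g x = \int[lebesgue3 R]_x g (c - x)%R)%E.
  move=> mg g0.
  have mr b : measurable_fun [set: measurableTypeR R] (fun x : measurableTypeR R => b - x : measurableTypeR R).
    exact: measurable_funB.
  rewrite (@ge0_integral_prod_map _ _ _ _ _ (lebesgue2 R) mu
      (fun x : measurableTypeR R * measurableTypeR R => (c.1.1 - x.1, c.1.2 - x.2))
      (fun x : measurableTypeR R => c.2 - x))//.
  - by apply: measurable_fun_pair; apply: (measurableT_comp (mr _)).
  - move=> h mh h0.
    rewrite (@ge0_integral_prod_map _ _ _ _ _ mu mu
      (fun x : measurableTypeR R => c.1.1 - x)
      (fun x : measurableTypeR R => c.1.2 - x))//; exact: ge0_integral_reflect.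
  - exact: ge0_integral_reflect.
move=> mf; rewrite integralE [RHS]integralE; congr (_ - _)%E.
- rewrite (key _ (measurable_funepos mf)) => [|x]; last exact: funepos_ge0.
  by apply: eq_integral => x _; rewrite !funeposE.
- rewrite (key _ (measurable_funeneg mf)) => [|x]; last exact: funeneg_ge0.
  by apply: eq_integral => x _; rewrite !funenegE.
Qed.

(** * Schwartz functions *)

Lemma integrable_inv_1Dsqr R :
  mu.-integrable [set: R] (fun x : R => ((1 + x ^+ 2)^-1)%:E).
Proof.
have D0 (x : R) : 0 < 1 + x ^+ 2 by rewrite ltr_pwDl// sqr_ge0.
have cf : continuous (fun x : R => (1 + x ^+ 2)^-1).
  move=> x; apply: (@continuousV _ _ (fun x : R => 1 + x ^+ 2)); first by rewrite gt_eqF.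
  move: x; apply: (@derivable_continuous _ (fun x : R => 1 + x ^+ 2)) => y.
  by apply: derivableD => //; case: (is_derive_exprn 1 y).
apply/integrableP; split.
  by apply/measurable_EFinP; exact: continuous_measurable_fun.
rewrite (_ : (\int[_]_x _)%E = (\int[mu]_x ((1 + x ^+ 2)^-1)%:E)%E); last first.
  by apply: eq_integral => x _; rewrite gee0_abs// lee_fin invr_ge0 ltW.
rewrite ge0_symfun_integralT//; last 2 first.
- by move=> x; rewrite invr_ge0 ltW.
- by move=> x /=; rewrite sqrrN.
rewrite (_ : [set x | _] = `[0%R, +oo[%classic); last first.
  by apply/seteqP; split => x /=; rewrite in_itv/= andbT.
have := integral0y_oneDsqr R; rewrite /oneDsqr => ->.
by rewrite -EFinM ltry.
Qed.

(** A common integrable majorant. The product form reduces its integrability to one variable, and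
    the single factors remain available on lines and planes. *)
Definition weight R (p : R * R * R) : R :=
  (1 + p.1.1 ^+ 2)^-1 * (1 + p.1.2 ^+ 2)^-1 * (1 + p.2 ^+ 2)^-1.

Lemma inv_1Dsqr_ge0 R (x : R) : 0 <= (1 + x ^+ 2)^-1.
Proof. by rewrite invr_ge0 addr_ge0// sqr_ge0. Qed.

Lemma inv_1Dsqr_le1 R (x : R) : (1 + x ^+ 2)^-1 <= 1.
Proof. by rewrite invf_le1 ?lerDl ?sqr_ge0// ltr_pwDl// sqr_ge0. Qed.

Lemma weight_ge0 R (p : R * R * R) : 0 <= weight p.
Proof. by rewrite /weight !mulr_ge0 ?inv_1Dsqr_ge0. Qed.

Lemma integrable_weight R :
  (lebesgue3 R).-integrable setT (EFin \o @weight R).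
Proof.
have I := integrable_inv_1Dsqr R.
have I2 : (lebesgue2 R).-integrable setT (fun p => ((1 + p.1 ^+ 2)^-1 * (1 + p.2 ^+ 2)^-1)%:E).
  exact: (integrable_prodM I I).
exact: (integrable_prodM I2 I).
Qed.

Lemma weightE R (p : R * R * R) :
  weight p = ((1 + p.1.1 ^+ 2) * (1 + p.1.2 ^+ 2) * (1 + p.2 ^+ 2))^-1.
Proof. by rewrite /weight !invfM. Qed.

Lemma enorm3_ge0 R (p : R * R * R) : 0 <= enorm3 p.
Proof. exact: sqrtr_ge0. Qed.

Lemma dot3_ge0 R (p : R * R * R) : 0 <= dot3 p p.
Proof. by rewrite /dot3 !addr_ge0// -expr2 sqr_ge0. Qed.

Lemma sqr_enorm3 R (p : R * R * R) : enorm3 p ^+ 2 = dot3 p p.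
Proof. by rewrite /enorm3 sqr_sqrtr// dot3_ge0. Qed.

Lemma measurable_sqr_enorm3 R :
  measurable_fun [set: space3 R] (fun x => enorm3 x ^+ 2).
Proof. by rewrite (funext (@sqr_enorm3 R)); exact: measurable_dot3_self. Qed.

(** Decay of orders 0 and 6 is enough: the inverse of [weight] is at most [(1 + |p|^2)^3], hence at
    most [4 (1 + |p|^6)]. *)
Lemma schwartz_le R (f : R * R * R -> R) : schwartz f ->
  exists2 M : R, 0 <= M & forall p, `|f p| <= M * weight p.
Proof.
move=> /(_ [::])[_ H]; have [M0 h0] := H 0%N; have [M6 h6] := H 6%N.
exists (4 * (`|M0| + `|M6|)); first by rewrite mulr_ge0// addr_ge0.
move=> p; rewrite weightE ler_pdivlMr; last first.
  by rewrite !mulr_gt0// ltr_pwDl// sqr_ge0.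
apply: le_trans (_ : `|f p| * (4 * (1 + enorm3 p ^+ 6)) <= _).
  rewrite ler_wpM2l// (_ : 6 = 2 * 3)%N// exprM sqr_enorm3 /dot3 -!expr2.
  have := sqr_ge0 p.1.1; have := sqr_ge0 p.1.2; have := sqr_ge0 p.2.
  move: (p.1.1 ^+ 2) (p.1.2 ^+ 2) (p.2 ^+ 2) => a b c c0 b0 a0.
  apply: le_trans (_ : (1 + (a + b + c)) ^+ 3 <= _).
    rewrite !exprS expr0 mulr1.
    rewrite mulrA !ler_pM ?addr_ge0// ?mulr_ge0 ?addr_ge0//; lra.
  have : 0 <= a + b + c by rewrite !addr_ge0.
  move: (a + b + c) => s s0.
  (* Three times this quantity is [4 (1 + s^3) - (1 + s)^3]. *)
  have : 0 <= (1 + s) * (s - 1) ^+ 2 by rewrite mulr_ge0 ?sqr_ge0// addr_ge0.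
  by rewrite !exprS expr0; nra.
have := h0 p; have := h6 p; rewrite expr0 mul1r /=.
have := ler_norm M0; have := ler_norm M6; nra.
Qed.

Lemma measurable_fun_fiber (d1 d2 : measure_display) (T : measurableType d1)
    (U : measurableType d2) (K : countType) (g : T -> K) (h : K -> U) :
  (forall k, measurable (g @^-1` [set k])) -> measurable_fun setT (h \o g).
Proof.
move=> mg _ Y mY; rewrite setTI.
rewrite (_ : _ @^-1` Y = \bigcup_(k in [set k | Y (h k)]) (g @^-1` [set k])).
  rewrite bigcup_mkcond; apply: countable_bigcupT_measurable; first exact: countableP.
  by move=> k; case: ifP.
by apply/seteqP; split=> [x Yx|x [k Yk gx]]; [exists (g x)|rewrite /= -[g x]/(g x) gx].
Qed.

Lemma cvg_floorM R (x : R) :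
  (Num.floor (n.+1%:R * x))%:~R / n.+1%:R @[n --> \oo] --> x.
Proof.
apply/cvgrPdist_le => e e0; near=> n.
have n0 : 0 < n.+1%:R :> R by rewrite ltr0n.
have /andP[a b] := floor_itv (n.+1%:R * x).
have -> : x - (Num.floor (n.+1%:R * x))%:~R / n.+1%:R =
  (n.+1%:R * x - (Num.floor (n.+1%:R * x))%:~R) / n.+1%:R.
  by field; rewrite gt_eqF.
rewrite ger0_norm; last by rewrite divr_ge0 ?subr_ge0// ltW.
apply: le_trans (_ : 1 / n.+1%:R <= _).
  by rewrite ler_pM2r ?invr_gt0//; move: b; rewrite intrD; lra.
rewrite ler_pdivrMr// mulrC -ler_pdivrMr// div1r.
near: n; exists (Num.truncn e^-1) => // n /= xn.
by rewrite ltW// (lt_le_trans (truncnS_gt _))// ler_nat.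
Unshelve. all: by end_near. Qed.

Lemma cvg_triple R (f g h : nat -> R) (a b c : R) :
  f n @[n --> \oo] --> a -> g n @[n --> \oo] --> b -> h n @[n --> \oo] --> c ->
  ((f n, g n, h n) @[n --> \oo]) --> ((a, b, c) : R * R * R).
Proof.
move=> fa gb hc; have H : ((f n, g n) @[n --> \oo]) --> ((a, b) : R * R) by exact: (cvg_pair fa gb).
exact: (cvg_pair H hc).
Qed.

(** Continuity refers to the topology of the product, measurability to the product sigma-algebra.
    They are linked by rounding each coordinate down to the grid of mesh [1 / (n + 1)]: the rounded
    function takes countably many values, each on a product of intervals, and converges pointwise to
    [f]. *)
Lemma continuous_measurable_fun3 R (f : R * R * R -> R) : continuous f ->
  measurable_fun [set: space3 R] f.
Proof.
move=> cf.
pose q (n : nat) (x : R) := Num.floor (n.+1%:R * x).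
pose r (n : nat) (k : int * int * int) : R * R * R :=
  (k.1.1%:~R / n.+1%:R, k.1.2%:~R / n.+1%:R, k.2%:~R / n.+1%:R).
have mq n k : measurable [set x : measurableTypeR R | q n x = k].
  rewrite (_ : [set x | _] = `[k%:~R / n.+1%:R, (k + 1)%:~R / n.+1%:R[%classic).
    exact: measurable_itv.
  apply/seteqP; split => x /=; rewrite in_itv/= ler_pdivrMr ?ltr0n// ltr_pdivlMr ?ltr0n//.
    by move=> <-; rewrite ![x * _]mulrC floor_itv.
  by rewrite ![x * _]mulrC; exact: floor_def.
apply: (measurable_fun_cvg (h := fun n (p : space3 R) => (f \o r n) (q n p.1.1, q n p.1.2, q n p.2))).
  move=> n; apply: (measurable_fun_fiber (g := fun p : space3 R => (q n p.1.1, q n p.1.2, q n p.2))).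
  move=> [[k1 k2] k3].
  rewrite (_ : _ @^-1` _ = ([set x | q n x = k1] `*` [set x | q n x = k2]) `*` [set x | q n x = k3]).
    by apply: measurableX; [exact: measurableX|].
  by apply/seteqP; split=> [[[x y] z] /= [-> -> ->]|[[x y] z] /= [[-> ->] ->]].
move=> [[x y] z] _.
have F (a b c : R) : (r n (q n a, q n b, q n c) @[n --> \oo]) --> ((a, b, c) : R * R * R).
  exact: (cvg_triple (@cvg_floorM R a) (@cvg_floorM R b) (@cvg_floorM R c)).
exact: (cvg_comp _ _ (F x y z) (cf (x, y, z))).
Qed.

Lemma schwartz_measurable R (f : R * R * R -> R) : schwartz f ->
  measurable_fun [set: space3 R] f.
Proof.
move=> /(_ [::])[df _]; apply: continuous_measurable_fun3 => x.
exact: differentiable_continuous.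
Qed.

Lemma schwartz_integrable R (f : R * R * R -> R) : schwartz f ->
  (lebesgue3 R).-integrable setT (EFin \o f).
Proof.
move=> sf; have [M M0 fM] := schwartz_le sf.
apply: (@le_integrable _ _ _ (lebesgue3 R) _ measurableT _ (fun p => (M%:E * (weight p)%:E)%E)).
- by apply/measurable_EFinP; exact: schwartz_measurable.
- move=> p _ /=; rewrite lee_fin; apply: le_trans (fM p) _; exact: ler_norm.
- by apply: integrableZl => //; exact: integrable_weight.
Qed.

(** * Derivatives of Schwartz functions and decay of their Fourier transforms *)

Lemma partials_rcons R (s : seq 'I_3) i (f : R * R * R -> R) :
  partials (rcons s i) f = partials s ('D_(basis3 R i) f).
Proof. by rewrite /partials foldr_rcons. Qed.

Lemma schwartzD R i (f : R * R * R -> R) : schwartz f ->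
  schwartz ('D_(basis3 R i) f).
Proof. by move=> sf s; rewrite -partials_rcons; exact: sf. Qed.

Lemma schwartzB R (f g : R * R * R -> R) : schwartz f -> schwartz g ->
  schwartz (f - g).
Proof.
move=> sf sg.
have E s : partials s (f - g) = partials s f - partials s g.
  elim: s => //= i s ->; apply/funext => x.
  have [df _] := sf s; have [dg _] := sg s.
  by rewrite deriveB//; apply: diff_derivable.
move=> s; rewrite E; have [df hf] := sf s; have [dg hg] := sg s; split.
  by move=> x; exact: differentiableB.
move=> n; have [M fM] := hf n; have [N gN] := hg n; exists (M + N) => x.
apply: le_trans (lerD (fM x) (gN x)); rewrite -mulrDr.
by rewrite ler_wpM2l ?exprn_ge0 ?enorm3_ge0// ler_normB.
Qed.

Lemma is_derive_line R (F : R * R * R -> R) (p v : R * R * R) (s : R) :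
  differentiable F (p + s *: v) ->
  is_derive s (1 : R) (fun s => F (p + s *: v)) ('D_v F (p + s *: v)).
Proof.
move=> dF; have dv : derivable F (p + s *: v) v by exact: diff_derivable.
have E : (fun h : R => h^-1 *: (((fun s => F (p + s *: v)) \o shift s) (h *: 1) - F (p + s *: v))) =
         (fun h : R => h^-1 *: ((F \o shift (p + s *: v)) (h *: v) - F (p + s *: v))).
  apply/funext => h /=; congr (_ *: (F _ - _)).
  by rewrite /GRing.scale/= mulr1 -/(GRing.scale _ _) addrCA scalerDl.
by split; [rewrite /derivable E|rewrite /derive E].
Qed.

Lemma basis3_0 R (p : R * R * R) (s : R) :
  p + s *: basis3 R 0 = (p.1.1 + s, p.1.2, p.2).
Proof. by case: p => [[a b] c]; congr (_, _, _); rewrite /= /GRing.scale/= ?mulr1 ?mulr0 ?addr0. Qed.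

Lemma basis3_1 R (p : R * R * R) (s : R) :
  p + s *: basis3 R 1 = (p.1.1, p.1.2 + s, p.2).
Proof. by case: p => [[a b] c]; congr (_, _, _); rewrite /= /GRing.scale/= ?mulr1 ?mulr0 ?addr0. Qed.

Lemma basis3_2 R (p : R * R * R) (s : R) :
  p + s *: basis3 R 2 = (p.1.1, p.1.2, p.2 + s).
Proof. by case: p => [[a b] c]; congr (_, _, _); rewrite /= /GRing.scale/= ?mulr1 ?mulr0 ?addr0. Qed.

Lemma I3_cases (i : 'I_3) : [\/ i = 0, i = 1 | i = 2].
Proof.
case: i => [[|[|[|//]]] Hi]; [constructor 1|constructor 2|constructor 3]; exact: val_inj.
Qed.

(** Fubini with the [i]-th coordinate innermost: the integral over each line in direction [i]
    already vanishes. On such a line [weight] is at most [1 / (1 + s^2)], as its other two factors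
    are at most 1. *)
Lemma integral3_deriv0 R (i : 'I_3) (F f : R * R * R -> R) (M : R) :
  measurable_fun [set: space3 R] f ->
  (forall p s, is_derive s (1 : R) (fun s => F (p + s *: basis3 R i)) (f (p + s *: basis3 R i))) ->
  (forall p, continuous (fun s : R => f (p + s *: basis3 R i))) ->
  0 <= M -> (forall p, `|f p| <= M * weight p) -> (forall p, `|F p| <= M * weight p) ->
  (\int[lebesgue3 R]_p (f p)%:E = 0)%E.
Proof.
move=> mf dF cf M0 fM FM.
have I1 := integrable_inv_1Dsqr R.
have I2 : (lebesgue2 R).-integrable setT (fun p => ((1 + p.1 ^+ 2)^-1 * (1 + p.2 ^+ 2)^-1)%:E).
  exact: (integrable_prodM I1 I1).
have I : (lebesgue3 R).-integrable setT (fun p => (f p)%:E).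
  apply: (@le_integrable _ _ _ (lebesgue3 R) _ measurableT _ (fun p => (M%:E * (weight p)%:E)%E)).
  - exact/measurable_EFinP.
  - by move=> p _ /=; rewrite lee_fin; apply: le_trans (fM p) _; exact: ler_norm.
  - by apply: integrableZl => //; exact: integrable_weight.
have line p : (forall s, weight (p + s *: basis3 R i) <= (1 + s ^+ 2)^-1) ->
    (\int[mu]_s (f (p + s *: basis3 R i))%:E = 0)%E.
  move=> wp; have b (h : R * R * R -> R) s : (forall p, `|h p| <= M * weight p) ->
      `|h (p + s *: basis3 R i)| <= M / (1 + s ^+ 2).
    by move=> hM; rewrite (le_trans (hM _))// ler_wpM2l.
  apply: (@integral_deriv0 _ (fun s => F (p + s *: basis3 R i)) _ M) => //.
  - apply: (@le_integrable _ _ _ mu _ measurableT _ (fun s => (M%:E * ((1 + s ^+ 2)^-1)%:E)%E)).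
    + by apply/measurable_EFinP; exact: continuous_measurable_fun.
    + by move=> s _ /=; rewrite lee_fin (le_trans (b _ _ fM))// ler_norm.
    + exact: integrableZl.
  - by move=> s; exact: b.
have W1 := @inv_1Dsqr_le1 R; have W0 := @inv_1Dsqr_ge0 R.
(* For the first two directions the planar integral is split once more, which requires integrability
   on every plane at fixed third coordinate. *)
have sec (c : R) : (lebesgue2 R).-integrable setT (fun q => (f (q, c))%:E).
  apply: (@le_integrable _ _ _ (lebesgue2 R) _ measurableT _
     (fun q => (M%:E * ((1 + q.1 ^+ 2)^-1 * (1 + q.2 ^+ 2)^-1)%:E)%E)).
  - by apply/measurable_EFinP; apply: (measurableT_comp mf); exact: pair2_measurable.
  - move=> q _ /=; rewrite lee_fin (le_trans (fM _))// (le_trans _ (ler_norm _))// ler_wpM2l//.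
    by rewrite /weight/= ler_piMr// mulr_ge0.
  - exact: integrableZl.
have [i0|i1|i2] := I3_cases i.
- rewrite /lebesgue3 -integral21_prod_meas1// integral0_eq// => c _; rewrite /fubini_G/=.
  rewrite /lebesgue2 -integral21_prod_meas1//.
  rewrite integral0_eq// => b _; rewrite /fubini_G/=.
  have := line (0, b, c); rewrite i0 => L; rewrite -L; last first.
    move=> s; rewrite basis3_0 /weight/= add0r -mulrA ler_piMr// mulr_ile1//.
  by apply: eq_integral => s _; rewrite basis3_0/= add0r.
- rewrite /lebesgue3 -integral21_prod_meas1// integral0_eq// => c _; rewrite /fubini_G/=.
  rewrite /lebesgue2 -integral12_prod_meas1//.
  rewrite integral0_eq// => b _; rewrite /fubini_F/=.
  have := line (b, 0, c); rewrite i1 => L; rewrite -L; last first.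
    move=> s; rewrite basis3_1 /weight/= add0r mulrAC ler_piMl// mulr_ile1//.
  by apply: eq_integral => s _; rewrite basis3_1/= add0r.
- rewrite /lebesgue3 -integral12_prod_meas1// integral0_eq// => -[a b] _; rewrite /fubini_F/=.
  have := line (a, b, 0); rewrite i2 => L; rewrite -L; last first.
    by move=> s; rewrite basis3_2 /weight/= add0r ler_piMl// mulr_ile1.
  by apply: eq_integral => s _; rewrite basis3_2/= add0r.
Qed.

(* Real form of the Fourier transform: the phases 0 and [- pi / 2] give its real
   and imaginary parts. *)
Definition osc R (f : R * R * R -> R) (t : R) (z : R * R * R) : R :=
  \int[lebesgue3 R]_y (f y * cos (t - dot3 y z)).

Lemma measurable_dot3 R (z : R * R * R) :
  measurable_fun [set: space3 R] (fun y => dot3 y z).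
Proof.
rewrite /dot3; apply: measurable_funD; last by apply: measurable_funM => //; exact: measurable_snd.
by apply: measurable_funD => //; apply: measurable_funM => //; apply: measurableT_comp.
Qed.

Lemma measurable_osc_ker R (f : R * R * R -> R) (t : R) (z : R * R * R) :
  schwartz f ->
  measurable_fun [set: space3 R]
    (fun y => f y * cos (t - dot3 y z)).
Proof.
move=> sf; apply: measurable_funM; first exact: schwartz_measurable.
apply: (measurableT_comp (@measurable_cos R)).
by apply: measurable_funB => //; exact: measurable_dot3.
Qed.

Lemma integrable_osc R (f : R * R * R -> R) (t : R) (z : R * R * R) :
  schwartz f -> (lebesgue3 R).-integrable setT (fun y => (f y * cos (t - dot3 y z))%:E).
Proof.
move=> sf; apply: integrable_cosM (schwartz_integrable sf).
by apply: measurable_funB => //; exact: measurable_dot3.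
Qed.

Lemma dot3_line R (p v z : R * R * R) (s : R) :
  dot3 (p + s *: v) z = dot3 p z + dot3 v z * s.
Proof. by rewrite /dot3 /= /GRing.scale/=; ring. Qed.

(** Integration by parts; the quarter turn [t - pi / 2] does the work of the factor [i] in the
    complex formula. *)
Lemma osc_derive R (i : 'I_3) (f : R * R * R -> R) (t : R) (z : R * R * R) :
  schwartz f ->
  osc ('D_(basis3 R i) f) t z = - (dot3 (basis3 R i) z) * osc f (t - pi / 2) z.
Proof.
move=> sf; have sDf := schwartzD i sf.
have [M M0 fM] := schwartz_le sf; have [N N0 DM] := schwartz_le sDf.
set c := dot3 (basis3 R i) z; pose e := basis3 R i.
have df x : differentiable f x by case: (sf [::]).
have dDf x : differentiable ('D_e f) x by case: (sDf [::]).
have I1 := integrable_osc t z sDf; have I2 := integrable_osc (t - pi / 2) z sf.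
have sinE y : cos (t - pi / 2 - dot3 y z) = sin (t - dot3 y z).
  by rewrite -[RHS]cosBpihalf; congr cos; ring.
have dc p s : is_derive s (1 : R) (fun s => cos (t - dot3 (p + s *: e) z))
    (c * sin (t - dot3 (p + s *: e) z)).
  have -> : (fun s : R => cos (t - dot3 (p + s *: e) z)) =
     cos \o (fun s : R => (t - dot3 p z) + (- c) * s).
    by apply/funext => r /=; rewrite dot3_line; congr cos; rewrite /c/e; ring.
  have d1 : is_derive s (1 : R) (fun s : R => (t - dot3 p z) + (- c) * s) (- c).
    apply: (is_derive_eq (is_deriveD (is_derive_cst (t - dot3 p z) s 1) (is_derive_mull (- c) s))).
    by rewrite add0r.
  apply: (is_derive_eq (is_derive1_comp (is_derive_cos _) d1)).
  by rewrite dot3_line /e -/c mulrNN mulrC; congr (_ * sin _); ring.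
have ds p (s : R) : derivable (fun s : R => sin (t - dot3 (p + s *: e) z)) s 1.
  have -> : (fun s : R => sin (t - dot3 (p + s *: e) z)) =
     sin \o (fun s : R => (t - dot3 p z) + (- c) * s).
    by apply/funext => r /=; rewrite dot3_line; congr sin; rewrite /c/e; ring.
  have d1 : is_derive s (1 : R) (fun s : R => (t - dot3 p z) + (- c) * s) (0 - c).
    exact: (is_deriveD (is_derive_cst (t - dot3 p z) s 1) (is_derive_mull (- c) s)).
  by case: (is_derive1_comp (is_derive_sin _) d1).
have Z : \int[lebesgue3 R]_y ('D_e f y * cos (t - dot3 y z) + c * (f y * cos (t - pi / 2 - dot3 y z))) = 0.
  rewrite /Rintegral (_ : (\int[_]_y _)%E = 0%E)//.
  apply: (@integral3_deriv0 _ i (fun y => f y * cos (t - dot3 y z)) _ (N + `|c| * M + M)).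
  - apply: measurable_funD; first exact: measurable_osc_ker.
    by apply: measurable_funM => //; exact: measurable_osc_ker.
  - move=> p s; apply: (is_derive_eq (is_deriveM (is_derive_line (df _)) (dc p s))).
    by rewrite sinE /GRing.scale/= -/e; ring.
  - move=> p; rewrite -/e; under eq_fun do rewrite sinE.
    apply: derivable_continuous => s.
    have d1 : derivable (fun s : R => 'D_e f (p + s *: e)) s 1 by case: (is_derive_line (dDf (p + s *: e))).
    have d2 : derivable (fun s : R => f (p + s *: e)) s 1 by case: (is_derive_line (df (p + s *: e))).
    have d3 : derivable (fun s : R => cos (t - dot3 (p + s *: e) z)) s 1 by case: (dc p s).
    exact: (derivableD (derivableM d1 d3) (derivableZ (derivableM d2 (ds p s)))).
  - by rewrite !addr_ge0// mulr_ge0.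
  - move=> p; apply: le_trans (ler_normD _ _) _; rewrite !normrM.
    have := fM p; have := DM p; have := cos_max (t - dot3 p z); have := cos_max (t - pi / 2 - dot3 p z).
    move=> a1 a2 b1 b2; apply: (@le_trans _ _ (N * weight p + `|c| * (M * weight p))).
      apply: lerD; first by rewrite (le_trans _ b1)// ler_piMr.
      by rewrite ler_wpM2l// (le_trans _ b2)// ler_piMr.
    rewrite [_ * (M * _)]mulrA -mulrDl ler_wpM2r ?weight_ge0// lerDl//.
  - move=> p; rewrite normrM (@le_trans _ _ `|f p|)// ?ler_piMr ?cos_max// (le_trans (fM p))//.
    by rewrite ler_wpM2r ?weight_ge0// lerDr addr_ge0// mulr_ge0.
have I3 : (lebesgue3 R).-integrable setT (fun y => (c * (f y * cos (t - pi / 2 - dot3 y z)))%:E).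
  rewrite (_ : (fun y => _) = (fun y => c%:E * (f y * cos (t - pi / 2 - dot3 y z))%:E)%E)//.
  exact: integrableZl.
move: Z; rewrite RintegralD// (RintegralZl _ measurableT I2) -/(osc _ _ _) -/(osc _ _ _) => Z.
by rewrite mulNr; apply/eqP; rewrite -addr_eq0 Z.
Qed.

Lemma oscBpi R (f : R * R * R -> R) (t : R) (z : R * R * R) : schwartz f ->
  osc f (t - pi / 2 - pi / 2) z = - osc f t z.
Proof.
move=> sf; rewrite /osc -[RHS]mulN1r -RintegralZl//; last exact: integrable_osc.
apply: eq_Rintegral => y _; rewrite mulN1r -[RHS]mulrN; congr (_ * _).
rewrite (_ : t - pi / 2 - pi / 2 - dot3 y z = - (pi - (t - dot3 y z))); last by field.
by rewrite cosN cosB cospi sinpi mul0r addr0 mulN1r.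
Qed.

Lemma osc_derive2 R (i : 'I_3) (f : R * R * R -> R) (t : R) (z : R * R * R) :
  schwartz f ->
  osc ('D_(basis3 R i) ('D_(basis3 R i) f)) t z = - (dot3 (basis3 R i) z ^+ 2) * osc f t z.
Proof.
move=> sf; rewrite osc_derive; last exact: schwartzD.
by rewrite osc_derive// oscBpi//; ring.
Qed.

Lemma oscB R (f g : R * R * R -> R) (t : R) (z : R * R * R) :
  schwartz f -> schwartz g -> osc (f - g) t z = osc f t z - osc g t z.
Proof.
move=> sf sg; rewrite /osc -RintegralB//; try exact: integrable_osc.
by apply: eq_Rintegral => y _; rewrite -mulrBl.
Qed.

(** Applying [1 - D_i^2] in each of the three directions multiplies the transform by the product of
    the [1 + z_i^2], which is the inverse of [weight z]. The constant is the L1 norm of the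
    resulting Schwartz function. *)
Lemma osc_le R (f : R * R * R -> R) : schwartz f ->
  exists2 K : R, 0 <= K & forall t z, `|osc f t z| <= K * weight z.
Proof.
move=> sf; pose L i (g : R * R * R -> R) := g - 'D_(basis3 R i) ('D_(basis3 R i) g).
have sL i g : schwartz g -> schwartz (L i g).
  by move=> sg; apply: schwartzB => //; do 2 apply: schwartzD.
have oL i g t z : schwartz g -> osc (L i g) t z = (1 + dot3 (basis3 R i) z ^+ 2) * osc g t z.
  move=> sg; rewrite oscB//; last by do 2 apply: schwartzD.
  by rewrite osc_derive2//; ring.
pose h := L 0 (L 1 (L 2 f)); have s2 := sL 2 _ sf; have s1 := sL 1 _ s2; have sh := sL 0 _ s1.
exists (\int[lebesgue3 R]_y `|h y|).
  by apply: Rintegral_ge0 => y _.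
move=> t z; rewrite weightE ler_pdivlMr; last first.
  by rewrite !mulr_gt0// ltr_pwDl// sqr_ge0.
rewrite [leLHS](_ : _ = `|osc h t z|); last first.
  rewrite !oL// !normrM !(@ger0_norm _ (1 + _ ^+ 2)) ?addr_ge0 ?sqr_ge0//.
  by rewrite /dot3 /basis3 /=; ring.
apply: le_trans (le_normr_Rintegral measurableT (integrable_osc t z sh)) _.
apply: le_Rintegral => //.
- by have := integrable_norm (integrable_osc t z sh).
- by have := integrable_norm (schwartz_integrable sh).
- by move=> y _; rewrite normrM ler_piMr// cos_max.
Qed.

(** * Gaussian multipliers acting on Schwartz functions *)

Lemma EFin_Rintegral R d (T : measurableType d) (m : {measure set T -> \bar R}) (f : T -> R) :
  m.-integrable setT (EFin \o f) -> ((\int[m]_x f x)%:E = \int[m]_x (f x)%:E)%E.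
Proof. by move=> If; rewrite /Rintegral fineK//; exact: integrable_fin_num. Qed.

Lemma integrableZl_EFin R d (T : measurableType d) (m : {measure set T -> \bar R})
    (c : R) (f : T -> R) :
  m.-integrable setT (EFin \o f) -> m.-integrable setT (EFin \o (fun x => c * f x)).
Proof. by move=> If; exact: (integrableZl measurableT c If). Qed.

Lemma measurable_integral_snd R d1 d2 (T1 : measurableType d1) (T2 : measurableType d2)
    (m2 : {sigma_finite_measure set T2 -> \bar R}) (f : T1 * T2 -> \bar R) :
  measurable_fun setT f -> measurable_fun setT (fun x => \int[m2]_y f (x, y))%E.
Proof.
move=> mf.
rewrite (_ : (fun x => _) = (fun x => \int[m2]_y f^\+ (x, y) - \int[m2]_y f^\- (x, y))%E); last first.
  apply/funext => x; rewrite integralE; congr (_ - _)%E.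
    by apply: eq_integral => y _; rewrite !funeposE.
  by apply: eq_integral => y _; rewrite !funenegE.
apply: emeasurable_funB.
- exact: (@measurable_fun_fubini_tonelli_F _ _ _ _ R m2 _ (measurable_funepos mf)).
- exact: (@measurable_fun_fubini_tonelli_F _ _ _ _ R m2 _ (measurable_funeneg mf)).
Qed.

Lemma measurable_heat_comp R d (T : measurableType d) (X : T -> R) :
  measurable_fun setT X -> (forall t, 0 < X t) ->
  measurable_fun setT (fun p : T * (space3 R) =>
    heat (X p.1) p.2).
Proof.
move=> mX X0.
rewrite (_ : (fun p => _) = (fun p : T * (space3 R) =>
    ((4 * pi * X p.1) `^ (- 2^-1)) ^+ 3 * expR (- (dot3 p.2 p.2 * (4 * X p.1) `^ (-1))))); last first.
  apply/funext => p; rewrite heatE// powR_inv1 ?mulr_ge0 ?(ltW (X0 _))//; congr (_ ^+ 3 * _).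
  by rewrite powRN powR12_sqrt ?mulr_ge0 ?pi_ge0 ?(ltW (X0 _)).
have mX1 : measurable_fun setT (fun p : T * (space3 R) => X p.1).
  exact: measurableT_comp.
have m2 : measurable_fun setT (fun p : T * (space3 R) => dot3 p.2 p.2).
  by apply: (measurableT_comp (@measurable_dot3_self R)); exact: measurable_snd.
apply: measurable_funM.
  apply: measurable_funX; apply: (measurableT_comp (measurable_powR _)).
  exact: measurable_funM.
apply: measurableT_comp => //; apply: measurable_funN; apply: measurable_funM => //.
by apply: (measurableT_comp (measurable_powR _)); exact: measurable_funM.
Qed.

Lemma measurable_sub3 R (x : R * R * R) :
  measurable_fun [set: space3 R]
    (fun y => x - y : space3 R).
Proof.
have [h1 h2 h3] := measurable_fun3 R.
rewrite (_ : (fun y => _) = (fun y => ((x.1.1 - y.1.1, x.1.2 - y.1.2), x.2 - y.2))); last first.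
  by apply/funext.
by apply: measurable_fun_pair; [apply: measurable_fun_pair|]; apply: measurable_funB.
Qed.

Lemma schwartz_integrable_sub R (f : R * R * R -> R) (x : R * R * R) : schwartz f ->
  (lebesgue3 R).-integrable setT (fun z => (f (x - z))%:E).
Proof.
move=> sf; have mf := schwartz_measurable sf.
have /integrableP[_ fi] := schwartz_integrable sf.
apply/integrableP; split.
  by apply/measurable_EFinP; exact: (measurableT_comp mf (measurable_sub3 x)).
rewrite (integral_reflect3 x) in fi => //.
by apply: measurableT_comp => //; exact/measurable_EFinP.
Qed.

(** The factor [cis (dot3 x z)] of the inverse transform becomes a phase, and [y -> x - y] moves it
    into a translate of [f], which is how the convolution appears. *)
Lemma osc_shift R (f : R * R * R -> R) (t : R) (x z : R * R * R) : schwartz f ->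
  ((osc f (dot3 x z + t) z)%:E = \int[lebesgue3 R]_y (f (x - y) * cos (t + dot3 y z))%:E)%E.
Proof.
move=> sf; rewrite EFin_Rintegral; last exact: integrable_osc.
rewrite [LHS](integral_reflect3 x); last first.
  by apply/measurable_EFinP; exact: (measurable_osc_ker _ _ sf).
apply: eq_integral => y _; congr (_ * cos _)%:E.
by rewrite /dot3/=; ring.
Qed.

Lemma measurable_dot3_pair R :
  measurable_fun setT (fun p : space3 R * space3 R => dot3 p.2 p.1).
Proof.
have [h1 h2 h3] := measurable_fun3 R; rewrite /dot3.
have a1 : measurable_fun setT (fun p : space3 R * space3 R => p.2.1.1 * p.1.1.1).
  by apply: measurable_funM; [exact: (measurableT_comp h1)|exact: (measurableT_comp h1)].
have a2 : measurable_fun setT (fun p : space3 R * space3 R => p.2.1.2 * p.1.1.2).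
  by apply: measurable_funM; [exact: (measurableT_comp h2)|exact: (measurableT_comp h2)].
have a3 : measurable_fun setT (fun p : space3 R * space3 R => p.2.2 * p.1.2).
  by apply: measurable_funM; [exact: (measurableT_comp h3)|exact: (measurableT_comp h3)].
by apply: measurable_funD => //; exact: measurable_funD.
Qed.

Lemma measurable_shift_ker R (f : R * R * R -> R) (t : R) (x : R * R * R) :
  schwartz f ->
  measurable_fun setT (fun p : space3 R * space3 R =>
      f (x - p.2) * cos (t + dot3 p.2 p.1)).
Proof.
move=> sf; apply: measurable_funM.
  have h := measurableT_comp (schwartz_measurable sf) (measurable_sub3 x).
  by apply: (measurableT_comp h); exact: measurable_snd.
apply: (measurableT_comp (@measurable_cos R)).
by apply: measurable_funD => //; exact: measurable_dot3_pair.
Qed.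

Lemma measurable_osc R (f : R * R * R -> R) (t : R) (x : R * R * R) : schwartz f ->
  measurable_fun [set: space3 R]
    (fun z => osc f (dot3 x z + t) z).
Proof.
move=> sf; apply/measurable_EFinP.
rewrite (_ : _ \o _ = (fun z => \int[lebesgue3 R]_y (f (x - y) * cos (t + dot3 y z))%:E)%E); last first.
  by apply/funext => z; rewrite -osc_shift.
apply: (measurable_integral_snd (lebesgue3 R)
  (f := fun p : space3 R * space3 R => (f (x - p.2) * cos (t + dot3 p.2 p.1))%:E)).
by apply/measurable_EFinP; exact: measurable_shift_ker.
Qed.

(** Inversion for a Gaussian multiplier: Fubini brings the frequency integral inside, where only the
    explicit transform of the Gaussian is needed. *)
Lemma integral_expRN_osc R (u : R) (f : R * R * R -> R) (t : R) (x : R * R * R) :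
  0 < u -> schwartz f ->
  (\int[lebesgue3 R]_z (expR (- (u * dot3 z z)) * osc f (dot3 x z + t) z)%:E =
   \int[lebesgue3 R]_y (cos t * (2 * pi) ^+ 3 * (heat u y * f (x - y)))%:E)%E.
Proof.
move=> u0 sf; have v0 : 0 < (4 * u)^-1 by rewrite invr_gt0 mulr_gt0.
have iE : (lebesgue3 R).-integrable setT (fun z => (expR (- (u * dot3 z z)))%:E).
  rewrite (_ : (fun z => _) = (fun z => (Num.sqrt (pi / u) ^+ 3)%:E * (heat (4 * u)^-1 z)%:E)%E).
    by apply: integrableZl => //; exact: integrable_heat.
  by apply/funext => z; rewrite expRN_heat.
have mE : measurable_fun [set: space3 R] (fun z => expR (- (u * dot3 z z))).
  by apply/measurable_EFinP; exact: measurable_int iE.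
pose H (p : space3 R * space3 R) :=
  (expR (- (u * dot3 p.1 p.1)) * (f (x - p.2) * cos (t + dot3 p.2 p.1)))%:E.
have iH : (lebesgue3 R \x lebesgue3 R)%E.-integrable setT H.
  apply: le_integrable (integrable_prodM iE (schwartz_integrable_sub x sf)) => //.
    apply/measurable_EFinP; apply: measurable_funM; last exact: measurable_shift_ker.
    by apply: (measurableT_comp mE); exact: measurable_fst.
  by move=> p _; rewrite lee_fin [leLHS]normrM [leRHS]normrM ler_wpM2l// normrM ler_piMr// cos_max.
transitivity (\int[lebesgue3 R]_z \int[lebesgue3 R]_y H (z, y))%E.
  apply: eq_integral => z _; rewrite EFinM osc_shift// -integralZl//.
  apply: integrable_cosM (schwartz_integrable_sub x sf).
  by apply: measurable_funD => //; exact: measurable_dot3.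
rewrite Fubini//; apply: eq_integral => y _.
transitivity (\int[lebesgue3 R]_z ((f (x - y))%:E * (expR (- (u * dot3 z z)) * cos (t + dot3 y z))%:E))%E.
  by apply: eq_integral => z _; rewrite /H/= -EFinM mulrCA.
rewrite integralZl//.
  by rewrite integral_expRN_cos// -EFinM; congr EFin; ring.
apply: integrable_cosM iE; apply: measurable_funD => //; rewrite (funext (dot3C y)).
exact: measurable_dot3.
Qed.

(** * Mixtures of heat kernels *)

(* Heat kernel run up to the random time [X]. *)
Definition heat_mix R d (T : measurableType d) (P : probability T R) (X : T -> R)
    (x : R * R * R) : R :=
  fine (\int[P]_t (heat (X t) x)%:E).

Lemma measurable_heat_mixE R d (T : measurableType d) (P : probability T R) (X : T -> R) :
  measurable_fun setT X -> (forall t, 0 < X t) ->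
  measurable_fun [set: space3 R] (fun x => \int[P]_t (heat (X t) x)%:E)%E.
Proof.
move=> mX X0.
have mH : measurable_fun setT (fun p : T * space3 R => (heat (X p.1) p.2)%:E).
  by apply/measurable_EFinP; exact: measurable_heat_comp.
have H0 (p : T * space3 R) : (0 <= (heat (X p.1) p.2)%:E)%E by rewrite lee_fin heat_ge0.
exact: (@measurable_fun_fubini_tonelli_G _ _ _ _ R P _ mH H0).
Qed.

Lemma integral_heat_mixE R d (T : measurableType d) (P : probability T R) (X : T -> R) :
  measurable_fun setT X -> (forall t, 0 < X t) ->
  (\int[lebesgue3 R]_x \int[P]_t (heat (X t) x)%:E = 1)%E.
Proof.
move=> mX X0.
have mH : measurable_fun setT (fun p : T * space3 R => (heat (X p.1) p.2)%:E).
  by apply/measurable_EFinP; exact: measurable_heat_comp.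
have H0 (p : T * space3 R) : (0 <= (heat (X p.1) p.2)%:E)%E by rewrite lee_fin heat_ge0.
rewrite -(@fubini_tonelli _ _ _ _ R P (lebesgue3 R) _ mH H0).
rewrite (eq_integral (cst 1%:E)); last first.
  move=> t _ /=; have := @integral_heat_cos R (X t) 0 (0, 0, 0) (X0 t).
  rewrite cos0 mul1r /dot3/= !mulr0 !addr0 mulr0 oppr0 expR0 => <-.
  by apply: eq_integral => x _; rewrite !mul0r !add0r cos0 mulr1.
by rewrite integral_cst// mul1e; exact: probability_setT.
Qed.

(** The average may be infinite at some points, where [fine] gives 0; its total mass 1 shows that
    these points form a null set. *)
Lemma heat_mix_ae R d (T : measurableType d) (P : probability T R) (X : T -> R) :
  measurable_fun setT X -> (forall t, 0 < X t) ->
  {ae lebesgue3 R, forall x, setT x ->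
    P.-integrable setT (fun t => (heat (X t) x)%:E)}.
Proof.
move=> mX X0; have mG := measurable_heat_mixE P mX X0.
have G0 x : (0 <= \int[P]_t (heat (X t) x)%:E)%E.
  by apply: integral_ge0 => t _; rewrite lee_fin heat_ge0.
have iG : (lebesgue3 R).-integrable setT (fun x => \int[P]_t (heat (X t) x)%:E)%E.
  apply/integrableP; split => //.
  under eq_integral do rewrite gee0_abs//.
  by rewrite integral_heat_mixE// ltry.
apply: filterS (integrable_ae measurableT iG) => x /(_ I) fx _.
apply/integrableP; split.
  apply/measurable_EFinP.
  exact: (measurableT_comp (measurable_heat_comp mX X0) (pair2_measurable x)).
under eq_integral do rewrite gee0_abs ?lee_fin ?heat_ge0//.
by rewrite -ge0_fin_numE.
Qed.

Lemma measurable_heat_mix R d (T : measurableType d) (P : probability T R) (X : T -> R) :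
  measurable_fun setT X -> (forall t, 0 < X t) ->
  measurable_fun [set: space3 R] (heat_mix P X).
Proof.
move=> mX X0; apply: (measurableT_comp (f := fine)); first exact: fine_measurable.
exact: measurable_heat_mixE.
Qed.

Lemma heat_mix_ge0 R d (T : measurableType d) (P : probability T R) (X : T -> R) x :
  0 <= heat_mix P X x.
Proof. by rewrite fine_ge0// integral_ge0// => t _; rewrite lee_fin heat_ge0. Qed.

Lemma integral_heat_mix R d (T : measurableType d) (P : probability T R) (X : T -> R) :
  measurable_fun setT X -> (forall t, 0 < X t) ->
  (\int[lebesgue3 R]_x (heat_mix P X x)%:E = 1)%E.
Proof.
move=> mX X0; rewrite -(integral_heat_mixE P mX X0); apply: ae_eq_integral => //.
- by apply/measurable_EFinP; exact: measurable_heat_mix.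
- exact: measurable_heat_mixE.
- apply: (@filterS _ (almost_everywhere (lebesgue3 R)) _ _ _ _ (heat_mix_ae P mX X0)) => x /(_ I) ix _.
  by rewrite /heat_mix fineK//; exact: integrable_fin_num ix.
Qed.

Lemma integrable_heat_mix R d (T : measurableType d) (P : probability T R) (X : T -> R) :
  measurable_fun setT X -> (forall t, 0 < X t) ->
  (lebesgue3 R).-integrable setT (EFin \o heat_mix P X).
Proof.
move=> mX X0; apply/integrableP; split.
  by apply/measurable_EFinP; exact: measurable_heat_mix.
under eq_integral do rewrite gee0_abs ?lee_fin ?heat_mix_ge0//.
by rewrite integral_heat_mix// ltry.
Qed.

Lemma schwartz_bounded R (f : R * R * R -> R) : schwartz f ->
  exists M : R, forall x, `|f x| <= M.
Proof.
move=> /(_ [::])[_ /(_ 0%N)[M h]]; exists M => x; have := h x.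
by rewrite expr0 mul1r.
Qed.

Lemma integrable_heat_mix_conv R d (T : measurableType d) (P : probability T R)
    (X : T -> R) (f : R * R * R -> R) (x : R * R * R) :
  measurable_fun setT X -> (forall t, 0 < X t) -> schwartz f ->
  (lebesgue3 R).-integrable setT (fun y => (heat_mix P X y * f (x - y))%:E).
Proof.
move=> mX X0 sf; have [M fM] := schwartz_bounded sf.
apply: (@le_integrable _ _ _ (lebesgue3 R) _ measurableT _ (fun y => (M%:E * (heat_mix P X y)%:E)%E)).
- apply/measurable_EFinP; apply: measurable_funM; first exact: measurable_heat_mix.
  exact: (measurableT_comp (schwartz_measurable sf) (measurable_sub3 x)).
- move=> y _ /=; rewrite lee_fin; apply: le_trans (ler_norm _).
  by rewrite normrM mulrC (ger0_norm (heat_mix_ge0 _ _ _)) ler_wpM2r// heat_mix_ge0.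
- by apply: integrableZl => //; exact: integrable_heat_mix.
Qed.

(** The bounded factor [h] is general because two instances occur: a reflected translate of a
    Schwartz function, and a cosine. *)
Lemma integral_heat_mixM R d (T : measurableType d) (P : probability T R)
    (X : T -> R) (h : R * R * R -> R) (c : R) :
  measurable_fun setT X -> (forall t, 0 < X t) -> measurable_fun [set: space3 R] h ->
  (exists M : R, forall x, `|h x| <= M) ->
  (\int[P]_t \int[lebesgue3 R]_y (c * (heat (X t) y * h y))%:E =
   \int[lebesgue3 R]_y (c * (heat_mix P X y * h y))%:E)%E.
Proof.
move=> mX X0 mh [M fM].
have mH := measurable_heat_comp mX X0.
have iK : (P \x lebesgue3 R)%E.-integrable setT
    (fun p : T * space3 R => (c * (heat (X p.1) p.2 * h p.2))%:E).
  have iH : (P \x lebesgue3 R)%E.-integrable setT (fun p : T * space3 R => (heat (X p.1) p.2)%:E).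
    have H0 (p : T * space3 R) : (0 <= (heat (X p.1) p.2)%:E)%E by rewrite lee_fin heat_ge0.
    have mH' : measurable_fun setT (fun p : T * space3 R => (heat (X p.1) p.2)%:E).
      exact/measurable_EFinP.
    apply/integrableP; split => //.
    under eq_integral do rewrite gee0_abs//.
    rewrite (@fubini_tonelli2 _ _ _ _ R P (lebesgue3 R) _ mH' H0).
    apply: le_lt_trans (ltry 1); rewrite (_ : (\int[_]_y _)%E = 1%E)//.
    exact: (integral_heat_mixE P mX X0).
  apply: (@le_integrable _ _ _ (P \x lebesgue3 R)%E _ measurableT _
    (fun p : T * space3 R => ((`|c| * M)%:E * (heat (X p.1) p.2)%:E)%E)).
  - apply/measurable_EFinP; apply: measurable_funM => //; apply: measurable_funM => //.
    by apply: (measurableT_comp mh); exact: measurable_snd.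
  - move=> p _ /=; rewrite lee_fin; apply: le_trans (ler_norm _).
    rewrite normrM -[`|c| * M * _](mulrA `|c| M) ler_wpM2l// normrM mulrC (ger0_norm (heat_ge0 _ _)).
    by rewrite ler_wpM2r// heat_ge0.
  - exact: integrableZl.
rewrite (Fubini iK) /=; apply: ae_eq_integral => //.
- apply: (@measurable_integral_snd _ _ _ _ _ P (fun p : space3 R * T => (c * (heat (X p.2) p.1 * h p.1))%:E)).
  apply/measurable_EFinP; apply: measurable_funM => //; apply: measurable_funM.
    have sw : measurable_fun setT (fun p : space3 R * T => (p.2, p.1)).
      by apply: measurable_fun_pair; [exact: measurable_snd|exact: measurable_fst].
    exact: (measurableT_comp mH sw).
  by apply: (measurableT_comp mh); exact: measurable_fst.
- apply/measurable_EFinP; apply: measurable_funM => //.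
  apply: measurable_funM; first exact: measurable_heat_mix.
  exact: mh.
- apply: (@filterS _ (almost_everywhere (lebesgue3 R)) _ _ _ _ (heat_mix_ae P mX X0)) => y /(_ I) iy _.
  under eq_integral do rewrite mulrCA EFinM.
  rewrite integralZr// mulrCA [RHS]EFinM /heat_mix fineK//.
  exact: integrable_fin_num iy.
Qed.

Lemma integral_heat_mix_conv R d (T : measurableType d) (P : probability T R)
    (X : T -> R) (f : R * R * R -> R) (c : R) (x : R * R * R) :
  measurable_fun setT X -> (forall t, 0 < X t) -> schwartz f ->
  (\int[P]_t \int[lebesgue3 R]_y (c * (heat (X t) y * f (x - y)))%:E =
   \int[lebesgue3 R]_y (c * (heat_mix P X y * f (x - y)))%:E)%E.
Proof.
move=> mX X0 sf; have [M fM] := schwartz_bounded sf.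
apply: (@integral_heat_mixM _ _ _ P X (fun y => f (x - y)) c mX X0); last by exists M.
exact: (measurableT_comp (schwartz_measurable sf) (measurable_sub3 x)).
Qed.

(** The symbol is expanded as an expectation of Gaussians, Fubini reduces to [integral_expRN_osc]
    for each value of [X], and a second Fubini reassembles the averaged kernel. Domination rests on
    the decay [osc_le] of the transform of [f], the Gaussians being bounded by 1. *)
Lemma integral_symbol_osc R d (T : measurableType d) (P : probability T R)
    (X : T -> R) (m : R -> R) (f : R * R * R -> R) (t : R) (x : R * R * R) :
  measurable_fun setT X -> (forall t, 0 < X t) ->
  (forall l, 0 <= l -> (\int[P]_t (expR (- (l * X t)))%:E = (m l)%:E)%E) ->
  schwartz f ->
  (\int[lebesgue3 R]_z (m (dot3 z z) * osc f (dot3 x z + t) z)%:E =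
   \int[lebesgue3 R]_y (cos t * (2 * pi) ^+ 3 * (heat_mix P X y * f (x - y)))%:E)%E.
Proof.
move=> mX X0 LX sf; have [K K0 oK] := osc_le sf.
have mo := measurable_osc t x sf.
have md := @measurable_dot3_self R.
have mE : measurable_fun setT (fun p : T * space3 R => expR (- (dot3 p.2 p.2 * X p.1))).
  apply: measurableT_comp => //; apply: measurable_funN; apply: measurable_funM.
    by apply: (measurableT_comp md); exact: measurable_snd.
  exact: measurableT_comp.
have E1 z s : expR (- (dot3 z z * X s)) <= 1.
  by rewrite -expR0 ler_expR oppr_le0 mulr_ge0 ?dot3_ge0// ltW.
have iP : P.-integrable setT (fun t => (cst 1 t)%:E).
  apply/integrableP; split; first exact/measurable_EFinP.
  under eq_integral do rewrite /= normr1.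
  by rewrite integral_cst// mul1e (le_lt_trans (probability_le1 _ _))// ltry.
have iH : (P \x lebesgue3 R)%E.-integrable setT
    (fun p : T * space3 R => (expR (- (dot3 p.2 p.2 * X p.1)) * osc f (dot3 x p.2 + t) p.2)%:E).
  apply: (@le_integrable _ _ _ (P \x lebesgue3 R)%E _ measurableT _
    (fun p : T * space3 R => (K%:E * (cst 1 p.1 * weight p.2)%:E)%E)).
  - apply/measurable_EFinP; apply: measurable_funM => //.
    by apply: (measurableT_comp mo); exact: measurable_snd.
  - move=> p _ /=; rewrite lee_fin; apply: le_trans (ler_norm _).
    rewrite normrM mul1r ger0_norm ?expR_ge0//; apply: le_trans (oK (dot3 x p.2 + t) _).
    by rewrite ler_piMl.
  - apply: integrableZl => //; exact: (integrable_prodM iP (integrable_weight R)).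
transitivity (\int[lebesgue3 R]_z \int[P]_s (expR (- (dot3 z z * X s)) * osc f (dot3 x z + t) z)%:E)%E.
  apply: eq_integral => z _; under [RHS]eq_integral do rewrite EFinM.
  rewrite integralZr//; first by rewrite LX// dot3_ge0.
  apply: le_integrable iP => //.
    apply/measurable_EFinP; exact: (measurableT_comp mE (pair2_measurable z)).
  by move=> s _; rewrite lee_fin /= normr1 ger0_norm ?expR_ge0.
rewrite -(Fubini iH) /=.
apply: etrans (integral_heat_mix_conv P (cos t * (2 * pi) ^+ 3) x mX X0 sf).
apply: eq_integral => s _; apply: etrans (integral_expRN_osc t x (X0 s) sf).
apply: eq_integral => z _.
by rewrite [dot3 z z * _]mulrC.
Qed.

Lemma heat_mix_kernel R d (T : measurableType d) (P : probability T R)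
    (X : T -> R) (m : R -> R) :
  measurable_fun setT X -> (forall t, 0 < X t) ->
  (forall l, 0 <= l -> (\int[P]_t (expR (- (l * X t)))%:E = (m l)%:E)%E) ->
  is_convolution_kernel (fun z => (m (dot3 z z))%:C%C) (heat_mix P X).
Proof.
move=> mX X0 LX; split; first exact: measurable_heat_mix.
move=> f sf x; split; first exact: integrable_heat_mix_conv.
have cE y z : cos (- dot3 y z) = cos (0 - dot3 y z) by rewrite sub0r.
have sE (y z : R * R * R) : sin (- dot3 y z) = cos (- (pi / 2) - dot3 y z).
  by rewrite -[LHS]cosBpihalf; congr cos; ring.
have FE z : fourier (fun y => (f y)%:C%C) z = (osc f 0 z +i* osc f (- (pi / 2)) z)%C.
  rewrite /fourier /cintegral3 /osc; congr (_ +i* _)%C; apply: eq_Rintegral => y _.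
    by rewrite /= mul0r subr0 cE.
  by rewrite /= mul0r addr0 sE.
(* The addition formula that identifies the real and imaginary parts of
   [fourier f z * cis (dot3 x z)] with phases of [osc]. *)
have oD (a t : R) z : osc f (a + t) z = cos a * osc f t z - sin a * osc f (t - pi / 2) z.
  rewrite /osc -!RintegralZl//; try exact: integrable_osc.
  rewrite -RintegralB//.
  - apply: eq_Rintegral => y _; rewrite (_ : a + t - dot3 y z = a + (t - dot3 y z)); last by rewrite addrA.
    rewrite cosD (_ : t - pi / 2 - dot3 y z = (t - dot3 y z) - pi / 2); last by ring.
    by rewrite cosBpihalf; ring.
  - by apply: integrableZl_EFin; exact: integrable_osc.
  - by apply: integrableZl_EFin; exact: integrable_osc.
rewrite /fourier_multiplier /inv_fourier /cintegral3.
have reE : \int[lebesgue3 R]_z complex.Re ((m (dot3 z z))%:C%C * fourier (fun y => (f y)%:C%C) z * cis (dot3 x z)) =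
    (2 * pi) ^+ 3 * convolution3 (heat_mix P X) f x.
  transitivity (\int[lebesgue3 R]_z (m (dot3 z z) * osc f (dot3 x z + 0) z)).
    by apply: eq_Rintegral => z _; rewrite FE oD sub0r /=; ring.
  rewrite /Rintegral (integral_symbol_osc 0 x mX X0 LX sf) -/(Rintegral _ _ _).
  rewrite cos0 mul1r RintegralZl//; exact: integrable_heat_mix_conv.
(* The phase is [- pi / 2], so the factor [cos t] of [integral_symbol_osc] is 0. *)
have imE : \int[lebesgue3 R]_z complex.Im ((m (dot3 z z))%:C%C * fourier (fun y => (f y)%:C%C) z * cis (dot3 x z)) = 0.
  transitivity (\int[lebesgue3 R]_z (m (dot3 z z) * osc f (dot3 x z + (- (pi / 2))) z)).
    apply: eq_Rintegral => z _; rewrite FE oD /=.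
    have -> : osc f (- (pi / 2) - pi / 2) z = - osc f 0 z by rewrite -oscBpi// sub0r.
    by ring.
  rewrite /Rintegral (integral_symbol_osc (- (pi / 2)) x mX X0 LX sf) -/(Rintegral _ _ _).
  apply: etrans (RintegralZl _ measurableT (integrable_heat_mix_conv P x mX X0 sf)) _.
  by rewrite cosN cos_pihalf !mul0r.
rewrite reE imE; apply/eqP; rewrite eq_complex /= !mul0r !mulr0 subr0 addr0 mulKf ?eqxx//.
by rewrite expf_neq0// gt_eqF// mulr_gt0// pi_gt0.
Qed.

(* 31 = 1 + 4 * 1! + 2! + 4 * 3!, from [y ^+ n * expR (- y) <= n!]. *)
Lemma heat_le R (u : R) (x : R * R * R) : 0 < u -> 0 < enorm3 x ->
  heat u x <= 31 / enorm3 x ^+ 3 * (1 - expR (- (u / enorm3 x ^+ 2))).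
Proof.
move=> u0 r0; rewrite heatE// -sqr_enorm3; set r := enorm3 x in r0 *.
have r30 : 0 < r ^+ 3 by rewrite exprn_gt0.
have p0 := @pi_gt0 R; have p1 : 1 <= (pi : R) by rewrite (le_trans _ (@pi_ge2 R))// ler1n.
set s := Num.sqrt (4 * pi * u); have s0 : 0 < s by rewrite sqrtr_gt0 !mulr_gt0.
have s2 : s ^+ 2 = 4 * pi * u by rewrite sqr_sqrtr// !mulr_ge0// ltW.
set y := r ^+ 2 / (4 * u); have y0 : 0 < y by rewrite divr_gt0 ?exprn_gt0// mulr_gt0.
pose q := r / s; have q0 : 0 < q by rewrite divr_gt0.
have q2 : q ^+ 2 <= y.
  rewrite expr_div_n s2 (_ : 4 * pi * u = (4 * u) * pi); last by ring.
  by rewrite invfM mulrA ler_pdivrMr// ler_peMr// ltW.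
(* The heat kernel has the half-integer power 3/2 of [y]; this replaces it by integer powers, which
   [exprn_expRN_le] controls. *)
have q3 : q ^+ 3 <= 1 + y ^+ 2.
  have : q ^+ 2 * q ^+ 2 <= y * y by rewrite ler_pM// ?sqr_ge0.
  rewrite -expr2 !exprS expr0 !mulr1; nra.
have e1 : expR (- y) <= 1 by rewrite -expR0 ler_expR oppr_le0 ltW.
have [yl f1] : 0 <= y /\ (1`! = 1)%N by split => //; exact: ltW.
have f2 : (2`! = 2)%N by []. have f3 : (3`! = 6)%N by [].
have m1 := exprn_expRN_le 1 yl; have m2 := exprn_expRN_le 2 yl; have m3 := exprn_expRN_le 3 yl.
rewrite f1 in m1; rewrite f2 in m2; rewrite f3 in m3.
have vE : u / r ^+ 2 = (4 * y)^-1 by rewrite /y; field; rewrite !gt_eqF.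
have y40 : 0 < 1 + 4 * y by lra.
(* From [exp (- v) <= 1 / (1 + v)] at [v = u / |x|^2 = 1 / (4 y)]. It remains to bound
   [(1 + y^2) (1 + 4 y) exp (- y)] by 31. *)
have low : (1 + 4 * y)^-1 <= 1 - expR (- (u / r ^+ 2)).
  have v0 : 0 <= (4 * y)^-1 by rewrite invr_ge0; lra.
  have := expRN_le_inv v0; rewrite vE.
  have -> : (1 + (4 * y)^-1)^-1 = 1 - (1 + 4 * y)^-1 by field; rewrite !gt_eqF//; lra.
  lra.
have -> : s^-1 ^+ 3 * expR (- y) = (q ^+ 3 * expR (- y)) / r ^+ 3.
  by rewrite /q; field; rewrite !gt_eqF.
rewrite [leRHS]mulrAC ler_pM2r ?invr_gt0//.
apply: le_trans (_ : 31 * (1 + 4 * y)^-1 <= _); last by rewrite ler_wpM2l.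
rewrite ler_pdivlMr//.
have e0 := expR_ge0 (- y).
apply: (@le_trans _ _ ((1 + y ^+ 2) * expR (- y) * (1 + 4 * y))).
  by rewrite ler_wpM2r ?ler_wpM2r// ltW.
move: m1 m2 m3; rewrite !exprS expr0 !mulr1; move: (expR _) e0 e1 => e e0 e1.
move=> m1 m2 m3.
have -> : (1 + y * y) * e * (1 + 4 * y) = e + 4 * (y * e) + (y * y * e) + 4 * (y * (y * y) * e) by ring.
move: (y * e) (y * y * e) (y * (y * y) * e) m1 m2 m3 => A B D; lra.
Qed.

Lemma heat_mix_le R d (T : measurableType d) (P : probability T R)
    (X : T -> R) (m : R -> R) (x : R * R * R) :
  measurable_fun setT X -> (forall t, 0 < X t) ->
  (forall l, 0 <= l -> (\int[P]_t (expR (- (l * X t)))%:E = (m l)%:E)%E) ->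
  0 < enorm3 x ->
  heat_mix P X x <= 31 / enorm3 x ^+ 3 * (1 - m (enorm3 x ^- 2)).
Proof.
move=> mX X0 LX r0; set r := enorm3 x in r0 *.
have c0 : 0 <= 31 / r ^+ 3 by rewrite divr_ge0// exprn_ge0// ltW.
have l0 : 0 <= r ^- 2 by rewrite invr_ge0 sqr_ge0.
have mE : measurable_fun setT (fun t => expR (- (r ^- 2 * X t))).
  exact: measurable_expRNM.
have E1 t : expR (- (r ^- 2 * X t)) <= 1.
  by rewrite -expR0 ler_expR oppr_le0 mulr_ge0// ltW.
have I1 := integral_oneB_expRN l0 mX (fun t => ltW (X0 t)) (LX _ l0).
have H : (\int[P]_t (heat (X t) x)%:E <= (31 / r ^+ 3 * (1 - m (r ^- 2)))%:E)%E.
  rewrite EFinM -I1 -ge0_integralZl//; last 2 first.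
  - by apply/measurable_EFinP; exact: measurable_funB.
  - by move=> t _; rewrite lee_fin subr_ge0.
  apply: ge0_le_integral => //.
  - by move=> t _; rewrite lee_fin heat_ge0.
  - by apply/measurable_EFinP; exact: (measurableT_comp (measurable_heat_comp mX X0) (pair2_measurable x)).
  - by apply/measurable_EFinP; apply: measurable_funM => //; exact: measurable_funB.
  - by move=> t _; rewrite -EFinM lee_fin [r ^- 2 * _]mulrC; exact: heat_le.
have /fineK E : (\int[P]_t (heat (X t) x)%:E \is a fin_num)%E.
  rewrite ge0_fin_numE; first exact: le_lt_trans H (ltry _).
  by apply: integral_ge0 => t _; rewrite lee_fin heat_ge0.
by rewrite -lee_fin /heat_mix E.
Qed.

(** * Second moments and failure of rapid decay *)

Lemma sqr_sin_le R (x : R) : sin x ^+ 2 <= x ^+ 2.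
Proof.
have key (y : R) : 0 < y -> sin y ^+ 2 <= y ^+ 2.
  move=> y0; have [|c _] := @MVT R sin cos 0 y y0 (fun z _ => is_derive_sin z).
    by apply: continuous_subspaceT; exact: continuous_sin.
  rewrite sin0 !subr0 => ->; rewrite exprMn ler_piMl ?sqr_ge0//.
have [x0|x0|<-] := ltgtP 0 x; first exact: key; last by rewrite sin0.
by rewrite -sqrrN -[leRHS]sqrrN -sinN key// oppr_gt0.
Qed.

Lemma oneB_cos_le R (x : R) : 1 - cos x <= x ^+ 2.
Proof.
have := sqr_sin_le (x / 2); have := cos2Dsin2 (x / 2); have := sqr_ge0 x.
have -> : cos x = cos (x / 2) * cos (x / 2) - sin (x / 2) * sin (x / 2).
  by rewrite -cosD -splitr.
by rewrite !expr2; lra.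
Qed.

Lemma measurable_cos_dot3 R (z : R * R * R) :
  measurable_fun [set: space3 R] (fun x => cos (dot3 z x)).
Proof.
apply: (measurableT_comp (@measurable_cos R)).
by rewrite (funext (dot3C z)); exact: measurable_dot3.
Qed.

(** Links the symbol near 0 to the tail of the kernel: since [1 - cos] is at most quadratic, a
    finite second moment would bound [1 - m (|z|^2)] by a multiple of [|z|^2]. *)
Lemma integral_heat_mix_cos R d (T : measurableType d) (P : probability T R)
    (X : T -> R) (m : R -> R) (z : R * R * R) :
  measurable_fun setT X -> (forall t, 0 < X t) ->
  (forall l, 0 <= l -> (\int[P]_t (expR (- (l * X t)))%:E = (m l)%:E)%E) ->
  (\int[lebesgue3 R]_x (heat_mix P X x * (1 - cos (dot3 z x)))%:E = (1 - m (dot3 z z))%:E)%E.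
Proof.
move=> mX X0 LX.
have mc := measurable_cos_dot3 z.
have c1 (x : R * R * R) : `|cos (dot3 z x)| <= 1 by exact: cos_max.
have E := integral_heat_mixM P 1 mX X0 mc (ex_intro _ 1 c1).
have C : (\int[lebesgue3 R]_x (heat_mix P X x * cos (dot3 z x))%:E = (m (dot3 z z))%:E)%E.
  transitivity (\int[lebesgue3 R]_x (1 * (heat_mix P X x * cos (dot3 z x)))%:E)%E.
    by apply: eq_integral => x _; rewrite mul1r.
  rewrite -E -LX ?dot3_ge0//; apply: eq_integral => t _.
  transitivity (\int[lebesgue3 R]_x (heat (X t) x * cos (0 + dot3 z x))%:E)%E.
    by apply: eq_integral => x _; rewrite mul1r add0r.
  by rewrite integral_heat_cos// cos0 mul1r mulrC.
have I0 := integrable_heat_mix P mX X0.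
have I1 : (lebesgue3 R).-integrable setT (fun x => (heat_mix P X x * cos (dot3 z x))%:E).
  by apply: integrable_cosM I0; rewrite (funext (dot3C z)); exact: measurable_dot3.
transitivity (\int[lebesgue3 R]_x ((heat_mix P X x)%:E - (heat_mix P X x * cos (dot3 z x))%:E))%E.
  by apply: eq_integral => x _; rewrite -EFinB mulrBr mulr1.
by rewrite integralB// integral_heat_mix// C EFinB.
Qed.

(** Explains the rate 8: once the second moment has taken [|x|^2], there remains [|x|^-6], the order
    of [weight]. The factor 8 comes from [(1 + |x|^2)^3 <= (2 |x|^2)^3] for [|x| >= 1]. *)
Lemma weight_enorm3 R (x : R * R * R) : 1 <= enorm3 x ->
  enorm3 x ^+ 2 * enorm3 x `^ (- 8) <= 8 * weight x.
Proof.
move=> r1; have r0 : 0 < enorm3 x by rewrite (lt_le_trans _ r1).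
rewrite powRN (_ : enorm3 x `^ 8 = enorm3 x ^+ 8); last exact: powR_mulrn (ltW r0).
rewrite weightE.
rewrite ler_pdivlMr; last by rewrite !mulr_gt0// ltr_pwDl// sqr_ge0.
rewrite mulrAC ler_pdivrMr ?exprn_gt0//.
have e8 : enorm3 x ^+ 8 = enorm3 x ^+ 2 * (enorm3 x ^+ 2) ^+ 3 by rewrite -exprM -exprD.
rewrite e8 [leRHS]mulrCA ler_wpM2l ?sqr_ge0//.
have : 1 <= enorm3 x ^+ 2 by rewrite exprn_ege1.
rewrite sqr_enorm3 /dot3 -!expr2.
have := sqr_ge0 x.1.1; have := sqr_ge0 x.1.2; have := sqr_ge0 x.2.
move: (x.1.1 ^+ 2) (x.1.2 ^+ 2) (x.2 ^+ 2) => a b c c0 b0 a0 s1.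
have s0 : 0 <= a + b + c by rewrite !addr_ge0.
rewrite (_ : 8 * _ = (2 * (a + b + c)) * (2 * (a + b + c)) * (2 * (a + b + c))); last by ring.
by rewrite !ler_pM ?mulr_ge0 ?addr_ge0//; lra.
Qed.

(** Inside a ball of radius [r] the integrand is at most [r^2 G]; outside, the decay gives a
    multiple of [weight]. The radius is at least 1 so that [weight_enorm3] applies. *)
Lemma second_moment_of_decay R (G : R * R * R -> R) :
  measurable_fun [set: space3 R] G -> (forall x, 0 <= G x) ->
  (lebesgue3 R).-integrable setT (EFin \o G) ->
  decays_at_rate G 8 ->
  exists2 K : R, 0 <= K & (\int[lebesgue3 R]_x (enorm3 x ^+ 2 * G x)%:E <= K%:E)%E.
Proof.
move=> mG G0 iG [M [r0 GM]]; pose r := Num.max 1 r0.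
have mn := @measurable_sqr_enorm3 R.
have iW := integrable_weight R.
pose B x := ((r ^+ 2)%R%:E * (G x)%:E + (`|M| * 8)%R%:E * (weight x)%:E)%E.
have GW : {ae lebesgue3 R, forall x, setT x -> ((enorm3 x ^+ 2 * G x)%:E <= B x)%E}.
  apply: (@filterS _ (almost_everywhere (lebesgue3 R)) _ _ _ _ GM) => x Gx _.
  rewrite /B -!EFinM -EFinD lee_fin.
  have e0 := enorm3_ge0 x; have [rx|rx] := leP r (enorm3 x).
    have [r1 rr] : 1 <= enorm3 x /\ r0 <= enorm3 x.
      by split; rewrite (le_trans _ rx)// le_max lexx ?orbT.
    apply: (@le_trans _ _ (enorm3 x ^+ 2 * (`|M| * enorm3 x `^ (- 8)))).
      rewrite ler_wpM2l ?sqr_ge0// (le_trans (ler_norm _))// (le_trans (Gx rr))//.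
      by rewrite ler_wpM2r ?powR_ge0// ler_norm.
    rewrite mulrCA -[`|M| * 8 * _]mulrA; apply: (@le_trans _ _ (`|M| * (8 * weight x))).
      by rewrite ler_wpM2l// weight_enorm3.
    by rewrite lerDr mulr_ge0// sqr_ge0.
  apply: (@le_trans _ _ (r ^+ 2 * G x)).
    by rewrite ler_wpM2r// !expr2 ler_pM// ltW.
  by rewrite lerDl mulr_ge0 ?weight_ge0// mulr_ge0.
have iB : (lebesgue3 R).-integrable setT B by apply: integrableD => //; exact: integrableZl.
have B0 x : (0 <= B x)%E.
  rewrite /B -!EFinM -EFinD lee_fin; apply: addr_ge0; first by rewrite mulr_ge0// sqr_ge0.
  by rewrite mulr_ge0 ?weight_ge0// mulr_ge0.
exists (fine (\int[lebesgue3 R]_x B x)); first by rewrite fine_ge0// integral_ge0.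
rewrite fineK; last exact: integrable_fin_num.
apply: ae_ge0_le_integral => //.
- by move=> x _; rewrite lee_fin mulr_ge0// sqr_ge0.
- by apply/measurable_EFinP; exact: measurable_funM.
- exact: measurable_int iB.
Qed.

(* At rate 8 the kernel would have a finite second moment, so one minus its
   Fourier transform would be [O(|z|^2)] at 0, whereas it is at least of order
   [|z|^(2 g)] with [g < 1]. *)
Lemma not_decays_at_rate8 R d (T : measurableType d) (P : probability T R)
    (X : T -> R) (b g a : R) :
  0 < b < 1 -> 0 < g < 1 -> 1 <= g * 2 -> 0 < a ->
  measurable_fun setT X -> (forall t, 0 < X t) ->
  (forall l, 0 <= l ->
    (\int[P]_t (expR (- (l * X t)))%:E = (mittag_leffler b (- (a * l `^ g)))%:E)%E) ->
  ~ decays_at_rate (heat_mix P X) 8.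
Proof.
move=> b01 /andP[g0 g1] g2 a0 mX X0 LX D.
have [K K0 GK] := second_moment_of_decay (measurable_heat_mix P mX X0)
  (heat_mix_ge0 P X) (integrable_heat_mix P mX X0) D.
have [c c0 lo] := mittag_leffler_lower b01.
have mn := @measurable_sqr_enorm3 R.
(* At the frequency [(0, 0, s)], one minus the symbol is at least [c a s^(2 g)] by
   [mittag_leffler_lower], and at most [s^2 K] by the second moment. *)
have key (s : R) : 0 <= s -> a * (s * s) `^ g <= 1 -> c * (a * (s * s) `^ g) <= s * s * K.
  move=> s0 a1; apply: (le_trans (lo _ _)).
    by rewrite a1 mulr_ge0 ?powR_ge0// ltW.
  have zz : dot3 (0, 0, s) (0, 0, s) = s * s by rewrite /dot3/= !mul0r !add0r.
  rewrite -lee_fin -zz -(@integral_heat_mix_cos _ _ _ P X (fun l => mittag_leffler b (- (a * l `^ g))) _ mX X0 LX).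
  apply: (@le_trans _ _ (\int[lebesgue3 R]_x ((s * s)%:E * (enorm3 x ^+ 2 * heat_mix P X x)%:E))%E).
    apply: ge0_le_integral => //.
    - by move=> x _; rewrite lee_fin mulr_ge0 ?heat_mix_ge0// subr_ge0 cos_le1.
    - apply/measurable_EFinP; apply: measurable_funM; first exact: measurable_heat_mix.
      by apply: measurable_funB => //; exact: measurable_cos_dot3.
    - apply: measurable_funeM; apply/measurable_EFinP; apply: measurable_funM => //.
      exact: measurable_heat_mix.
    - move=> x _; rewrite -EFinM lee_fin mulrA [leRHS]mulrC ler_wpM2l ?heat_mix_ge0//.
      apply: le_trans (oneB_cos_le _) _.
      rewrite sqr_enorm3 /dot3/= !mul0r !add0r exprMn -expr2 ler_wpM2l ?sqr_ge0//.
      by rewrite -!expr2 lerDr addr_ge0// sqr_ge0.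
  rewrite ge0_integralZl//.
  - by rewrite zz [leRHS]EFinM lee_wpmul2l// lee_fin mulr_ge0.
  - apply/measurable_EFinP; apply: measurable_funM => //; exact: measurable_heat_mix.
  - by move=> x _; rewrite lee_fin mulr_ge0 ?sqr_ge0 ?heat_mix_ge0.
  - by rewrite lee_fin mulr_ge0.
(* The bounds on [e] yield in turn [l^g <= e], then [a l^g <= 1], which allows the use of [key], and
   finally [e K < c a]. The choice of [l] makes [l = l^g e], so [key] gives [c a <= e K], a
   contradiction. *)
pose e := Num.min 1 (Num.min a^-1 (c * a / (2 * (K + 1)))).
have e0 : 0 < e.
  by rewrite !lt_min ltr01 invr_gt0 a0 divr_gt0 ?mulr_gt0// ltr_wpDl.
have [e1 ea ec] : [/\ e <= 1, e <= a^-1 & e <= c * a / (2 * (K + 1))].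
  by split; rewrite /e !ge_min lexx ?orbT.
pose l := e `^ (1 - g)^-1; have l0 : 0 < l by exact: powR_gt0.
have g1' : 1 - g != 0 by rewrite subr_eq0 gt_eqF.
have lg : l `^ (1 - g) = e by rewrite -powRrM mulVf// powRr1// ltW.
have ll : l `^ g * e = l.
  by rewrite -lg -powRD; [rewrite subrKC powRr1// ltW|rewrite subrKC oner_eq0].
pose s := Num.sqrt l; have ss : s * s = l by rewrite -expr2 sqr_sqrtr// ltW.
(* Here [l^g] is [e] to the power [g / (1 - g)], which is at least 1 because [g >= 1 / 2]. *)
have lge : l `^ g <= e.
  rewrite -powRrM; apply: ge1r_powR; first by rewrite e0.
  by rewrite mulrC ler_pdivlMr ?subr_gt0//; lra.
have al1 : a * l `^ g <= 1.
  by rewrite (le_trans (ler_wpM2l (ltW a0) lge))// -ler_pdivlMl// mulr1.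
have := key s (sqrtr_ge0 _); rewrite ss => /(_ al1); rewrite -[X in _ <= X * K]ll => h.
have lg0 : 0 < l `^ g by exact: powR_gt0.
have : c * a <= e * K by rewrite -(ler_pM2l lg0); move: h; lra.
apply/negP; rewrite -ltNge.
apply: (@le_lt_trans _ _ (c * a / (2 * (K + 1)) * K)); first by rewrite ler_wpM2r.
rewrite mulrAC ltr_pdivrMr; last by rewrite mulr_gt0// ltr_wpDl.
by rewrite ltr_pM2l ?mulr_gt0//; lra.
Qed.

Lemma continuous_dot3 R (e : R * R * R) : continuous (fun p : R * R * R => dot3 p e).
Proof.
move=> p; rewrite /dot3.
have c1 : {for p, continuous (fun p : R * R * R => p.1)} by exact: cvg_fst.
have c2 : {for p, continuous (fun p : R * R * R => p.2)} by exact: cvg_snd.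
have c11 : {for p, continuous (fun p : R * R * R => p.1.1)}.
  by apply: (continuous_comp c1); exact: cvg_fst.
have c12 : {for p, continuous (fun p : R * R * R => p.1.2)}.
  by apply: (continuous_comp c1); exact: cvg_snd.
have cM (f : R * R * R -> R) (c : R) : {for p, continuous f} -> {for p, continuous (fun p => f p * c)}.
  by move=> cf; apply: continuousM => //; exact: cst_continuous.
exact: (continuousD (continuousD (cM _ _ c11) (cM _ _ c12)) (cM _ _ c2)).
Qed.

Lemma differentiable_dot3 R (e p : R * R * R) :
  differentiable (fun p : R * R * R => dot3 p e) p.
Proof.
have lin : linear_for *:%R (fun p : R * R * R => dot3 p e).
  by move=> c x y; rewrite /dot3/= /GRing.scale/=; ring.
pose L : {linear (R * R * R)%type -> R} := HB.pack (fun p : R * R * R => dot3 p e)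
  (GRing.isLinear.Build _ _ _ _ _ lin).
by apply: (@linear_differentiable _ _ _ L); exact: continuous_dot3.
Qed.

Lemma derive_line R (F : R * R * R -> R) (p v : R * R * R) (d : R) :
  is_derive (0 : R) (1 : R) (fun s => F (p + s *: v)) d -> 'D_v F p = d.
Proof.
move=> dF; rewrite -(@derive_val _ _ _ _ _ _ _ dF) /derive.
have E : (fun h : R => h^-1 *: (((fun s => F (p + s *: v)) \o shift 0) (h *: 1) - F (p + 0 *: v))) =
         (fun h : R => h^-1 *: ((F \o shift p) (h *: v) - F p)).
  apply/funext => h /=.
  by rewrite scale0r !addr0 (_ : h%:A = h) ?[h *: v + p]addrC//; exact: mulr1.
by rewrite E.
Qed.

(** * Uniqueness of the kernel *)

Definition coord3 R (i : 'I_3) (p : R * R * R) : R := dot3 p (basis3 R i).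

(** In the application [q i] is 1 or 0 and turns the cutoff in the [i]-th coordinate on or off. *)
Definition expt R (k c q : 'I_3 -> R) (i : 'I_3) (p : R * R * R) : R :=
  q i * expR (k i * coord3 i p + c i).

Definition test_base R (k c q : 'I_3 -> R) (p : R * R * R) : R :=
  expR (- (dot3 p p + (expt k c q 0 p + expt k c q 1 p + expt k c q 2 p))).

(* Stable under differentiation, and rich enough to approximate orthant
   indicators (times a Gaussian). *)
Inductive test_class R (k c q : 'I_3 -> R) : (R * R * R -> R) -> Prop :=
| test_class_base : test_class k c q (test_base k c q)
| test_class_coord i f : test_class k c q f -> test_class k c q (fun p => coord3 i p * f p)
| test_class_expt i f : test_class k c q f -> test_class k c q (fun p => expt k c q i p * f p)
| test_class_lin a f g : test_class k c q f -> test_class k c q g ->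
    test_class k c q (fun p => a * f p + g p).

Lemma differentiable_expR R (g : R * R * R -> R) (p : R * R * R) :
  differentiable g p -> differentiable (fun p => expR (g p)) p.
Proof.
move=> dg; apply: (@differentiable_comp _ _ _ _ g (@expR R)) => //.
by apply/derivable1_diffP.
Qed.

Lemma differentiable_expt R (k c q : 'I_3 -> R) i p : differentiable (expt k c q i) p.
Proof.
apply: (@differentiableZ _ _ _ (fun p => expR (k i * coord3 i p + c i)) (q i)).
apply: differentiable_expR.
apply: differentiableD; last exact: differentiable_cst.
exact: (@differentiableZ _ _ _ (coord3 i) (k i) p (differentiable_dot3 _ _)).
Qed.

Lemma dot3E R (p : R * R * R) :
  dot3 p p = coord3 0 p * coord3 0 p + coord3 1 p * coord3 1 p + coord3 2 p * coord3 2 p.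
Proof. by rewrite /coord3 /basis3 /dot3/=; ring. Qed.

Lemma differentiable_test_class R (k c q : 'I_3 -> R) f p :
  test_class k c q f -> differentiable f p.
Proof.
have dc i : differentiable (@coord3 R i) p by exact: differentiable_dot3.
elim=> [|i g _ dg|i g _ dg|a g h _ dg _ dh].
- apply: differentiable_expR; apply: differentiableN; apply: differentiableD.
    rewrite (_ : (fun p => dot3 p p) = coord3 0 * coord3 0 + coord3 1 * coord3 1 + coord3 2 * coord3 2).
      by apply: differentiableD; [apply: differentiableD|]; exact: differentiableM.
    by apply/funext => x; exact: dot3E.
  by apply: differentiableD; [apply: differentiableD|]; exact: differentiable_expt.
- exact: (differentiableM (dc i) dg).
- exact: (differentiableM (differentiable_expt k c q i p) dg).
- exact: (differentiableD (differentiableZ _ dg) dh).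
Qed.

Lemma is_derive_coord3 R (p v : R * R * R) (i : 'I_3) (s : R) :
  is_derive s (1 : R) (fun s => coord3 i (p + s *: v)) (coord3 i v).
Proof.
rewrite (_ : (fun s : R => _) = (fun s : R => coord3 i p + coord3 i v * s)); last first.
  by apply/funext => r; rewrite /coord3 dot3_line.
apply: (is_derive_eq (is_deriveD (is_derive_cst (coord3 i p) s 1) (is_derive_mull (coord3 i v) s))).
by rewrite add0r.
Qed.

Lemma is_derive_expt R (k c q : 'I_3 -> R) (p v : R * R * R) (i : 'I_3) :
  is_derive (0 : R) (1 : R) (fun s => expt k c q i (p + s *: v)) (k i * coord3 i v * expt k c q i p).
Proof.
have d1 : is_derive (0 : R) (1 : R) (fun s => k i * coord3 i (p + s *: v) + c i) (k i * coord3 i v).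
  apply: (is_derive_eq (is_deriveD (is_deriveZ (k i) (is_derive_coord3 p v i 0))
    (is_derive_cst (c i) (0 : R) 1))).
  by rewrite addr0.
apply: (is_derive_eq (is_deriveZ (q i) (is_derive1_comp (is_derive_expR _) d1))).
by rewrite scale0r addr0 /expt /GRing.scale/=; ring.
Qed.

Lemma test_class0 R (k c q : 'I_3 -> R) : test_class k c q (fun=> 0).
Proof.
rewrite (_ : (fun=> 0) = (fun p => -1 * test_base k c q p + test_base k c q p)).
  by apply: test_class_lin; exact: test_class_base.
by apply/funext => p; rewrite mulN1r addNr.
Qed.

Lemma derive_test_class R (k c q : 'I_3 -> R) f (v : R * R * R) :
  test_class k c q f -> test_class k c q ('D_v f).
Proof.
elim=> [|i g Cg Dg|i g Cg Dg|a g h Cg Dg Ch Dh].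
(* The sum is nested and ends in 0 so that every term is one use of [test_class_lin]. *)
- rewrite (_ : 'D_v _ = (fun p => (-2 * coord3 0 v) * (coord3 0 p * test_base k c q p) +
    ((-2 * coord3 1 v) * (coord3 1 p * test_base k c q p) +
    ((-2 * coord3 2 v) * (coord3 2 p * test_base k c q p) +
    ((- (k 0 * coord3 0 v)) * (expt k c q 0 p * test_base k c q p) +
    ((- (k 1 * coord3 1 v)) * (expt k c q 1 p * test_base k c q p) +
    ((- (k 2 * coord3 2 v)) * (expt k c q 2 p * test_base k c q p) + 0))))))); last first.
    apply/funext => p; apply: derive_line.
    have dt i := is_derive_expt k c q p v i.
    have dx i := is_derive_coord3 p v i 0.
    have dd : is_derive (0 : R) (1 : R) (fun s => dot3 (p + s *: v) (p + s *: v))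
        (2 * coord3 0 v * coord3 0 p + 2 * coord3 1 v * coord3 1 p + 2 * coord3 2 v * coord3 2 p).
      rewrite (_ : (fun s => _) =
        (fun s => coord3 0 (p + s *: v)) * (fun s => coord3 0 (p + s *: v)) +
        (fun s => coord3 1 (p + s *: v)) * (fun s => coord3 1 (p + s *: v)) +
        (fun s => coord3 2 (p + s *: v)) * (fun s => coord3 2 (p + s *: v))); last first.
        by apply/funext => s; exact: dot3E.
      apply: (is_derive_eq (is_deriveD (is_deriveD (is_deriveM (dx 0) (dx 0))
        (is_deriveM (dx 1) (dx 1))) (is_deriveM (dx 2) (dx 2)))).
      by rewrite scale0r addr0 /GRing.scale/=; ring.
    have ds := is_deriveN (is_deriveD dd (is_deriveD (is_deriveD (dt 0) (dt 1)) (dt 2))).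
    apply: (is_derive_eq (is_derive1_comp (is_derive_expR _) ds)).
    by rewrite !fctE scale0r addr0 -/(test_base k c q p); ring.
  have B := test_class_base k c q.
  exact: (test_class_lin _ (test_class_coord 0 B) (test_class_lin _ (test_class_coord 1 B)
    (test_class_lin _ (test_class_coord 2 B) (test_class_lin _ (test_class_expt 0 B)
    (test_class_lin _ (test_class_expt 1 B) (test_class_lin _ (test_class_expt 2 B)
    (test_class0 k c q))))))).
- rewrite (_ : 'D_v _ = (fun p => coord3 i v * g p + coord3 i p * 'D_v g p)); last first.
    apply/funext => p; apply: derive_line.
    have dg := is_derive_line (differentiable_test_class (p + 0 *: v) Cg).
    apply: (is_derive_eq (is_deriveM (is_derive_coord3 p v i 0) dg)).
    by rewrite scale0r addr0 /GRing.scale/=; ring.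
  by apply: test_class_lin => //; exact: test_class_coord.
- rewrite (_ : 'D_v _ = (fun p => (k i * coord3 i v) * (expt k c q i p * g p) + expt k c q i p * 'D_v g p)); last first.
    apply/funext => p; apply: derive_line.
    have dg := is_derive_line (differentiable_test_class (p + 0 *: v) Cg).
    apply: (is_derive_eq (is_deriveM (is_derive_expt k c q p v i) dg)).
    by rewrite scale0r addr0 /GRing.scale/=; ring.
  by apply: test_class_lin; exact: test_class_expt.
- rewrite (_ : 'D_v _ = (fun p => a * 'D_v g p + 'D_v h p)); first exact: test_class_lin.
  apply/funext => p; apply: derive_line.
  have dg := is_derive_line (differentiable_test_class (p + 0 *: v) Cg).
  have dh := is_derive_line (differentiable_test_class (p + 0 *: v) Ch).
  apply: (is_derive_eq (is_deriveD (is_deriveZ a dg) dh)).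
  by rewrite scale0r addr0.
Qed.

Lemma exprn_le_oneD R (x : R) (n : nat) : 0 <= x -> x ^+ n <= 1 + (x ^+ 2) ^+ n.
Proof.
move=> x0; have [x1|x1] := leP x 1.
  by rewrite (le_trans (exprn_ile1 n x0 x1))// lerDl exprn_ge0// sqr_ge0.
have x11 := ltW x1.
rewrite -exprM mulnC exprM -[leLHS]mul1r.
have : 1 <= x ^+ n by rewrite exprn_ege1.
by rewrite mul1r expr2; nra.
Qed.

Lemma expRN3 R (x y z : R) :
  expR (- (x + y + z)) = expR (- x) * expR (- y) * expR (- z).
Proof. by rewrite !opprD !expRD. Qed.

(** The powers of the three [expt] factors are there for the induction: a coordinate factor raises
    [n] by one, an [expt] factor raises one [j i]. In the base case the Gaussian absorbs the powers
    of [|p|], and each [exp (- expt)] those of its own [expt]. *)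
Lemma test_class_le R (k c q : 'I_3 -> R) f (n : nat) (j : 'I_3 -> nat) :
  (forall i, 0 <= q i) -> test_class k c q f ->
  exists M : R, forall p, enorm3 p ^+ n *
    (expt k c q 0 p ^+ j 0 * expt k c q 1 p ^+ j 1 * expt k c q 2 p ^+ j 2) * `|f p| <= M.
Proof.
move=> q0 Cf; have t0 i p : 0 <= expt k c q i p by rewrite mulr_ge0 ?expR_ge0.
have w0 m (l : 'I_3 -> nat) p : 0 <= enorm3 p ^+ m *
    (expt k c q 0 p ^+ l 0 * expt k c q 1 p ^+ l 1 * expt k c q 2 p ^+ l 2).
  by rewrite !mulr_ge0 ?exprn_ge0 ?enorm3_ge0.
elim: Cf n j => [|i g _ IH|i g _ IH|a g h _ IHg _ IHh] n j.
- exists ((1 + n`!%:R) * ((j 0)`!%:R * (j 1)`!%:R * (j 2)`!%:R)) => p.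
  rewrite ger0_norm ?expR_ge0// /test_base opprD expRD (expRN3 (expt k c q 0 p)).
  have T i := exprn_expRN_le (j i) (t0 i p).
  have T0 i : 0 <= expt k c q i p ^+ j i * expR (- expt k c q i p).
    by rewrite mulr_ge0 ?expR_ge0 ?exprn_ge0.
  have E : enorm3 p ^+ n * expR (- dot3 p p) <= 1 + n`!%:R.
    have d0 := dot3_ge0 p; have := exprn_le_oneD n (enorm3_ge0 p); rewrite sqr_enorm3 => h.
    apply: (@le_trans _ _ ((1 + dot3 p p ^+ n) * expR (- dot3 p p))).
      by rewrite ler_wpM2r ?expR_ge0.
    rewrite mulrDl mul1r lerD//; last exact: exprn_expRN_le.
    by rewrite -expR0 ler_expR oppr_le0.
  rewrite [leLHS](_ : _ = (enorm3 p ^+ n * expR (- dot3 p p)) *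
    ((expt k c q 0 p ^+ j 0 * expR (- expt k c q 0 p)) *
     (expt k c q 1 p ^+ j 1 * expR (- expt k c q 1 p)) *
     (expt k c q 2 p ^+ j 2 * expR (- expt k c q 2 p)))); last by ring.
  apply: ler_pM => //; first by rewrite mulr_ge0 ?expR_ge0 ?exprn_ge0 ?enorm3_ge0.
    by apply: mulr_ge0 => //; exact: mulr_ge0.
  by apply: ler_pM => //; [exact: mulr_ge0|exact: ler_pM].
- have [M H] := IH n.+1 j; exists M => p; apply: le_trans (H p).
  have C : `|coord3 i p| <= enorm3 p.
    rewrite -ler_sqr ?nnegrE ?enorm3_ge0// real_normK ?num_real// sqr_enorm3 dot3E -!expr2.
    by have [->|->|->] := I3_cases i; have := sqr_ge0 (coord3 0 p);
      have := sqr_ge0 (coord3 1 p); have := sqr_ge0 (coord3 2 p); lra.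
  rewrite normrM exprSr -!mulrA ler_wpM2l ?exprn_ge0 ?enorm3_ge0// !mulrA.
  rewrite [leLHS](_ : _ = (expt k c q 0 p ^+ j 0 * expt k c q 1 p ^+ j 1 * expt k c q 2 p ^+ j 2) *
    (`|coord3 i p| * `|g p|)); last by rewrite !mulrA.
  rewrite [leRHS](_ : _ = (expt k c q 0 p ^+ j 0 * expt k c q 1 p ^+ j 1 * expt k c q 2 p ^+ j 2) *
    (enorm3 p * `|g p|)); last by ring.
  apply: ler_wpM2l; first by rewrite !mulr_ge0 ?exprn_ge0.
  by rewrite ler_wpM2r.
- have [M H] := IH n (fun l => (j l + (l == i))%N); exists M => p; apply: le_trans (H p).
  rewrite normrM (ger0_norm (t0 i p)) le_eqVlt; apply/orP; left; apply/eqP.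
  by have [->|->|->] := I3_cases i; rewrite /= ?addn0 ?addn1 ?exprSr; ring.
- have [M H] := IHg n j; have [N K] := IHh n j; exists (`|a| * M + N) => p.
  apply: le_trans (lerD (ler_wpM2l (normr_ge0 a) (H p)) (K p)).
  have := w0 n j p; move: (enorm3 p ^+ n * _) => W W0.
  by rewrite mulrCA -mulrDr ler_wpM2l// -normrM ler_normD.
Qed.

Lemma schwartz_test_class R (k c q : 'I_3 -> R) f :
  (forall i, 0 <= q i) -> test_class k c q f -> schwartz f.
Proof.
move=> q0 Cf s.
have Cs : test_class k c q (partials s f) by elim: s => //= i s IH; exact: derive_test_class.
split; first by move=> x; exact: differentiable_test_class Cs.
move=> n; have [M H] := @test_class_le _ k c q _ n (fun=> 0%N) q0 Cs; exists M => p.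
by have := H p; rewrite !expr0 !mulr1.
Qed.

(** * Orthants and Dynkin's theorem *)

(** [None] stands for the whole line, which the pi-system must contain and which corresponds to the
    absence of a cutoff. *)
Definition ray R (o : option R) : set (measurableTypeR R) :=
  if o is Some b then `]-oo, b[%classic else setT.

Definition in_ray R (o : option R) (s : R) : bool :=
  if o is Some b then s < b else true.

Lemma rayE R (o : option R) (s : R) : ray o s = in_ray o s.
Proof. by case: o => [b|]; rewrite /ray/= ?in_itv/= ?trueE. Qed.

Lemma cvg_expRN_nat R : expR (- n%:R) @[n --> \oo] --> (0 : R).
Proof.
apply/cvgrPdist_le => e e0; near=> n; rewrite sub0r normrN ger0_norm ?expR_ge0//.
apply: (le_trans (expRN_le_inv (ler0n _ n))).
rewrite -[leRHS]invrK lef_pV2 ?posrE ?invr_gt0 ?ltr_pwDl//.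
have : e^-1 <= n%:R; last by lra.
near: n; exists (Num.truncn e^-1).+1 => // n /= xn.
by rewrite ltW// (lt_le_trans (truncnS_gt _))// ler_nat.
Unshelve. all: by end_near. Qed.

(** The quadratic factor sends [n^2 (s - b) + n] to minus infinity for [s < b], while for [s >= b]
    it is at least [n]. At [s = b] the summand [n] alone decides for the limit 0, in accordance with
    the open end of the ray. *)
Lemma cvg_cutoff R (o : option R) (s : R) :
  expR (- (o%:R * expR (n%:R ^+ 2 * (s - odflt 0 o) + n%:R))) @[n --> \oo] --> ((in_ray o s)%:R : R).
Proof.
case: o => [b|] /=; last first.
  by apply: cvg_near_cst; apply: nearW => n; rewrite mul0r oppr0 expR0.
have [sb|bs] := ltP s b; rewrite [X in _ --> X]/=.
  have E0 : expR (n%:R ^+ 2 * (s - b) + n%:R) @[n --> \oo] --> (0 : R).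
    apply: (@squeeze_cvgr _ _ _ _ (fun=> 0) (fun n => expR (- n%:R))).
    - near=> n; rewrite expR_ge0/= ler_expR.
      have : 2 / (b - s) <= n%:R.
        near: n; exists (Num.truncn (2 / (b - s))).+1 => // n /= xn.
        by rewrite ltW// (lt_le_trans (truncnS_gt _))// ler_nat.
      rewrite ler_pdivrMr ?subr_gt0// => h; have := ler0n R n; rewrite expr2; nra.
    - exact: cvg_cst.
    - exact: cvg_expRN_nat.
  have : expR (- expR (n%:R ^+ 2 * (s - b) + n%:R)) @[n --> \oo] --> expR (- 0 : R).
    by apply: continuous_cvg; [exact: continuous_expR|exact: cvgN].
  by rewrite oppr0 expR0; under eq_fun do rewrite -[expR (_ + _)]mul1r.
apply: (@squeeze_cvgr _ _ _ _ (fun=> 0) (fun n => expR (- n%:R))).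
- near=> n; rewrite mul1r expR_ge0/= ler_expR lerN2.
  apply: le_trans (_ : n%:R ^+ 2 * (s - b) + n%:R <= _).
    by rewrite lerDr mulr_ge0 ?sqr_ge0// subr_ge0.
  by apply: le_trans (expR_ge1Dx _); rewrite lerDr.
- exact: cvg_cst.
- exact: cvg_expRN_nat.
Unshelve. all: by end_near. Qed.

(** Dynkin's argument along one coordinate [c], with [E] holding fixed the constraints on the
    others. Having [setT] in [G] makes the integral over [E] itself vanish, which settles
    complements. *)
Lemma integral_setI_eq0 R d d' (T : measurableType d) (T' : measurableType d')
    (m : {measure set T -> \bar R}) (H : T -> \bar R) (E : set T) (c : T -> T')
    (G : set (set T')) :
  measurable E -> measurable_fun setT c -> m.-integrable setT H ->
  d'.-measurable = <<s G >> -> setI_closed G -> G setT ->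
  (forall A, G A -> \int[m]_(x in E `&` c @^-1` A) H x = 0)%E ->
  forall A, measurable A -> (\int[m]_(x in E `&` c @^-1` A) H x = 0)%E.
Proof.
move=> mE mc iH GE GI GT G0 A mA.
have mEc B : measurable B -> measurable (E `&` c @^-1` B).
  by move=> mB; apply: measurableI => //; rewrite -[_ @^-1` _]setTI; exact: mc.
have iS (S : set T) : measurable S -> m.-integrable S H.
  by move=> mS; exact: (integrableS measurableT).
have mH (S : set T) : measurable S -> measurable_fun S H.
  by move=> mS; exact: measurable_int (iS _ mS).
apply: (@dynkin_induction _ _ G (fun A => \int[m]_(x in E `&` c @^-1` A) H x = 0)%E GE GI) => //.
- exact: G0.
- move=> S mS S0; have := G0 _ GT; rewrite preimage_setT setIT.
  rewrite {1}(_ : E = (E `&` c @^-1` S) `|` (E `&` c @^-1` (~` S))); last first.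
    by rewrite -setIUr -preimage_setU setUCr preimage_setT setIT.
  rewrite integral_setU; first by rewrite S0 add0e.
  + exact: mEc.
  + by apply: mEc; exact: measurableC.
  + by apply: mH; apply: measurableU; apply: mEc => //; exact: measurableC.
  + by rewrite /disj_set -setIIr -preimage_setI setICr preimage_set0 setI0.
- move=> F mF tF F0.
  rewrite preimage_bigcup setI_bigcupr integral_bigcup//.
  + by apply: eseries0 => k _ _; exact: F0.
  + apply/trivIsetP => i j _ _ ij; rewrite -setIIr -preimage_setI.
    by move/trivIsetP : tF => /(_ i j I I ij) ->; rewrite preimage_set0 setI0.
  + by move=> k; exact: mEc.
  + by apply: iS; apply: bigcup_measurable => k _; exact: mEc.
- by rewrite -GE.
Qed.

Lemma measurable_rays R :
  (((ocitv (R := R)).-sigma).-measurable) = <<s [set ray o | o in [set: option R]] >>.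
Proof.
apply/seteqP; split.
  rewrite RGenInftyO.measurableE; apply: sub_sigma_algebra2 => _ [b ->].
  by exists (Some b).
apply: smallest_sub; first exact: sigma_algebra_measurable.
move=> _ [[b|] _ <-]; last exact: measurableT.
exact: measurable_itv.
Qed.

Lemma setI_closed_rays R : setI_closed [set ray o | o in [set: option R]].
Proof.
move=> _ _ [[b|] _ <-] [[b'|] _ <-]; last 3 first.
- by exists (Some b) => //; rewrite setIT.
- by exists (Some b') => //; rewrite setTI.
- by exists None => //; rewrite setTI.
exists (Some (Num.min b b')) => //; apply/seteqP; split => x /=; rewrite !in_itv/= lt_min.
  by move/andP.
by move=> [-> ->].
Qed.

Lemma setI_closed_rect d d' (T : measurableType d) (T' : measurableType d') :
  setI_closed [set A `*` B | A in @measurable d T & B in @measurable d' T'].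
Proof.
move=> _ _ [A mA [B mB <-]] [A' mA' [B' mB' <-]].
by exists (A `&` A'); [exact: measurableI|exists (B `&` B'); [exact: measurableI|rewrite setXI]].
Qed.

(** Rays are replaced by Borel sets one coordinate at a time; boxes are then extended to measurable
    sets of the plane, and products of these to measurable sets of the space. *)
Lemma integral_rays_eq0 R (H : space3 R -> \bar R) :
  (lebesgue3 R).-integrable setT H ->
  (forall o1 o2 o3, \int[lebesgue3 R]_(x in (ray o1 `*` ray o2) `*` ray o3) H x = 0)%E ->
  ae_eq (lebesgue3 R) setT H (cst 0%E).
Proof.
move=> iH H0; have [h1 h2 h3] := measurable_fun3 R.
have mR := measurable_rays R; have IR := @setI_closed_rays R.
have TR : [set ray o | o in [set: option R]] setT by exists None.
have mray (o : option R) : measurable (ray o).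
  by rewrite [measurable]mR; apply: sub_sigma_algebra; exists o.
have S1 (A : set (measurableTypeR R)) (o2 o3 : option R) : measurable A ->
    (\int[lebesgue3 R]_(x in (A `*` ray o2) `*` ray o3) H x = 0)%E.
  have E B : (setT `*` ray o2) `*` ray o3 `&` (fun x : space3 R => x.1.1) @^-1` B =
    (B `*` ray o2) `*` ray o3.
    by apply/seteqP; split=> x /=; tauto.
  move=> mA; rewrite -E.
  apply: (@integral_setI_eq0 _ _ _ _ _ (lebesgue3 R) H _ _ _ _ h1 iH mR IR TR) => //.
    by apply: measurableX => //; exact: measurableX.
  by move=> _ [r _ <-]; rewrite E.
have S2 (A B : set (measurableTypeR R)) (o3 : option R) : measurable A -> measurable B ->
    (\int[lebesgue3 R]_(x in (A `*` B) `*` ray o3) H x = 0)%E.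
  move=> mA; have E C : (A `*` setT) `*` ray o3 `&` (fun x : space3 R => x.1.2) @^-1` C =
    (A `*` C) `*` ray o3.
    by apply/seteqP; split=> x /=; tauto.
  move=> mB; rewrite -E.
  apply: (@integral_setI_eq0 _ _ _ _ _ (lebesgue3 R) H _ _ _ _ h2 iH mR IR TR) => //.
    by apply: measurableX => //; exact: measurableX.
  by move=> _ [r _ <-]; rewrite E S1.
have S3 (A B C : set (measurableTypeR R)) : measurable A -> measurable B -> measurable C ->
    (\int[lebesgue3 R]_(x in (A `*` B) `*` C) H x = 0)%E.
  move=> mA mB; have E D : (A `*` B) `*` setT `&` (fun x : space3 R => x.2) @^-1` D =
    (A `*` B) `*` D.
    by apply/seteqP; split=> x /=; tauto.
  move=> mC; rewrite -E.
  apply: (@integral_setI_eq0 _ _ _ _ _ (lebesgue3 R) H _ _ _ _ h3 iH mR IR TR) => //.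
    by apply: measurableX => //; exact: measurableX.
  by move=> _ [r _ <-]; rewrite E S2.
have S4 (B : set (measurableTypeR R * measurableTypeR R)) (C : set (measurableTypeR R)) :
    measurable B -> measurable C -> (\int[lebesgue3 R]_(x in B `*` C) H x = 0)%E.
  move=> mB mC; have E D : setT `*` C `&` (fun x : space3 R => x.1) @^-1` D = D `*` C.
    by apply/seteqP; split=> x /=; tauto.
  rewrite -E.
  apply: (@integral_setI_eq0 _ _ _ _ _ (lebesgue3 R) H _ _ _ _ _ iH
    (@measurable_prod_measurableType _ _ _ _) (@setI_closed_rect _ _ _ _)) => //.
  - exact: measurableX.
  - exact: measurable_fst.
  - by exists setT => //; exists setT => //; rewrite setXTT.
  - by move=> _ [A1 mA1 [A2 mA2 <-]]; rewrite E S3.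
apply: (integral_ae_eq measurableT iH) => // E _ mE; rewrite integral_cst// mul0e.
rewrite -[E]setTI.
apply: (@integral_setI_eq0 _ _ _ _ _ (lebesgue3 R) H setT id _ _ _ iH
    (@measurable_prod_measurableType _ _ _ _) (@setI_closed_rect _ _ _ _)) => //.
- by exists setT => //; exists setT => //; rewrite setXTT.
- by move=> _ [A1 mA1 [A2 mA2 <-]]; rewrite setTI S4.
Qed.

Lemma coord3E R (p : R * R * R) :
  [/\ coord3 0 p = p.1.1, coord3 1 p = p.1.2 & coord3 2 p = p.2].
Proof. by split; rewrite /coord3 /dot3 /basis3/= !mulr0 mulr1 ?addr0 ?add0r. Qed.

Definition sel3 (T : Type) (x y z : T) (i : 'I_3) : T :=
  if i == 0 then x else if i == 1 then y else z.

(* Here [o%:R] is 1 if [o] is [Some b] and 0 if it is [None]. *)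
Definition cutoff R (n : nat) (o : option R) (s : R) : R :=
  expR (- (o%:R * expR (n%:R ^+ 2 * (s - odflt 0 o) + n%:R))).

Lemma cutoff_itv R (n : nat) (o : option R) (s : R) : 0 <= cutoff n o s <= 1.
Proof.
by rewrite /cutoff expR_ge0/= -expR0 ler_expR oppr_le0 mulr_ge0 ?expR_ge0// ler0n.
Qed.

Lemma schwartz_cutoff R (n : nat) (u v w : option R) :
  exists2 f : R * R * R -> R, schwartz f &
    forall y, f (0 - y) =
      expR (- dot3 y y) * (cutoff n u y.1.1 * cutoff n v y.1.2 * cutoff n w y.2).
Proof.
pose b := sel3 (odflt 0 u) (odflt 0 v) (odflt 0 w).
(* The sign is reversed because the function is evaluated at [- y]; [c] then supplies
   [n - n^2 b]. *)
pose k (i : 'I_3) : R := - n%:R ^+ 2.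
pose c (i : 'I_3) : R := n%:R - n%:R ^+ 2 * b i.
pose q := sel3 (u%:R : R) v%:R w%:R.
have q0 i : 0 <= q i by rewrite /q /sel3; case: ifP => _ //; case: ifP.
exists (test_base k c q).
  by apply: (schwartz_test_class q0); exact: test_class_base.
move=> y; rewrite sub0r /test_base opprD expRD.
rewrite (_ : dot3 (- y) (- y) = dot3 y y); last by rewrite /dot3/=; ring.
rewrite (expRN3 (expt k c q 0 (- y))); congr (_ * _).
have T (i : 'I_3) (z : R) : coord3 i (- y) = - z ->
    expt k c q i (- y) = q i * expR (n%:R ^+ 2 * (z - b i) + n%:R).
  by move=> cz; rewrite /expt cz; congr (_ * expR _); rewrite /k /c; ring.
have [c0 c1 c2] := coord3E (- y).
by rewrite (T 0 _ c0) (T 1 _ c1) (T 2 _ c2).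
Qed.

(** Comparing both convolutions at the single point 0 shows that the difference [D] integrates to 0
    against every reflected Schwartz function. As [D] need not be integrable, it is multiplied by a
    Gaussian, which never vanishes and is cancelled at the end. *)
Lemma kernel_unique R (m : R * R * R -> R[i]) (G G' : R * R * R -> R) :
  is_convolution_kernel m G -> is_convolution_kernel m G' ->
  {ae lebesgue3 R, forall x, G x = G' x}.
Proof.
move=> [mG kG] [mG' kG'].
pose D y := G y - G' y.
have intD f : schwartz f -> (lebesgue3 R).-integrable setT (fun y => (D y * f (0 - y))%:E) /\
    (\int[lebesgue3 R]_y (D y * f (0 - y))%:E = 0)%E.
  move=> sf; have [i1 e1] := kG f sf 0; have [i2 e2] := kG' f sf 0.
  have iD : (lebesgue3 R).-integrable setT (fun y => (D y * f (0 - y))%:E).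
    rewrite (_ : (fun y => _) = (fun y => (G y * f (0 - y))%:E - (G' y * f (0 - y))%:E)%E).
      exact: integrableB.
    by apply/funext => y; rewrite /D mulrBl EFinB.
  split => //; rewrite -EFin_Rintegral//; congr EFin.
  transitivity (\int[lebesgue3 R]_y (G y * f (0 - y) - G' y * f (0 - y))).
    by apply: eq_Rintegral => y _; rewrite /D mulrBl.
  rewrite RintegralB//; apply/eqP; rewrite subr_eq0; apply/eqP.
  by have := etrans e1 (esym e2) => -[].
pose H y := (D y * expR (- dot3 y y))%:E.
have iH : (lebesgue3 R).-integrable setT H.
  (* Without cutoffs the test function is the bare Gaussian, so the integrability of [H] is part of
     the definition of a kernel. *)
  have [f sf fE] := @schwartz_cutoff R 0 None None None.
  rewrite (_ : H = (fun y => (D y * f (0 - y))%:E)); first by case: (intD f sf).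
  by apply/funext => y; rewrite /H fE /cutoff !mul0r !oppr0 expR0 !mulr1.
have mH : measurable_fun setT H by exact: measurable_int iH.
have H0 u v w : (\int[lebesgue3 R]_(x in (ray u `*` ray v) `*` ray w) H x = 0)%E.
  pose h (n : nat) (y : R * R * R) := (D y * expR (- dot3 y y) *
    (cutoff n u y.1.1 * cutoff n v y.1.2 * cutoff n w y.2))%:E.
  have hE n : (lebesgue3 R).-integrable setT (h n) /\ (\int[lebesgue3 R]_y h n y = 0)%E.
    have [f sf fE] := schwartz_cutoff n u v w.
    rewrite (_ : h n = (fun y => (D y * f (0 - y))%:E)); first exact: intD.
    by apply/funext => y; rewrite /h fE; congr EFin; rewrite [RHS]mulrA.
  have c1 : (\int[lebesgue3 R]_y h n y @[n --> \oo])%E -->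
      (\int[lebesgue3 R]_y (D y * expR (- dot3 y y) *
        ((in_ray u y.1.1)%:R * (in_ray v y.1.2)%:R * (in_ray w y.2)%:R))%:E)%E.
    apply: (@dominated_cvg _ _ _ (lebesgue3 R) setT measurableT h _ (abse \o H)) => //.
    - by move=> n; case: (hE n) => /measurable_int.
    - move=> y _; apply: cvg_EFin; first exact: nearW.
      apply: cvgMr; apply: cvgM; [apply: cvgM|]; exact: cvg_cutoff.
    - exact: integrable_abse.
    - move=> n y _; rewrite /h /H /= lee_fin normrM ler_piMr// ger0_norm.
        have /andP[a0 a1] := cutoff_itv n u y.1.1; have /andP[b0 b1] := cutoff_itv n v y.1.2.
        have /andP[d0 d1] := cutoff_itv n w y.2.
        exact: (mulr_ile1 (mulr_ge0 a0 b0) d0 (mulr_ile1 a0 b0 a1 b1) d1).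
      by rewrite !mulr_ge0// expR_ge0.
  have c0 : (\int[lebesgue3 R]_y h n y @[n --> \oo])%E --> 0%E.
    rewrite (_ : (fun n => _) = (fun=> 0%E)); first exact: cvg_cst.
    by apply/funext => n; case: (hE n).
  have := cvg_unique _ c1 c0 => <- //.
  rewrite integral_mkcond; apply: eq_integral => y _; rewrite patchE.
  rewrite (_ : (y \in _) = [&& in_ray u y.1.1, in_ray v y.1.2 & in_ray w y.2]).
    by case: in_ray; case: in_ray; case: in_ray; rewrite /= ?mul1r ?mul0r ?mulr1 ?mulr0.
  apply/idP/idP; rewrite inE /= !rayE.
    by move=> [[-> ->] ->].
  by move=> /and3P[-> -> ->].
have := integral_rays_eq0 iH H0.
apply: (@filterS _ (almost_everywhere (lebesgue3 R))) => y /(_ I) [] /eqP.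
by rewrite mulf_eq0 expR_eq0 orbF /D subr_eq0 => /eqP.
Qed.

(** * Far field of the Mittag-Leffler kernel *)

Lemma mittag_leffler_symbolE R (nu alpha beta t : R) :
  mittag_leffler_symbol nu alpha beta t =
  fun z => (mittag_leffler beta (- (nu * t `^ beta * dot3 z z `^ (alpha / 2))))%:C%C.
Proof.
apply/funext => z; congr (real_complex _ (mittag_leffler beta _)).
by rewrite !mulNr /enorm3 -powR12_sqrt ?dot3_ge0// -powRrM [2^-1 * _]mulrC.
Qed.

Lemma heat_mix_far_field R d (T : measurableType d) (P : probability T R)
    (X : T -> R) (nu alpha beta t : R) (x : R * R * R) :
  0 < nu -> 0 < beta < 1 -> 0 < t ->
  measurable_fun setT X -> (forall s, 0 < X s) ->
  (forall l, 0 <= l -> (\int[P]_s (expR (- (l * X s)))%:E =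
    (mittag_leffler beta (- (nu * t `^ beta * l `^ (alpha / 2))))%:E)%E) ->
  0 < enorm3 x ->
  heat_mix P X x <= 31 * nu / Gamma (beta + 1) * (t `^ beta / enorm3 x `^ (3 + alpha)).
Proof.
move=> nu0 b01 t0 mX X0 LX r0; have r0' := ltW r0.
apply: (le_trans (heat_mix_le mX X0 LX r0)).
have z0 : 0 <= nu * t `^ beta * (enorm3 x ^- 2) `^ (alpha / 2).
  by rewrite !mulr_ge0 ?powR_ge0// ltW.
have c0 : 0 <= 31 / enorm3 x ^+ 3 by rewrite divr_ge0// exprn_ge0.
apply: (le_trans (ler_wpM2l c0 (mittag_leffler_upper b01 z0))).
rewrite powRD; last by rewrite (gt_eqF r0) implybT.
rewrite (powR_mulrn 3 r0') (_ : (enorm3 x ^- 2) `^ (alpha / 2) = (enorm3 x `^ alpha)^-1).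
  rewrite le_eqVlt; apply/orP; left; apply/eqP; field.
  rewrite (gt_eqF r0) !gt_eqF ?powR_gt0//.
  by rewrite Gamma_gt0//; case/andP : b01 => /ltW.
rewrite -powR_invn// -powRrM -powRN; congr (_ `^ _).
by field.
Qed.

Theorem proposition3p4 (R : realType) (nu alpha beta : R)
  (hnu : 0 < nu) (halpha : 1 < alpha < 2) (hbeta : 0 < beta < 1) :
  (forall t : R, 0 < t -> exists G : R * R * R -> R,
     is_convolution_kernel (mittag_leffler_symbol nu alpha beta t) G) /\
  (exists2 C : R, 0 < C &
     forall t : R, 0 < t -> forall G : R * R * R -> R,
       is_convolution_kernel (mittag_leffler_symbol nu alpha beta t) G ->
       [/\ {ae lebesgue3 R, forall x, 0 <= G x},
           (\int[lebesgue3 R]_x (G x)%:E)%E = 1%E,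
           {ae lebesgue3 R, forall x, t `^ (beta / alpha) <= enorm3 x ->
              G x <= C / Gamma (beta + 1) *
                     (t `^ beta / enorm3 x `^ (3 + alpha))}
         & decays_only_algebraically G]).
Proof.
have [a1 a2] := andP halpha.
have g01 : 0 < alpha / 2 < 1 by apply/andP; split; lra.
have mix (t : R) : 0 < t -> exists d (T : measurableType d) (P : probability T R) (X : T -> R),
    [/\ measurable_fun setT X, (forall s, 0 < X s) &
      forall l, 0 <= l -> (\int[P]_s (expR (- (l * X s)))%:E =
        (mittag_leffler beta (- (nu * t `^ beta * l `^ (alpha / 2))))%:E)%E].
  by move=> t0; apply: mittag_leffler_mixture => //; rewrite mulr_gt0// powR_gt0.
split.
  move=> t t0; have [d [T [P [X [mX X0 LX]]]]] := mix t t0.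
  exists (heat_mix P X); rewrite mittag_leffler_symbolE.
  exact: (@heat_mix_kernel _ _ _ P X (fun l => mittag_leffler beta (- (nu * t `^ beta * l `^ (alpha / 2))))).
(* 31 comes from [heat_le], and [nu] from the argument [nu t^beta |x|^(- alpha)] in the linear bound
   [mittag_leffler_upper]. The power of [t] stays outside, so the constant serves all times. *)
exists (31 * nu); first by rewrite mulr_gt0.
move=> t t0 G kG; have [d [T [P [X [mX X0 LX]]]]] := mix t t0.
have kH : is_convolution_kernel (mittag_leffler_symbol nu alpha beta t) (heat_mix P X).
  rewrite mittag_leffler_symbolE.
  exact: (@heat_mix_kernel _ _ _ P X (fun l => mittag_leffler beta (- (nu * t `^ beta * l `^ (alpha / 2))))).
(* From here on every claim about [G] is a claim about the average of heat kernels, up to a null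
   set. *)
have GH := kernel_unique kG kH.
have far x : t `^ (beta / alpha) <= enorm3 x ->
    heat_mix P X x <= 31 * nu / Gamma (beta + 1) * (t `^ beta / enorm3 x `^ (3 + alpha)).
  move=> tx; apply: heat_mix_far_field => //.
  exact: lt_le_trans (powR_gt0 _ t0) tx.
have ae (Q Q' : R * R * R -> Prop) : (forall x, G x = heat_mix P X x -> Q x -> Q' x) ->
    {ae lebesgue3 R, forall x, Q x} -> {ae lebesgue3 R, forall x, Q' x}.
  move=> QQ'; apply: (@filterS2 _ (almost_everywhere (lebesgue3 R)) _ _ _ _ _ GH) => x; exact: QQ'.
have aeT (Q : R * R * R -> Prop) : (forall x, G x = heat_mix P X x -> Q x) ->
    {ae lebesgue3 R, forall x, Q x}.
  by move=> GQ; apply: (@filterS _ (almost_everywhere (lebesgue3 R)) _ _ _ _ GH) => x; exact: GQ.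
split.
- by apply: aeT => x ->; exact: heat_mix_ge0.
- rewrite -(integral_heat_mix P mX X0); apply: ae_eq_integral => //.
  + by apply/measurable_EFinP; case: kG.
  + by apply/measurable_EFinP; exact: measurable_heat_mix.
  + by apply: aeT => x -> _.
- by apply: aeT => x ->; exact: far.
- split.
    exists (3 + alpha); first by lra.
    exists (31 * nu / Gamma (beta + 1) * t `^ beta), (t `^ (beta / alpha)).
    apply: aeT => x -> tx; rewrite ger0_norm ?heat_mix_ge0//.
    by rewrite powRN -mulrA; exact: far.
  exists 8 => -[M [r Gd]].
  have : decays_at_rate (heat_mix P X) 8 by exists M, r; apply: ae Gd => x ->.
  apply: (@not_decays_at_rate8 _ _ _ P X beta (alpha / 2) (nu * t `^ beta)) => //.
    by lra.
  by rewrite mulr_gt0// powR_gt0.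
Qed.
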